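(* Let $K$ be a measurable kernel on $\mathbb{R}^N$ with $K(x)=K(-x)\ge 0$ for every $x\in\mathbb{R}^N$, satisfying one of the following two assumptions: (Fractional type) $\min\{1,|h|\}\,K(h)\in L^1(\mathbb{R}^N)$, and there exist $C>0$ and $s\in(0,1)$ such that $K(h)\ge C|h|^{-N-s}$; (Integrable type) $K\in L^1(\mathbb{R}^N)$ with $\|K\|_1>0$, and $\liminf_{z\to 0}\big[K(z)-K(z+x)\big]>0$ for every $x\neq 0$. Then for any given lattice $G$ in $\mathbb{R}^N$ there exists a fundamental domain $D\in\mathcal{D}_G$ such that $$\mathrm{Per}_K(D)=\min_{E\in\mathcal{D}_G}\mathrm{Per}_K(E).$$
   Context: A lattice is a discrete subgroup $G$ of $(\mathbb{R}^N,+)$ of rank $N$. A measurable set $D\subset\mathbb{R}^N$ is a fundamental domain for $G$ if $\big|\mathbb{R}^N\setminus\bigcup_{g\in G}(D+g)\big|=0$ and $|D\cap(D+g)|=0$ for all $g\in G\setminus\{0\}$, where $|\cdot|$ is Lebesgue measure; $\mathcal{D}_G$ denotes the set of all fundamental domains for $G$. The nonlocal perimeter of a measurable set $E$ is $$\mathrm{Per}_K(E):=\int_E\int_{\mathbb{R}^N\setminus E}K(x-y)\,dx\,dy\in[0,+\infty].$$ *)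

(* Defs.v *)
(* MathComp-Analysis. *)
From HB Require Import structures.
From mathcomp Require Import all_boot all_order all_algebra.
From mathcomp Require Import all_classical all_reals all_analysis.

Set Implicit Arguments.
Unset Strict Implicit.
Unset Printing Implicit Defensive.

Import Order.TTheory GRing.Theory Num.Theory.
Import numFieldNormedType.Exports.

Local Open Scope classical_set_scope.
Local Open Scope ring_scope.

(* The library has the Lebesgue measure on the line only. As there, the
   N-dimensional one is obtained by the Caratheodory construction from the outer
   measure given by countable covers by half-open boxes, so that [measurable]
   on [RN R n] means Lebesgue measurable (and not just Borel). The dimension is
   N = n.+1, i.e. N >= 1: in dimension 0 no box is empty, and the infimum below
   would give infinite mass to the empty set. *)
Section lebesgueN.
Context {R : realType} {n : nat}.
Implicit Types (a b : 'rV[R]_n.+1) (A B : set 'rV[R]_n.+1).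
Local Open Scope ereal_scope.

Definition box a b : set 'rV[R]_n.+1 :=
  [set x | forall i, (a ord0 i < x ord0 i <= b ord0 i)%R].

Definition box_volume a b : \bar R :=
  (\prod_i Num.max 0 (b ord0 i - a ord0 i))%R%:E.

Definition lebesgue_outer A : \bar R :=
  ereal_inf [set \sum_(k <oo) box_volume (F k).1 (F k).2 |
             F in [set F : nat -> 'rV[R]_n.+1 * 'rV[R]_n.+1 |
                   A `<=` \bigcup_k box (F k).1 (F k).2]].

Lemma box_volume_ge0 a b : 0 <= box_volume a b.
Proof. by rewrite lee_fin prodr_ge0// => i _; rewrite le_max lexx. Qed.

Lemma lebesgue_outer_ge0 A : 0 <= lebesgue_outer A.
Proof.
apply: le_ereal_inf_tmp => _ [F _ <-].
by apply: nneseries_ge0 => k _ _; exact: box_volume_ge0.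
Qed.

Lemma lebesgue_outer0 : lebesgue_outer set0 = 0.
Proof.
apply/eqP; rewrite eq_le lebesgue_outer_ge0 andbT.
apply: ereal_inf_lbound; exists (fun=> (0%R, 0%R)) => //=.
apply: eseries0 => k _ _; rewrite /box_volume big_ord_recl.
by rewrite subrr maxxx mul0r.
Qed.

Lemma le_lebesgue_outer : {homo lebesgue_outer : A B / A `<=` B >-> A <= B}.
Proof.
move=> A B AB; apply: ereal_inf_le_tmp => _ [F BF <-]; exists F => //.
exact: subset_trans BF.
Qed.

Lemma lebesgue_outer_sigma_subadditive : sigma_subadditive lebesgue_outer.
Proof.
move=> A; have [[i ioo]|] := pselect (exists i, lebesgue_outer (A i) = +oo).
  rewrite (eseries_pinfty _ _ ioo) ?leey// => k _.
  by rewrite -ltNye (lt_le_trans _ (lebesgue_outer_ge0 _)).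
rewrite -forallNE => Aoo.
suff add2e (e : {posnum R}) : lebesgue_outer (\bigcup_k A k) <=
    \sum_(i <oo) lebesgue_outer (A i) + e%:num%:E.
  by apply/lee_addgt0Pr => _/posnumP[].
rewrite (le_trans _ (epsilon_trick _ _ _))//; last first.
  by move=> k; exact: lebesgue_outer_ge0.
pose vol (p : 'rV[R]_n.+1 * 'rV[R]_n.+1) := box_volume p.1 p.2.
pose P k (F : nat -> 'rV[R]_n.+1 * 'rV[R]_n.+1) :=
  A k `<=` \bigcup_j box (F j).1 (F j).2 /\
  \sum_(j <oo) vol (F j) <= lebesgue_outer (A k) + (e%:num / (2 ^ k.+1)%:R)%:E.
have [G PG] : {G & forall k, P k (G k)}.
  apply: (@choice _ _ P) => k.
  have fA : lebesgue_outer (A k) \is a fin_num.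
    by rewrite ge0_fin_numE ?lebesgue_outer_ge0// ltey; apply/eqP/Aoo.
  have ek : (0 < e%:num / (2 ^ k.+1)%:R)%R by [].
  have [_ [F AF <-] ltF] := lb_ereal_inf_adherent ek fA.
  by exists F; split => //; exact: ltW.
pose vG := vol \o uncurry G.
have vG_ge0 p : 0 <= vG p by exact: box_volume_ge0.
apply: (@le_trans _ _ (\esum_(p in setT) vG p)).
  apply: ereal_inf_lbound => /=.
  have /card_esym/ppcard_eqP[f] := card_nat2.
  exists (uncurry G \o f) => [t [i _ /(PG i).1 [j _ Gijt]]|].
    by exists (f^-1%FUN (i, j)) => //=; rewrite invK ?inE.
  rewrite -(esum_pred_image vG _ xpredT) ?[fun=> _]set_true//.
  by rewrite image_eq.
rewrite (_ : esum _ _ = \sum_(i <oo) \sum_(j <oo) vol (G i j)).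
  apply: lee_nneseries => [i _ _|i _]; last exact: (PG i).2.
  by apply: nneseries_ge0 => j _ _; exact: box_volume_ge0.
pose J (i : nat) : set (nat * nat) := [set (i, j) | j in setT].
rewrite (_ : setT = \bigcup_k J k); last first.
  by rewrite predeqE => -[a b]; split => // _; exists a => //; exists b.
rewrite esum_bigcupT /=; last 2 first.
- apply/trivIsetP => i j _ _ ij.
  rewrite predeqE => -[p q] /=; split => //= -[] [_] _ [<-{p} _].
  by move=> [q' _] [] /esym/eqP; rewrite (negbTE ij).
- by move=> ?; exact: vG_ge0.
rewrite -(image_id [set: nat]) -fun_true esum_pred_image//; last first.
  by move=> i _; apply: esum_ge0 => ? _; exact: vG_ge0.
apply: eq_eseriesr => /= i _.
rewrite -(esum_pred_image vG (pair i) predT)//=; last first.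
  by move=> ? ? _ _; exact: (@can_inj _ _ _ snd).
by congr esum; rewrite predeqE => -[a b]; split; move=> [q _ <-]; exists q.
Qed.

HB.instance Definition _ := isOuterMeasure.Build R 'rV[R]_n.+1 lebesgue_outer
  lebesgue_outer0 lebesgue_outer_ge0 le_lebesgue_outer
  lebesgue_outer_sigma_subadditive.

End lebesgueN.

Definition RN (R : realType) (n : nat) :=
  caratheodory_type (@lebesgue_outer R n).

Definition lebesgueN {R : realType} {n : nat} : set (RN R n) -> \bar R :=
  lebesgue_outer.
HB.instance Definition _ (R : realType) n := isMeasure.Build _ (RN R n) R
  lebesgueN (@caratheodory_measure0 _ _ (@lebesgue_outer R n))
  (@caratheodory_measure_ge0 _ _ (@lebesgue_outer R n))
  (@caratheodory_measure_sigma_additive _ _ (@lebesgue_outer R n)).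

Section lattices.
Context {R : realType} {n : nat}.
Implicit Types (G D : set 'rV[R]_n.+1).

Definition subgroup G := G 0 /\ forall x y, G x -> G y -> G (x - y).

Definition discrete_set G := G `<=` isolated G.

Definition zfree k (v : 'I_k -> 'rV[R]_n.+1) :=
  forall c : 'I_k -> int, \sum_i v i *~ c i = 0 -> forall i, c i = 0.

(* Rank as an abelian group: the maximal number of Z-independent elements. *)
Definition has_rank G k :=
  (exists v : 'I_k -> 'rV[R]_n.+1, (forall i, G (v i)) /\ zfree v) /\
  (forall v : 'I_k.+1 -> 'rV[R]_n.+1, (forall i, G (v i)) -> ~ zfree v).

Definition lattice G := [/\ subgroup G, discrete_set G & has_rank G n.+1].

Definition translate D (g : 'rV[R]_n.+1) := [set x + g | x in D].

Definition fundamental_domain G D :=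
  [/\ measurable (D : set (RN R n)),
      lebesgueN (~` \bigcup_(g in G) translate D g) = 0%E &
      forall g, G g -> g != 0 -> lebesgueN (D `&` translate D g) = 0%E].

End lattices.

Section kernels.
Context {R : realType} {n : nat}.
Implicit Types (K : 'rV[R]_n.+1 -> R) (E : set 'rV[R]_n.+1).

(* Euclidean norm; the library's norm on matrices is the sup norm. *)
Definition enorm (x : 'rV[R]_n.+1) : R := Num.sqrt (\sum_i x ord0 i ^+ 2).

Definition Per K E : \bar R :=
  (\int[lebesgueN]_(y in (E : set (RN R n)))
     \int[lebesgueN]_(x in (~` E : set (RN R n))) (K (x - y)%R)%:E)%E.

(* At the origin the lower bound is void: K is real-valued, and [0 `^ _] would
   not be the intended infinite value. *)
Definition fractional_type K :=
  lebesgueN.-integrable [set: RN R n]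
    (fun h : 'rV[R]_n.+1 => (Num.min 1 (enorm h) * K h)%:E) /\
  exists C s : R, [/\ 0 < C, 0 < s < 1 &
    forall h : 'rV[R]_n.+1, h != 0 -> C * enorm h `^ (- n.+1%:R - s) <= K h].

Definition integrable_type K :=
  [/\ lebesgueN.-integrable [set: RN R n] (EFin \o K),
      (0 < Lnorm (@lebesgueN R n) 1 (EFin \o K))%E &
      forall x : 'rV[R]_n.+1, x != 0 ->
        (0 < limf_einf (fun z => (K z - K (z + x))%R%:E) (0%R : 'rV[R]_n.+1)^')%E].

End kernels.

(* Main.v *)
(* Fix a measurable tile X, meeting every coset of G exactly once, and describe a
   fundamental domain E by the indicators on X of its pieces (E - g) /\ X. Relax
   these indicators to functions f_g : X -> [0, 1] with sum 1. The perimeter is then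
     sum_h int_(X x X) K(x - y + h) (1 - sum_g f_g(y) f_(g+h)(x)) dy dx.
   Along an ultrafilter the pieces of a minimizing sequence that carry mass, each
   followed up to a translation of the labels, converge weakly, and products
   f_g(y) f_(g+h)(x) pass to the limit because the two variables are independent;
   as the labels escaping to infinity can only lower the agreement, the relaxed
   functional has a minimizer. If two pieces a, b of it were both at least t > 0 on
   a small set A, then moving the amount t on A from b to a and from a to b would
   change the sum of the two energies by 2t^2 times
     int_(A x A) K(x - y + b - a) + K(x - y + a - b) - 2 K(x - y) < 0,
   where the sign comes from the behaviour of K at the origin. Hence a minimizer of
   finite energy is an indicator, that is, a fundamental domain. *)

Require Import Defs.
From HB Require Import structures.
From mathcomp Require Import all_boot all_order all_algebra finmap.
From mathcomp Require Import all_classical all_reals all_analysis.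
From mathcomp Require Import measurable_realfun.
From mathcomp Require Import ring lra.

Import Order.TTheory GRing.Theory Num.Theory.
Import numFieldNormedType.Exports.

Local Open Scope classical_set_scope.
Local Open Scope ring_scope.

Set Implicit Arguments.
Unset Strict Implicit.
Unset Printing Implicit Defensive.

(** * Weak limits along an ultrafilter *)

(** A minimizing sequence is not confined: its pieces may run off along the lattice or split into
    ever smaller ones. Labels are therefore enumerated greedily by mass: one missed by the first n
    picks has mass at most [2 * M / n], uniformly along the sequence. For two profiles followed in
    this way the ultrafilter decides whether the difference of their labels is eventually a given
    [h], with no diagonal extraction. Lost mass is put back on label 0, which can only raise the
    agreement. Hence only upper semicontinuity of the agreement on measurable sets of pairs is
    needed in the limit; [K] enters afterwards, through simple functions from below, so that its
    singularity does no harm. A second obstacle is measurability: for a Lebesgue measurable [K], the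
    function [K (x - y)] need not be measurable for the product of the Lebesgue sigma-algebras, as
    Fubini requires. [K] is cut off on a null set outside which its superlevel sets are built from
    boxes; since translates of a null set are null, no integral over a single variable changes. *)

Lemma ultra_ereal_cvg (R : realType) (I : Type) (U : set_system I)
    (UU : UltraFilter U) (M : R) (a : I -> \bar R) :
  (forall i, (0 <= a i <= M%:E)%E) ->
  exists l : \bar R, a i @[i --> U] --> l /\ (0 <= l <= M%:E)%E.
Proof.
move=> aM.
have afin i : a i \is a fin_num.
  have /andP[a0 aM'] := aM i.
  by rewrite ge0_fin_numE// (le_lt_trans aM')// ltry.
have : UltraFilter ((fine \o a) i @[i --> U]).
  split; first exact: fmap_proper_filter.
  move=> G PG UG; rewrite eqEsubset; split => // B GB.
  have [//|nB] := in_ultra_setVsetC ((fine \o a) @^-1` B) UU.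
  have /filter_ex[] : G (B `&` ~` B) by apply: filterI => //; exact: UG.
  by move=> x [].
move=> FU.
have := @segment_compact R 0 M; rewrite compact_ultra => /(_ _ FU).
case.
  apply: (@filterE _ U) => i; rewrite /= in_itv/= -!lee_fin fineK//; exact: aM.
move=> l [lM /= cl]; exists l%:E; split; last first.
  by move: lM; rewrite /= in_itv /= !lee_fin.
apply/fine_cvgP; split; first by apply: filterE => i; exact: afin.
exact: cl.
Qed.

Section limit_measure.
Context d (T : measurableType d) (R : realType).
Context (mu : {measure set T -> \bar R}) (muoo : (mu setT < +oo)%E).
Context (U : set_system nat) (UU : UltraFilter U) (w : nat -> T -> R).
Hypothesis mw : forall k, measurable_fun setT (w k).
Hypothesis w01 : forall k x, 0 <= w k x <= 1.
Local Open Scope ereal_scope.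

Lemma integral_unit_bounds k A : measurable A ->
  0 <= \int[mu]_(x in A) (w k x)%:E <= mu A.
Proof.
move=> mA; apply/andP; split.
  by apply: integral_ge0 => x _; rewrite lee_fin; case/andP: (w01 k x).
rewrite -[leRHS]mul1e -integral_cst//; apply: ge0_le_integral => //.
- by move=> x _; rewrite lee_fin; case/andP: (w01 k x).
- by apply/measurable_EFinP; exact: measurable_funTS.
- by move=> x _; rewrite lee_fin; case/andP: (w01 k x).
Qed.

(** Setwise limits exist because an ultrafilter converges on bounded sequences, and finite
    additivity passes to them. Countable additivity comes from the domination by [mu]: the limit
    mass of a tail is at most its [mu]-mass, which tends to 0. *)
Lemma limit_measure_exists : exists nu : {finite_measure set T -> \bar R},
  (forall A, measurable A ->
     \int[mu]_(x in A) (w k x)%:E @[k --> U] --> nu A) /\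
  (forall A, measurable A -> nu A <= mu A).
Proof.
have mufin A : measurable A -> mu A \is a fin_num.
  move=> mA; rewrite ge0_fin_numE// (le_lt_trans _ muoo)//.
  by apply: le_measure => //; rewrite inE.
have H (A : set T) : exists l, measurable A ->
    \int[mu]_(x in A) (w k x)%:E @[k --> U] --> l /\ 0 <= l <= mu A.
  have [mA|nA] := pselect (measurable A); last by exists 0.
  have [l [cl lM]] := @ultra_ereal_cvg R _ U UU (fine (mu A))
    (fun k => \int[mu]_(x in A) (w k x)%:E)
    (fun k => ltac:(rewrite fineK ?mufin//; exact: integral_unit_bounds)).
  by exists l => _; rewrite fineK ?mufin in lM *.
have [lam0 lam0P] := choice H.
(* The value chosen off the measurable sets is arbitrary; 0 keeps the set function nonnegative on
   every set. *)
pose lam (A : set T) := if pselect (measurable A) then lam0 A else 0.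
have lamP A : measurable A ->
    \int[mu]_(x in A) (w k x)%:E @[k --> U] --> lam A.
  by move=> mA; rewrite /lam; case: pselect => // ?; case: (lam0P A mA).
have lam_ge0 A : 0 <= lam A.
  rewrite /lam; case: pselect => // mA.
  by have [_ /andP[]] := lam0P A mA.
have lam_le A : measurable A -> lam A <= mu A.
  move=> mA; rewrite /lam; case: pselect => // ?.
  by have [_ /andP[]] := lam0P A mA.
have lam00 : lam set0 = 0.
  apply/eqP; rewrite eq_le lam_ge0 andbT (le_trans (lam_le _ _))//.
  by rewrite measure0.
have lamU A B : measurable A -> measurable B -> [disjoint A & B] ->
    lam (A `|` B) = lam A + lam B.
  move=> mA mB AB.
  apply: (@cvg_unique _ (@ereal_hausdorff R) _ _ _ _ (lamP _ (measurableU _ _ mA mB))).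
  rewrite [X in X @ _](_ : _ = fun k => \int[mu]_(x in A) (w k x)%:E +
                         \int[mu]_(x in B) (w k x)%:E); last first.
    apply/funext => k; rewrite ge0_integral_setU//.
      by apply/measurable_EFinP; exact: measurable_funTS.
    by move=> x _; rewrite lee_fin; case/andP: (w01 k x).
  by apply: cvgeD; rewrite ?ge0_adde_def ?inE//; exact: lamP.
have lamsum (F : (set T)^nat) n : (forall i, measurable (F i)) -> trivIset setT F ->
    lam (\big[setU/set0]_(i < n) F i) = \sum_(i < n) lam (F i).
  move=> mF tF; elim: n => [|n IH]; first by rewrite !big_ord0 lam00.
  rewrite !big_ord_recr/= lamU ?IH//; first exact: bigsetU_measurable.
  apply/disj_setPRL => x Fx; rewrite -bigcup_mkord => -[i /= ik Fix].
  have : i = n by apply: (tF i n I I); exists x.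
  by move=> E; move: ik; rewrite E ltnn.
have sig : semi_sigma_additive lam.
  move=> F mF tF mUF.
  have -> : lam (\bigcup_n F n) = \sum_(i <oo) lam (F i); last first.
    by apply: is_cvg_nneseries => n _ _; exact: lam_ge0.
  have tail n : lam (\bigcup_n F n) =
      \sum_(i < n) lam (F i) + lam (\bigcup_n F n `\` \big[setU/set0]_(i < n) F i).
    rewrite -lamsum// -lamU.
    - by rewrite setDUK// => x; rewrite -bigcup_mkord => -[i _ ?]; exists i.
    - exact: bigsetU_measurable.
    - by apply: measurableD => //; exact: bigsetU_measurable.
    - by apply/disj_setPS => x [? []].
  apply/eqP; rewrite eq_le; apply/andP; split; last first.
    apply: lime_le; first by apply: is_cvg_nneseries.
    by apply: nearW => n; rewrite big_mkord (tail n) leeDl.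
  apply/lee_addgt0Pr => e e0.
  have mub := mufin _ mUF.
  have := @measure_semi_sigma_additive _ _ _ mu F mF tF mUF.
  rewrite -[mu (\bigcup_n _)]fineK// => /fine_cvgP[_ /cvgrPdist_lt /(_ e e0)].
  case=> N _ /(_ N (leqnn _)) /= HN.
  have mUN : measurable (\big[setU/set0]_(i < N) F i) by exact: bigsetU_measurable.
  rewrite (tail N); apply: leeD.
    by rewrite -(big_mkord xpredT (fun i => lam (F i))); exact: nneseries_lim_ge.
  apply: le_trans (lam_le _ _) _; first exact: measurableD.
  have muN : \sum_(0 <= i < N) mu (F i) = mu (\big[setU/set0]_(i < N) F i).
    by rewrite big_mkord measure_bigsetU.
  rewrite measureD ?ltey_eq ?mub// setIidr; last first.
    by move=> x; rewrite -bigcup_mkord => -[i _ ?]; exists i.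
  rewrite -[leLHS]fineK ?fin_numB ?mub ?mufin//.
  rewrite lee_fin fineB ?mufin//; apply/ltW/(le_lt_trans (ler_norm _)); move: HN; rewrite muN; apply.
pose mix := isMeasure.Build _ _ _ lam lam00 lam_ge0 sig.
pose nu : {measure set T -> \bar R} := HB.pack lam mix.
have lamfin : fin_num_fun lam.
  move=> A mA; rewrite ge0_fin_numE// (le_lt_trans (lam_le _ mA))//.
  by rewrite -ge0_fin_numE// mufin.
pose fmix := Measure_isFinite.Build _ _ _ nu lamfin.
pose fnu : {finite_measure set T -> \bar R} := HB.pack lam mix fmix.
by exists fnu.
Qed.
End limit_measure.

(** Tested on sets only: kernels come in later, through simple functions from below. *)
Definition weak_lim d (T : measurableType d) (R : realType)
    (mu : set T -> \bar R) (U : set_system nat) (w : nat -> T -> R) (F : T -> R) :=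
  forall A, measurable A ->
    (\int[mu]_(x in A) (w k x)%:E)%E @[k --> U] --> (\int[mu]_(x in A) (F x)%:E)%E.

Section weak_limits.
Context d (T : measurableType d) (R : realType).
Context (mu : {finite_measure set T -> \bar R}).
Local Open Scope ereal_scope.

Lemma finite_measure_lty : mu setT < +oo.
Proof. by rewrite -ge0_fin_numE//; exact: fin_num_measure. Qed.

(** On the set where [h > 1] the positive function [h - 1] has integral at most 0. *)
Lemma null_gt1 (h : T -> R) : measurable_fun setT h ->
  (forall x, (0 <= h x)%R) ->
  (forall A, measurable A -> \int[mu]_(x in A) (h x)%:E <= mu A) ->
  mu [set x | (1 < h x)%R] = 0.
Proof.
move=> mh h0 hA.
set B := [set x | (1 < h x)%R].
have mB : measurable B.
  rewrite /B (_ : [set x | _] = h @^-1` `]1%R, +oo[); last first.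
    by apply/seteqP; split => x /=; rewrite in_itv/= andbT.
  by rewrite -[X in measurable X]setTI; exact: mh.
pose g x := (h x - 1)%R.
have mg : measurable_fun B (EFin \o g).
  by apply/measurable_EFinP/measurable_funTS; exact: measurable_funB.
have g0 x : B x -> 0 <= (g x)%:E by rewrite /B/= lee_fin subr_ge0 => /ltW.
have Bfin : mu B \is a fin_num by exact: fin_num_measure.
have : \int[mu]_(x in B) (g x)%:E + mu B <= mu B.
  rewrite -{1}[mu B]mul1e -integral_cst// -ge0_integralD//.
  apply: le_trans (hA _ mB); rewrite le_eqVlt; apply/orP; left; apply/eqP.
  by apply: eq_integral => x _; rewrite /g -EFinD subrK.
rewrite -leeBrDr// subee// => int0.
have : \int[mu]_(x in B) `|(g x)%:E| = 0.
  apply/eqP; rewrite eq_le integral_ge0// andbT (le_trans _ int0)// le_eqVlt.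
  apply/orP; left; apply/eqP; apply: eq_integral => x /[!inE] Bx.
  by rewrite gee0_abs// g0.
move/(ae_eq_integral_abs _ mB) => /(_ mg)[N [mN N0 BN]].
apply/eqP; rewrite -measure_le0 -N0; apply: le_measure; rewrite ?inE//.
move=> x Bx; apply: BN => /= /(_ Bx)[/eqP].
by rewrite /g subr_eq0 => /eqP h1; move: Bx; rewrite /B/= h1 ltxx.
Qed.

Context (U : set_system nat) (UU : UltraFilter U).

(** The setwise limit is a measure dominated by [mu]; [F] is its Radon-Nikodym density. *)
Lemma weak_lim_exists (w : nat -> T -> R) :
  (forall k, measurable_fun setT (w k)) ->
  (forall k x, (0 <= w k x <= 1)%R) ->
  exists F : T -> R, [/\ measurable_fun setT F, (forall x, (0 <= F x)%R) &
    weak_lim mu U w F].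
Proof.
move=> mw w01.
have [nu [nulim nule]] := limit_measure_exists finite_measure_lty UU mw w01.
have dom : nu `<< mu.
  apply/null_content_dominatesP => A mA A0; apply/eqP; rewrite -measure_le0 -A0.
  exact: nule.
have [f [f0 ffin fint fE]] := radon_nikodym_sigma_finite dom.
exists (fine \o f); split.
- apply/measurable_EFinP; rewrite (_ : EFin \o _ = f); last first.
    by apply/funext => x /=; rewrite fineK.
  exact: measurable_int fint.
- by move=> x; exact: fine_ge0.
- move=> A mA; rewrite (_ : \int[mu]_(x in A) _ = nu A); first exact: nulim.
  rewrite [RHS](fE A mA); apply: eq_integral => x _ /=; by rewrite fineK.
Qed.

Lemma weak_lim_family (w : nat -> nat -> T -> R) :
  (forall i k, measurable_fun setT (w i k)) ->
  (forall i k x, (0 <= w i k x)%R) ->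
  (forall n k x, (\sum_(i < n) w i k x <= 1)%R) ->
  exists F : nat -> T -> R, [/\ forall i, measurable_fun setT (F i),
    (forall i x, (0 <= F i x)%R),
    (forall n x, (\sum_(i < n) F i x <= 1)%R) &
    forall i, weak_lim mu U (w i) (F i)].
Proof.
move=> mw w0 w1.
have w01 i k x : (0 <= w i k x <= 1)%R.
  rewrite w0/= (le_trans _ (w1 i.+1 k x))// big_ord_recr/= lerDr.
  by apply: sumr_ge0.
have [F FP] := choice (fun i => weak_lim_exists (mw i) (w01 i)).
have mF i : measurable_fun setT (F i) by case: (FP i).
have F0 i x : (0 <= F i x)%R by case: (FP i).
have Flim i : weak_lim mu U (w i) (F i) by case: (FP i).
have mS n : measurable_fun setT (fun x => \sum_(i < n) F i x)%R.
  exact: measurable_sum.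
have S0 n x : (0 <= \sum_(i < n) F i x)%R by exact: sumr_ge0.
have intS (G : nat -> T -> R) n A : measurable A -> (forall i, measurable_fun setT (G i)) ->
    (forall i x, (0 <= G i x)%R) ->
    \int[mu]_(x in A) (\sum_(i < n) G i x)%:E = \sum_(i < n) \int[mu]_(x in A) (G i x)%:E.
  move=> mA mG G0.
  under eq_integral do rewrite -sumEFin.
  rewrite ge0_integral_sum// => [i|i x _]; last by rewrite lee_fin.
  by apply/measurable_EFinP/measurable_funTS.
pose N n := [set x | (1 < \sum_(i < n) F i x)%R].
have mN n : measurable (N n).
  rewrite /N (_ : [set x | _] = (fun x => \sum_(i < n) F i x)%R @^-1` `]1%R, +oo[); last first.
    by apply/seteqP; split => x /=; rewrite in_itv/= andbT.
  by rewrite -[X in measurable X]setTI; exact: mS.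
have N0 n : mu (N n) = 0.
  apply: null_gt1 => // A mA; rewrite intS//.
  apply: (@cvge_le _ U _ _ (fun k => \sum_(i < n) \int[mu]_(x in A) (w i k x)%:E)).
    apply: nearW => k; rewrite -(intS (fun i => w i k))//.
    have := @integral_unit_bounds _ _ _ mu (fun k x => \sum_(i < n) w i k x)%R.
    case/(_ _ _ k A mA)/andP => //.
      by move=> j; exact: measurable_sum.
    by move=> j x; rewrite w1 sumr_ge0.
  apply: cvg_nnesum => i _; last exact: Flim.
  by apply: nearW => k; apply: integral_ge0 => x _; rewrite lee_fin.
have mUN : measurable (\bigcup_n N n) by exact: bigcupT_measurable.
have UN0 : mu (\bigcup_n N n) = 0.
  apply/negligibleP => //; apply: negligible_bigcup => n; exists (N n); split; [exact: mN|exact: N0|by []].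
(* The bounds on partial sums hold only almost everywhere. Cutting off on the countable union of the
   exceptional null sets makes them hold at every point and leaves the integrals unchanged. *)
exists (fun i x => (F i x * \1_(~` \bigcup_n N n) x)%R); split.
- by move=> i; apply: measurable_funM => //; by apply: measurable_indic; exact: measurableC.
- by move=> i x; rewrite mulr_ge0.
- move=> n x; rewrite -big_distrl/= indicE in_setC.
  case: (boolP (x \in _)) => [|/negP xN]; first by rewrite mulr0.
  rewrite mulr1 leNgt; apply/negP => xn; apply: xN; rewrite inE.
  by exists n.
- move=> i A mA; rewrite (_ : \int[mu]_(x in A) _ = \int[mu]_(x in A) (F i x)%:E); first exact: Flim.
  apply: ge0_ae_eq_integral => //.
  + by apply/measurable_EFinP/measurable_funTS/measurable_funM => //; by apply: measurable_indic; exact: measurableC.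
  + by apply/measurable_EFinP/measurable_funTS.
  + by move=> x _; rewrite lee_fin mulr_ge0.
  + by move=> x _; rewrite lee_fin.
  + exists (\bigcup_n N n); split => // x /= H; apply: contrapT => xN; apply: H => _.
    by rewrite indicE mem_set// mulr1.
Qed.
End weak_limits.

Section eventually_le.
Context (R : realType) (U : set_system nat) (UU : UltraFilter U).
Local Open Scope ereal_scope.

(** For finite [a] this is [a <= liminf b] along [U], in a form stable under finite sums and
    nonnegative multiples. *)
Definition eventually_le (a : \bar R) (b : nat -> \bar R) :=
  forall e : R, (0 < e)%R -> \forall k \near U, a <= b k + e%:E.

Lemma eventually_le_sum (J : Type) (s : seq J) (P : pred J)
    (a : J -> \bar R) (b : J -> nat -> \bar R) :
  (forall j, P j -> eventually_le (a j) (b j)) ->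
  eventually_le (\sum_(j <- s | P j) a j) (fun k => \sum_(j <- s | P j) b j k).
Proof.
move=> ab; elim: s => [|j s IH] e e0.
  by apply: nearW => k; rewrite !big_nil add0e lee_fin ltW.
have e20 : (0 < e / 2)%R by rewrite divr_gt0.
have := IH _ e20; have [Pj|nPj] := boolP (P j); last first.
  apply: filterS => k; rewrite !big_cons (negbTE nPj) => /le_trans; apply.
  by rewrite leeD2l// lee_fin ler_pdivrMr// mulr_natr mulr2n lerDl ltW.
have := ab _ Pj _ e20.
apply: filterS2 => k H1 H2; rewrite !big_cons Pj.
by rewrite [e]splitr EFinD addeACA leeD.
Qed.

Lemma eventually_leZ (r : R) (a : \bar R) (b : nat -> \bar R) : (0 <= r)%R ->
  eventually_le a b -> eventually_le (r%:E * a) (fun k => r%:E * b k).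
Proof.
rewrite le_eqVlt => /predU1P[<- _ e e0|r0 ab e e0].
  by apply: nearW => k; rewrite !mul0e add0e lee_fin ltW.
have := ab (e / r)%R (divr_gt0 e0 r0).
apply: filterS => k; rewrite -(@lee_pmul2l _ r%:E) ?lte_fin// => /le_trans; apply.
rewrite muleDr// ?fin_num_adde_defl// -EFinM mulrC divfK// gt_eqF//.
Qed.

Lemma eventually_le_lt (r : R) a b : eventually_le a b -> r%:E < a ->
  \forall k \near U, r%:E < b k.
Proof.
move: a => [a||//] ab; last first.
  by move=> _; apply: filterS (ab 1%R ltr01) => k; case: (b k) => [?||]//=; rewrite ltry.
rewrite lte_fin => ra.
have e0 : (0 < (a - r) / 2)%R by rewrite divr_gt0// subr_gt0.
apply: filterS (ab _ e0) => k; case: (b k) => [bk||]//=; last by rewrite ltry.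
by rewrite -EFinD lee_fin lte_fin; lra.
Qed.

End eventually_le.

(** * Lower semicontinuity of weighted integrals *)

Section lower_semicontinuity.
Context d (T : measurableType d) (R : realType) (mu : {measure set T -> \bar R}).
Context (U : set_system nat) (UU : UltraFilter U).
Context (h : T -> R) (hk : nat -> T -> R).
Hypotheses (mh : measurable_fun setT h) (mhk : forall k, measurable_fun setT (hk k)).
Hypotheses (h0 : forall x, 0 <= h x) (hk0 : forall k x, 0 <= hk k x).
Local Open Scope ereal_scope.
Hypothesis hle : forall A, measurable A ->
  eventually_le U (\int[mu]_(x in A) (h x)%:E) (fun k => \int[mu]_(x in A) (hk k x)%:E).
Import HBNNSimple.

Lemma integral_nnsfunM (s : {nnsfun T >-> R}) (g : T -> R) :
    measurable_fun setT g -> (forall x, (0 <= g x)%R) ->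
  \int[mu]_x ((s x)%:E * (g x)%:E) =
  \sum_(y \in range s) (y%:E * \int[mu]_(x in s @^-1` [set y]) (g x)%:E).
Proof.
move=> mg g0.
transitivity (\int[mu]_x (\sum_(y \in range s)
    (y * \1_(s @^-1` [set y]) x)%:E * (g x)%:E)).
  under [RHS]eq_integral => x xE.
    rewrite -ge0_mule_fsuml => [|y]; last exact: nnfun_muleindic_ge0.
    rewrite fsumEFin // -(fimfunE _ x); over.
  by [].
rewrite ge0_integral_fsum//; last 2 first.
  - move=> y; apply: emeasurable_funM; last exact/measurable_EFinP.
    by apply/measurable_EFinP/measurable_funM.
  - by move=> m y Ey; apply: mule_ge0; [rewrite EFinM nnfun_muleindic_ge0|rewrite lee_fin].
apply: eq_fsbigr => r rs.
under eq_integral do rewrite EFinM -muleA.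
have r0 : (0 <= r)%R by move: rs; rewrite inE => -[t _ <-].
rewrite ge0_integralZl//.
- under eq_integral do rewrite muleC.
  rewrite (eq_integral ((EFin \o g) \_ (s @^-1` [set r]))); last first.
    by move=> x xE; rewrite epatch_indic.
  by rewrite -integral_mkcond.
- by apply: emeasurable_funM; exact/measurable_EFinP.
- by move=> t _; rewrite mule_ge0 ?lee_fin.
Qed.

(** The approximants [S n] are integrals against simple functions increasing to [K]. They stand in
    for the integral itself, which may be infinite: for an infinite left side [eventually_le] would
    ask the right sides to be infinite eventually. *)
Lemma eventually_le_integralM (K : T -> R) :
    measurable_fun setT K -> (forall x, (0 <= K x)%R) ->
  exists S : nat -> \bar R, [/\ forall n, 0 <= S n,
    S n @[n --> \oo] --> \int[mu]_x ((K x)%:E * (h x)%:E) &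
    forall n, eventually_le U (S n) (fun k => \int[mu]_x ((K x)%:E * (hk k x)%:E))].
Proof.
move=> mK K0.
have mKE : measurable_fun setT (EFin \o K) by exact/measurable_EFinP.
pose s := nnsfun_approx measurableT mKE.
have K0E x : setT x -> 0 <= (EFin \o K) x by move=> _; rewrite lee_fin.
have sK n x : (s n x <= K x)%R.
  rewrite -lee_fin; apply: (@cvge_ge _ \oo _ _ (fun m => (s m x)%:E)); last exact: cvg_nnsfun_approx.
  near=> m; rewrite lee_fin; apply/lefP/nd_nnsfun_approx.
  by near: m; exact: nbhs_infty_ge.
exists (fun n => \int[mu]_x ((s n x)%:E * (h x)%:E)); split.
- by move=> n; apply: integral_ge0 => x _; rewrite mule_ge0// lee_fin.
- have Kh x : setT x -> (K x)%:E * (h x)%:E = lim ((s n x)%:E * (h x)%:E @[n --> \oo]).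
    move=> _; apply/esym/cvg_lim => //; apply: cvgeZr => //.
    exact: (@cvg_nnsfun_approx _ _ _ _ measurableT _ mKE K0E).
  under eq_integral => x /[!inE] /Kh -> //.
  apply: cvg_monotone_convergence => [//|n|n x _|x _ a b ab].
  + by apply: emeasurable_funM; exact/measurable_EFinP.
  + by rewrite mule_ge0 ?lee_fin.
  + by rewrite lee_wpmul2r ?lee_fin//; exact/lefP/nd_nnsfun_approx.
- move=> n.
  have : eventually_le U (\int[mu]_x ((s n x)%:E * (h x)%:E))
      (fun k => \int[mu]_x ((s n x)%:E * (hk k x)%:E)).
    have mR y : measurable (s n @^-1` [set y]).
      by rewrite -[X in measurable X]setTI; exact: measurable_funP.
    have finR : finite_set (range (s n)) by exact: fimfunP.
    rewrite integral_nnsfunM// fsbig_finite//=.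
    rewrite (_ : (fun k => \int[mu]_x _) = fun k =>
        \sum_(y <- fset_set (range (s n)) | y \in range (s n))
        y%:E * \int[mu]_(x in s n @^-1` [set y]) (hk k x)%:E); last first.
      apply/funext => k; rewrite integral_nnsfunM// fsbig_finite//= big_seq_cond.
      by rewrite [RHS]big_seq_cond; apply: eq_bigl => y; rewrite in_fset_set// andbT andbb.
    rewrite (_ : \sum_(y <- _) _ = \sum_(y <- fset_set (range (s n)) | y \in range (s n))
        y%:E * \int[mu]_(x in s n @^-1` [set y]) (h x)%:E); last first.
      rewrite big_seq_cond.
      by rewrite [RHS]big_seq_cond; apply: eq_bigl => y; rewrite in_fset_set// andbT andbb.
    apply: eventually_le_sum => y; rewrite inE => -[x _ <-].
    by apply: eventually_leZ => //; exact: hle.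
  move=> + e e0 => /(_ e e0); apply: filterS => k /le_trans; apply.
  rewrite leeD2r//; apply: ge0_le_integral => //.
  + by move=> x _; rewrite mule_ge0 ?lee_fin.
  + by apply: emeasurable_funM; exact/measurable_EFinP.
  + by apply: emeasurable_funM; exact/measurable_EFinP.
  + by move=> x _; rewrite lee_wpmul2r ?lee_fin.
Unshelve. all: by end_near. Qed.
End lower_semicontinuity.

(** * Weak limits of products in independent variables *)

Section product_weak_limit.
Context d (T : measurableType d) (R : realType).
Context (mu : {finite_measure set T -> \bar R}).
Local Open Scope ereal_scope.

Lemma measurable_tensor (u v : T -> R) : measurable_fun setT u -> measurable_fun setT v ->
  measurable_fun setT (fun p : T * T => u p.1 * v p.2)%R.
Proof.
by move=> mu_ mv; apply: measurable_funM;
  [exact: (measurableT_comp mu_ measurable_fst)|exact: (measurableT_comp mv measurable_snd)].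
Qed.

Lemma integral_tensor (u v : T -> R) (A B : set T) :
  measurable_fun setT u -> measurable_fun setT v ->
  (forall x, (0 <= u x)%R) -> (forall x, (0 <= v x)%R) ->
  measurable A -> measurable B ->
  \int[mu \x mu]_(p in A `*` B) (u p.1 * v p.2)%:E =
  \int[mu]_(x in A) (u x)%:E * \int[mu]_(y in B) (v y)%:E.
Proof.
move=> mu_ mv u0 v0 mA mB.
have mAB : measurable (A `*` B) by exact: measurableX.
rewrite integral_mkcond.
rewrite (_ : _ \_ (A `*` B) = fun p : T * T =>
    ((u p.1 * \1_A p.1) * (v p.2 * \1_B p.2))%:E); last first.
  apply/funext => -[x y]; rewrite /patch in_setX/= !indicE.
  by case: (x \in A); case: (y \in B); rewrite /= ?mulr1 ?mulr0 ?mul0r ?mulr0.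
have mu1 : measurable_fun setT (fun x => u x * \1_A x)%R by exact: measurable_funM.
have mv1 : measurable_fun setT (fun x => v x * \1_B x)%R by exact: measurable_funM.
rewrite fubini_tonelli1//; last 2 first.
- apply/measurable_EFinP.
  exact: (@measurable_tensor (fun x => u x * \1_A x)%R (fun x => v x * \1_B x)%R).
- by move=> p; rewrite lee_fin !mulr_ge0.
rewrite /fubini_F/=.
under eq_integral => x _.
  under eq_integral do rewrite EFinM.
  rewrite ge0_integralZl//; last 3 first.
  - exact/measurable_EFinP.
  - by move=> y _; rewrite lee_fin mulr_ge0.
  - by rewrite lee_fin mulr_ge0.
  over.
rewrite ge0_integralZr//; last 3 first.
- exact/measurable_EFinP.
- by move=> y _; rewrite lee_fin mulr_ge0.
- by apply: integral_ge0 => y _; rewrite lee_fin mulr_ge0.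
rewrite [in RHS]integral_mkcond [X in _ = _ * X]integral_mkcond.
by congr (_ * _); apply: eq_integral => x _; rewrite epatch_indic/= EFinM.
Qed.

Lemma product_measure_lty : (mu \x mu) setT < +oo.
Proof.
rewrite -setXTT product_measure1E// -ge0_fin_numE ?mule_ge0//.
by rewrite fin_numM// fin_num_measure.
Qed.

Context (U : set_system nat) (UU : UltraFilter U).

(** On rectangles the integrals factor and the factors converge. The limit measure of the products
    thus agrees on rectangles with the product of the two limit measures, and a product measure is
    determined by its values there. *)
Lemma weak_lim_tensor (u v : nat -> T -> R) (F G : T -> R) :
  (forall k, measurable_fun setT (u k)) -> (forall k, measurable_fun setT (v k)) ->
  measurable_fun setT F -> measurable_fun setT G ->
  (forall k x, (0 <= u k x <= 1)%R) -> (forall k x, (0 <= v k x <= 1)%R) ->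
  (forall x, (0 <= F x <= 1)%R) -> (forall x, (0 <= G x <= 1)%R) ->
  weak_lim mu U u F -> weak_lim mu U v G ->
  weak_lim (mu \x mu) U (fun k p => u k p.1 * v k p.2)%R (fun p => F p.1 * G p.2)%R.
Proof.
move=> mu_ mv mF mG u01 v01 F01 G01 uF vG.
have t01 (a b : T -> R) : (forall x, (0 <= a x <= 1)%R) -> (forall x, (0 <= b x <= 1)%R) ->
    forall p : T * T, (0 <= a p.1 * b p.2 <= 1)%R.
  move=> a01 b01 p; have /andP[a0 a1] := a01 p.1; have /andP[b0 b1] := b01 p.2.
  by rewrite mulr_ge0//= mulr_ile1.
have [nu [nulim _]] := limit_measure_exists product_measure_lty UU
  (fun k => measurable_tensor (mu_ k) (mv k)) (fun k => t01 _ _ (u01 k) (v01 k)).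
have [nu' [nulim' _]] := limit_measure_exists product_measure_lty UU
  (fun k => measurable_tensor mF mG) (fun k => t01 _ _ F01 G01).
have nu'E X : measurable X -> nu' X = \int[mu \x mu]_(p in X) (F p.1 * G p.2)%:E.
  move=> mX; apply/esym.
  exact: (@cvg_unique _ (@ereal_hausdorff R) _ _ _ _ (cvg_cst _) (nulim' X mX)).
have [nF [nFlim _]] := limit_measure_exists (finite_measure_lty mu) UU
  (fun k => mF) (fun k => F01).
have nFE X : measurable X -> nF X = \int[mu]_(p in X) (F p)%:E.
  move=> mX; apply/esym.
  exact: (@cvg_unique _ (@ereal_hausdorff R) _ _ _ _ (cvg_cst _) (nFlim X mX)).
have [nG [nGlim _]] := limit_measure_exists (finite_measure_lty mu) UU
  (fun k => mG) (fun k => G01).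
have nGE X : measurable X -> nG X = \int[mu]_(p in X) (G p)%:E.
  move=> mX; apply/esym.
  exact: (@cvg_unique _ (@ereal_hausdorff R) _ _ _ _ (cvg_cst _) (nGlim X mX)).
have F0 x : (0 <= F x)%R by case/andP: (F01 x).
have G0 x : (0 <= G x)%R by case/andP: (G01 x).
move=> X mX; rewrite -nu'E//.
rewrite -(@product_measure_unique _ _ _ _ _ nF nG nu')//; last first.
  move=> A B mA mB; apply: (etrans (nu'E _ (measurableX mA mB))).
  apply: (etrans (integral_tensor mF mG F0 G0 mA mB)).
  exact: (esym (f_equal2 _ (nFE _ mA) (nGE _ mB))).
rewrite (@product_measure_unique _ _ _ _ _ nF nG nu)//; first exact: nulim.
move=> A B mA mB.
apply: (@cvg_unique _ (@ereal_hausdorff R) _ _ _ _ (nulim _ (measurableX mA mB))).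
have EAB : \int[mu]_(x in A) (F x)%:E * \int[mu]_(x in B) (G x)%:E = nF A * nG B.
  exact: (esym (f_equal2 _ (nFE _ mA) (nGE _ mB))).
suff H : (fun k => \int[mu \x mu]_(p in A `*` B) (u k p.1 * v k p.2)%:E) @ U -->
    \int[mu]_(x in A) (F x)%:E * \int[mu]_(x in B) (G x)%:E.
  by move: H; rewrite EAB.
rewrite (_ : (fun k => _) = fun k =>
  \int[mu]_(x in A) (u k x)%:E * \int[mu]_(x in B) (v k x)%:E); last first.
  apply/funext => k; rewrite integral_tensor//.
  - by move=> x; case/andP: (u01 k x).
  - by move=> x; case/andP: (v01 k x).
apply: cvgeM; [|exact: uF|exact: vG].
by rewrite -nFE// -nGE// mule_def_fin// fin_num_measure.
Qed.

End product_weak_limit.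

(** * Existence of relaxed minimizers *)

Section countable_esum.
Context (R : realType) (L : choiceType) (e : nat -> L) (e' : L -> nat).
Hypotheses (eK : cancel e e') (e'K : cancel e' e).
Local Open Scope ereal_scope.
Implicit Types a : L -> \bar R.

Lemma esum_enum a : (forall g, 0 <= a g) ->
  \esum_(g in setT) a g = \sum_(n <oo) a (e n).
Proof.
move=> a0; rewrite nneseries_esumT//; apply: reindex_esum; split => //.
- by move=> x y _ _ /(can_inj eK).
- by move=> g _; exists (e' g).
Qed.

Lemma esum_fibers (h : nat -> L) (a : nat -> \bar R) : (forall i, 0 <= a i) ->
  \esum_(g in setT) \esum_(i in [set i | h i = g]) a i = \esum_(i in setT) a i.
Proof.
move=> a0; rewrite esum_enum; last by move=> g; exact: esum_ge0.
rewrite nneseries_esumT; last by move=> g; exact: esum_ge0.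
rewrite -esum_bigcupT//.
  by congr esum; apply/seteqP; split => // i _; exists (e' (h i)) => //=; rewrite e'K.
move=> i j _ _ [k []/= -> E]; exact: (can_inj eK).
Qed.

Lemma esumZl (r : R) a : (0 <= r)%R -> (forall g, 0 <= a g) ->
  \esum_(g in setT) (r%:E * a g) = r%:E * \esum_(g in setT) a g.
Proof.
move=> r0 a0; rewrite !esum_enum// ?nneseriesZl// => g.
by rewrite mule_ge0.
Qed.

Lemma esum_split_seq (s : seq L) a : uniq s -> (forall g, 0 <= a g) ->
  \esum_(g in setT) a g =
  \sum_(g <- s) a g + \esum_(g in [set g | g \notin s]) a g.
Proof.
move=> us a0; rewrite (esumID [set` s])// !setTI.
congr (_ + _); last by congr esum; apply/seteqP; split => g /= /negP.
by rewrite esum_fset// -fsbig_seq.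
Qed.

Lemma sum_seq_le_esum (s : seq L) a : uniq s -> (forall g, 0 <= a g) ->
  \sum_(g <- s) a g <= \esum_(g in setT) a g.
Proof.
by move=> us a0; rewrite (esum_split_seq us)// leeDl// esum_ge0.
Qed.

Context d (T : measurableType d) (mu : {measure set T -> \bar R}).

Lemma measurable_esum (D : set T) (a : L -> T -> \bar R) :
  (forall g x, 0 <= a g x) -> (forall g, measurable_fun D (a g)) ->
  measurable_fun D (fun x => \esum_(g in setT) a g x).
Proof.
move=> a0 ma; under eq_fun do rewrite esum_enum//.
by apply: ge0_emeasurable_sum.
Qed.

Lemma integral_esum (D : set T) (a : L -> T -> \bar R) : measurable D ->
  (forall g x, 0 <= a g x) -> (forall g, measurable_fun D (a g)) ->
  \int[mu]_(x in D) (\esum_(g in setT) a g x) =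
  \esum_(g in setT) \int[mu]_(x in D) a g x.
Proof.
move=> mD a0 ma; rewrite esum_enum; last by move=> g; exact: integral_ge0.
by under eq_integral do rewrite esum_enum//; rewrite integral_nneseries.
Qed.

End countable_esum.

Lemma esum_shift (R : realType) (L : zmodType) (a : L -> \bar R) (g : L) :
  (\esum_(h in setT) a (h + g)%R = \esum_(h in setT) a h)%E.
Proof.
apply/esym/reindex_esum; split => //.
- by move=> x y _ _ /addIr.
- by move=> h _; exists (h - g) => //; rewrite subrK.
Qed.

(** * Enumerating labels by decreasing mass *)

Section greedy_enumeration.
Context (R : realType) (L : eqType) (e : nat -> L) (e_inj : injective e).
Context (m : L -> R) (M : R).
Hypotheses (m0 : forall g, 0 <= m g).
Hypothesis mM : forall s : seq L, uniq s -> \sum_(g <- s) m g <= M.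

(** Settling for half of the supremum avoids showing that it is attained; if the supremum is 0, any
    fresh label will do. *)
Lemma half_maximal_outside (s : seq L) :
  exists g, g \notin s /\ forall h, h \notin s -> m h <= 2 * m g.
Proof.
have [g0 g0s] : exists g0, g0 \notin s.
  apply: contrapT => /forallNP H.
  have : (size (map e (iota 0 (size s).+1)) <= size s)%N.
    apply: uniq_leq_size; first by rewrite map_inj_uniq// iota_uniq.
    by move=> x _; have := H x => /negP; rewrite negbK.
  by rewrite size_map size_iota ltnn.
pose S := [set m h | h in [set h | h \notin s]].
have S0 : S !=set0 by exists (m g0); exists g0.
have SM : has_ubound S.
  exists M => _ [h _ <-]; have := mM (s := [:: h]) isT.
  by rewrite big_seq1.
have hS : has_sup S by split.
have [sp|sn] := ltP 0 (sup S).
  have sp2 : 0 < sup S / 2 by rewrite divr_gt0.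
  have [_ [g gs <-] mg] := sup_adherent sp2 hS.
  exists g; split => // h hs.
  have : m h <= sup S by apply: ub_le_sup => //; exists h.
  move: mg; lra.
exists g0; split => // h hs.
have : m h <= sup S by apply: ub_le_sup => //; exists h.
by have := m0 g0; lra.
Qed.

(** Each of the first n picks has at least half the mass of any label still missing, and together
    the picks have mass at most [M]. The bound involves [m] only through [M], which makes it uniform
    along a sequence of labellings. *)
Lemma greedy_enumeration : exists gam : nat -> L, injective gam /\
  forall n g, (forall i, (i < n)%N -> g != gam i) -> n%:R * m g <= 2 * M.
Proof.
have [nx nxP] := choice half_maximal_outside.
pose G n := iter n (fun s => rcons s (nx s)) [::].
pose gam n := nx (G n).
have memG n g : (g \in G n) = has (fun i => g == gam i) (iota 0 n).
  elim: n => [//|n IH]; rewrite /G iterS -/(G n) mem_rcons in_cons IH.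
  by rewrite -addn1 iotaD has_cat/= add0n orbF orbC.
have inG n i : (i < n)%N -> gam i \in G n.
  by move=> i_n; rewrite memG; apply/hasP; exists i => //; rewrite mem_iota.
have gam_inj : injective gam.
  have lt_neq i j : (i < j)%N -> gam i != gam j.
    move=> ij; apply/eqP => E; have [] := nxP (G j).
    by rewrite -/(gam j) -E inG.
  move=> i j E; apply/eqP; case: (ltngtP i j) => // /lt_neq; rewrite E eqxx//.
exists gam; split => // n g gn.
have : \sum_(g <- map gam (iota 0 n)) m g <= M.
  by apply: mM; rewrite map_inj_uniq// iota_uniq.
rewrite big_map => sM.
apply: le_trans (ler_wpM2l (ler0n _ 2) sM).
rewrite mulr_sumr (_ : iota 0 n = index_iota 0 n); last by rewrite /index_iota subn0.
rewrite mulr_natl -[X in _ *+ X](subn0 n) -sumr_const_nat ler_sum_nat// => i /andP[_ i_n].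
have [_ /(_ g)] := nxP (G i); apply; rewrite memG; apply/hasPn => j.
rewrite mem_iota/= add0n => ji; apply: gn.
exact: ltn_trans i_n.
Qed.
End greedy_enumeration.

(** * Relaxed fundamental domains and their agreement *)

Section fuzzy_labellings.
Context d (T : measurableType d) (R : realType).
Context (L : zmodType) (e : nat -> L) (e' : L -> nat).
Hypotheses (eK : cancel e e') (e'K : cancel e' e).
Implicit Types f : L -> T -> R.

(* A relaxed fundamental domain [E]: [f g x] stands for the indicator of
   [x + v g] in [E], where [x] runs through a tile and [v] maps the labels onto G. *)
Definition fuzzy f := [/\ forall g, measurable_fun setT (f g),
  forall g x, 0 <= f g x & forall x, (\esum_(g in setT) (f g x)%:E = 1)%E].

(** For an indicator labelling this is 1 exactly when the label of [p.2] is that of [p.1] plus [h].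
    For a fuzzy labelling the sum is at most 1, so [fine] loses nothing. *)
Definition agreement f (h : L) (p : T * T) : R :=
  fine (\esum_(g in setT) (f g p.1 * f (g + h) p.2)%:E).

Definition disagreement f (h : L) (p : T * T) : R := 1 - agreement f h p.

Lemma fuzzy_sum_le1 f (s : seq L) x : fuzzy f -> uniq s -> \sum_(g <- s) f g x <= 1.
Proof.
move=> [_ f0 f1] us; rewrite -lee_fin -sumEFin -(f1 x).
by apply: (sum_seq_le_esum us) => g; rewrite lee_fin.
Qed.

Lemma fuzzy_ge0_le1 f g x : fuzzy f -> 0 <= f g x <= 1.
Proof.
move=> ff; have [_ f0 _] := ff; rewrite f0/=.
by have := @fuzzy_sum_le1 f [:: g] x ff isT; rewrite big_seq1.
Qed.

Lemma esum_agreement_le1 f h p : fuzzy f ->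
  (\esum_(g in setT) (f g p.1 * f (g + h) p.2)%:E <= 1)%E.
Proof.
move=> ff; have [_ f0 f1] := ff; rewrite -(f1 p.1); apply: le_esum => g _.
rewrite lee_fin -[leRHS]mulr1 ler_wpM2l//.
by case/andP: (fuzzy_ge0_le1 (g + h) p.2 ff).
Qed.

Lemma agreementE f h p : fuzzy f ->
  ((agreement f h p)%:E = \esum_(g in setT) (f g p.1 * f (g + h)%R p.2)%:E)%E.
Proof.
move=> ff; have [_ f0 _] := ff; rewrite fineK// ge0_fin_numE.
  by rewrite (le_lt_trans (esum_agreement_le1 h p ff))// ltry.
by apply: esum_ge0 => g _; rewrite lee_fin mulr_ge0.
Qed.

Lemma agreement_ge0_le1 f h p : fuzzy f -> 0 <= agreement f h p <= 1.
Proof.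
move=> ff; have [_ f0 _] := ff; rewrite -!lee_fin agreementE//.
rewrite esum_agreement_le1// andbT.
by apply: esum_ge0 => g _; rewrite lee_fin mulr_ge0.
Qed.

Lemma disagreement_ge0_le1 f h p : fuzzy f -> 0 <= disagreement f h p <= 1.
Proof.
by move=> /(agreement_ge0_le1 h p)/andP[? ?]; rewrite /disagreement; lra.
Qed.

Lemma measurable_agreement f h : fuzzy f -> measurable_fun setT (agreement f h).
Proof.
move=> ff; have [mf f0 _] := ff; apply/measurable_EFinP.
rewrite (_ : _ \o _ = fun p : T * T => (\esum_(g in setT) (f g p.1 * f (g + h)%R p.2)%:E)%E).
  apply: (measurable_esum eK e'K) => [g p|g]; first by rewrite lee_fin mulr_ge0.
  apply/measurable_EFinP; exact: measurable_tensor.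
by apply/funext => p; rewrite /= agreementE.
Qed.

Lemma measurable_disagreement f h : fuzzy f -> measurable_fun setT (disagreement f h).
Proof. by move=> ff; apply: measurable_funB => //; exact: measurable_agreement. Qed.

Context (mu : {finite_measure set T -> \bar R}).
Context (U : set_system nat) (UU : UltraFilter U).
Local Open Scope ereal_scope.

Lemma esum_mass f : fuzzy f -> \esum_(g in setT) \int[mu]_x (f g x)%:E = mu setT.
Proof.
move=> [mf f0 f1]; rewrite -(@integral_esum _ _ _ _ eK e'K _ _ mu setT (fun g x => (f g x)%:E))//.
- by under eq_integral do rewrite f1; rewrite integral_cst// mul1e.
- by move=> g; exact/measurable_EFinP.
Qed.

Lemma integral_tensorT (u v : T -> R) : measurable_fun setT u -> measurable_fun setT v ->
  (forall x, (0 <= u x)%R) -> (forall x, (0 <= v x)%R) ->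
  \int[mu \x mu]_p (u p.1 * v p.2)%:E = \int[mu]_x (u x)%:E * \int[mu]_y (v y)%:E.
Proof. by move=> *; rewrite -setXTT integral_tensor. Qed.

(* The bound does not depend on [f]: the labels not reached by the greedy
   enumeration matter little, uniformly along a minimizing sequence. *)
Lemma integral_agreement_tail f (s : seq L) (c : R) h : fuzzy f -> (0 <= c)%R ->
  (forall g, g \notin s -> \int[mu]_x (f g x)%:E <= c%:E) ->
  \int[mu \x mu]_p (\esum_(g in [set g | g \notin s]) (f g p.1 * f (g + h)%R p.2)%:E)
    <= c%:E * mu setT.
Proof.
move=> ff c0 fs; have [mf f0 _] := ff.
under eq_integral do rewrite esum_mkcond.
rewrite (@integral_esum _ _ _ _ eK e'K _ _ (mu \x mu) setT (fun g p => if g \in [set g | g \notin s]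
  then (f g p.1 * f (g + h)%R p.2)%:E else 0))//; last 2 first.
- by move=> g p /=; case: (g \in _) => //; rewrite lee_fin mulr_ge0.
- move=> g /=; case: (g \in _); last exact: measurable_cst.
  apply/measurable_EFinP; exact: measurable_tensor.
(* The first factor has mass at most [c] off [s]. The masses of the second factor, taken over all
   [g + h], are a shift of the whole family and add up to [mu setT]. *)
rewrite -(esum_mass ff) -(esum_shift (fun g => \int[mu]_x (f g x)%:E) h) -(esumZl eK e'K)//; last first.
  by move=> g; apply: integral_ge0 => x _; rewrite lee_fin.
apply: le_esum => g _; case E : (g \in [set g0 | g0 \notin s]); last first.
  rewrite integral0_eq//.
  apply: mule_ge0; rewrite ?lee_fin//.
  by apply: integral_ge0 => x _; rewrite lee_fin.
have gs : g \notin s by move/set_mem: E.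
rewrite integral_tensorT//.
apply: lee_wpmul2r; last exact: fs.
by apply: integral_ge0 => x _; rewrite lee_fin.
Qed.

End fuzzy_labellings.

Section compactness.
Context d (T : measurableType d) (R : realType).
Context (L : zmodType) (e : nat -> L) (e' : L -> nat).
Hypotheses (eK : cancel e e') (e'K : cancel e' e).
Context (mu : {finite_measure set T -> \bar R}).
Context (U : set_system nat) (UU : UltraFilter U).
Local Open Scope ereal_scope.

(* The k-th term of the sequence carries its i-th profile at the label [gam k i],
   which may escape to infinity with k; only the eventually constant differences
   survive in the limit. *)
Lemma consistent_labels (gam : nat -> nat -> L) : exists lab : nat -> L,
  forall i j h, (\forall k \near U, gam k j = gam k i + h)%R -> lab j = (lab i + h)%R.
Proof.
pose E i j h := \forall k \near U, (gam k j = gam k i + h)%R.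
have Eun i j h h' : E i j h -> E i j h' -> h = h'.
  move=> H H'; have [k [Hk Hk']] := filter_ex (filterI H H').
  by apply: (@addrI _ (gam k i)); rewrite -Hk.
have Erefl i : E i i 0%R by apply: nearW => k; rewrite addr0.
have Esym i j h : E i j h -> E j i (- h)%R.
  by apply: filterS => k ->; rewrite addrK.
have Etrans i j l h h' : E i j h -> E j l h' -> E i l (h + h')%R.
  by apply: filterS2 => k -> ->; rewrite addrA.
pose C i := [set j | exists h, E i j h].
(* [xget] depends only on the class as a set, so related indices share a representative, and a label
   can be defined as the offset from it. *)
pose rep i := xget 0%N (C i).
have CE i j h : E i j h -> C i = C j.
  move=> Eh; apply/seteqP; split => l [h' Eh'].
    by exists (- h + h')%R; apply: Etrans Eh'; exact: Esym.
  by exists (h + h')%R; exact: Etrans Eh'.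
have repP i : exists h, E (rep i) i h.
  have [h Eh] : C i (rep i) by rewrite /rep; apply: (xgetPex 0%N); exists i, 0%R.
  by exists (- h)%R; exact: Esym.
have [lab labP] := choice repP.
exists lab => i j h Eh; apply: Eun (labP j) _.
have -> : rep j = rep i by rewrite /rep (CE _ _ _ Eh).
exact: Etrans (labP i) Eh.
Qed.

(** Unrelated profiles may receive the same label. The cross terms created by such a collision are
    nonnegative, so gluing profiles can only raise the agreement; this is why an inequality is
    enough. *)
Lemma agreement_limit_ge (Phi : nat -> T -> R) (F : L -> T -> R) (lab : nat -> L)
    (h : L) (n : nat) (p : T * T) (nxt : nat -> option nat) :
  fuzzy F -> (forall i x, (0 <= Phi i x)%R) ->
  (forall g x, \esum_(i in [set i | lab i = g]) (Phi i x)%:E <= (F g x)%:E) ->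
  (forall i j, nxt i = Some j -> lab j = (lab i + h)%R) ->
  (\sum_(i < n) (if nxt i is Some j then Phi i p.1 * Phi j p.2 else 0)
    <= agreement F h p)%R.
Proof.
move=> fF Phi0 PhiF labnxt; have [mF F0 F1] := fF.
have PhiE i x : (Phi i x)%:E <= (F (lab i) x)%:E.
  apply: le_trans (PhiF (lab i) x).
  apply: esum_ge; exists [set i]; last by rewrite fsbig_set1.
  by split; [exact: finite_set1|move=> _ ->].
rewrite -lee_fin agreementE// -sumEFin.
pose a i := (Phi i p.1 * F (lab i + h)%R p.2)%:E.
have a0 i : 0 <= a i by rewrite lee_fin mulr_ge0.
apply: (@le_trans _ _ (\sum_(i < n) a i)).
  apply: lee_sum => i _; rewrite lee_fin; case E : (nxt i) => [j|]; last exact: mulr_ge0.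
  by rewrite ler_wpM2l// -lee_fin -(labnxt _ _ E); exact: PhiE.
apply: (@le_trans _ _ (\esum_(i in setT) a i)).
  rewrite -(big_mkord xpredT a) -nneseries_esumT//; exact: nneseries_lim_ge.
rewrite -(esum_fibers eK e'K lab)//; apply: le_esum => g _.
apply: (@le_trans _ _ ((F (g + h)%R p.2)%:E * \esum_(i in [set i | lab i = g]) (Phi i p.1)%:E)).
  rewrite !(esum_mkcond [set i | lab i = g]).
  rewrite -(@esumZl _ _ id id (fun=> erefl) (fun=> erefl))//; last first.
    by move=> i; case: (i \in _); rewrite ?lee_fin.
  apply: le_esum => i _; case E : (i \in [set i | lab i = g]); last by rewrite mule0.
  by rewrite /a (set_mem E) EFinM muleC.
by rewrite EFinM muleC lee_wpmul2r ?lee_fin.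
Qed.

Lemma glue_profiles (Phi : nat -> T -> R) (lab : nat -> L) :
  (forall i, measurable_fun setT (Phi i)) -> (forall i x, (0 <= Phi i x)%R) ->
  (forall n x, (\sum_(i < n) Phi i x <= 1)%R) ->
  exists F : L -> T -> R, fuzzy F /\
    forall g x, \esum_(i in [set i | lab i = g]) (Phi i x)%:E <= (F g x)%:E.
Proof.
move=> mPhi Phi0 Phi1.
pose S g x := \esum_(i in [set i | lab i = g]) (Phi i x)%:E.
have S0 g x : 0 <= S g x by apply: esum_ge0 => i _; rewrite lee_fin.
have SE x : \esum_(g in setT) S g x = \esum_(i in setT) (Phi i x)%:E.
  by apply: (esum_fibers eK e'K) => i; rewrite lee_fin.
have tot1 x : \esum_(i in setT) (Phi i x)%:E <= 1.
  rewrite -nneseries_esumT; last by move=> i; rewrite lee_fin.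
  apply: lime_le; first by apply: is_cvg_nneseries => i _ _; rewrite lee_fin.
  by apply: nearW => n; rewrite big_mkord sumEFin lee_fin.
have S1 g x : S g x <= 1.
  apply: le_trans (tot1 x); rewrite -SE.
  by have := @sum_seq_le_esum _ _ [:: g] (S^~ x) isT (S0^~ x); rewrite big_seq1.
have Sfin g x : S g x \is a fin_num by rewrite ge0_fin_numE// (le_lt_trans (S1 g x))// ltry.
have totfin x : \esum_(i in setT) (Phi i x)%:E \is a fin_num.
  rewrite ge0_fin_numE ?(le_lt_trans (tot1 x)) ?ltry//.
  by apply: esum_ge0 => i _; rewrite lee_fin.
(* The mass that escaped, put on label 0 to restore the total 1. The choice of label is immaterial,
   since only a lower bound on [F] is claimed. *)
pose rest x : R := (1 - fine (\esum_(i in setT) (Phi i x)%:E))%R.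
have rest0 x : (0 <= rest x)%R by rewrite subr_ge0 -lee_fin fineK.
pose F g x := (fine (S g x) + (if g == 0%R then rest x else 0))%R.
have mS g : measurable_fun setT (S g).
  rewrite (_ : S g = fun x => \esum_(i in setT) (if i \in [set i | lab i = g] then (Phi i x)%:E else 0)).
    apply: (@measurable_esum _ _ id id (fun=> erefl) (fun=> erefl)) => [i x|i].
      by case: (i \in _); rewrite ?lee_fin.
    by case: (i \in _) => //; exact/measurable_EFinP.
  by apply/funext => x; rewrite /S esum_mkcond.
have mtot : measurable_fun setT (fun x => \esum_(i in setT) (Phi i x)%:E).
  apply: (@measurable_esum _ _ id id (fun=> erefl) (fun=> erefl)) => [i x|i].
    by rewrite lee_fin.
  exact/measurable_EFinP.
have mfine (u : T -> \bar R) : (forall x, u x \is a fin_num) ->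
    measurable_fun setT u -> measurable_fun setT (fun x => fine (u x)).
  move=> ufin mu_; apply/measurable_EFinP; rewrite (_ : _ \o _ = u)//.
  by apply/funext => x /=; rewrite fineK.
have F0 g x : (0 <= F g x)%R.
  by rewrite addr_ge0 ?fine_ge0//; case: eqP.
exists F; split; last first.
  move=> g x; rewrite -/(S g x) /F EFinD fineK// leeDl// lee_fin.
  by case: eqP.
split => // [g|x].
  apply: measurable_funD; first by apply: mfine => //; exact: mS.
  case: eqP => // _; apply: measurable_funB => //.
  exact: mfine.
rewrite (eq_esum (b := fun g => S g x + (if g == 0%R then (rest x)%:E else 0))); last first.
  by move=> g _; rewrite /F EFinD fineK//; case: eqP.
rewrite esumD//; last by move=> g _; case: eqP; rewrite ?lee_fin.
rewrite SE (_ : \esum_(g in setT) (if g == 0%R then _ else _) = (rest x)%:E).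
  by rewrite /rest EFinB fineK// addeC subeK.
rewrite -[RHS](@esum_set1 R L 0%R (fun=> (rest x)%:E)) ?lee_fin//.
rewrite [RHS]esum_mkcond; apply: eq_esum => g _; congr (if _ then _ else _).
by apply/eqP/idP => [->|/set_mem//]; exact/mem_set.
Qed.
End compactness.

Section fuzzy_compactness.
Context d (T : measurableType d) (R : realType).
Context (L : zmodType) (e : nat -> L) (e' : L -> nat).
Hypotheses (eK : cancel e e') (e'K : cancel e' e).
Context (mu : {finite_measure set T -> \bar R}).
Local Open Scope ereal_scope.

Lemma integral_agreement_split (f : L -> T -> R) (s : seq L) (c : R) (h : L) A :
  fuzzy f -> uniq s -> measurable A -> (0 <= c)%R ->
  (forall g, g \notin s -> \int[mu]_x (f g x)%:E <= c%:E) ->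
  \int[mu \x mu]_(p in A) (agreement f h p)%:E <=
  \sum_(g <- s) \int[mu \x mu]_(p in A) (f g p.1 * f (g + h)%R p.2)%:E + c%:E * mu setT.
Proof.
move=> ff us mA c0 fs; have [mf f0 f1] := ff.
pose a g (p : T * T) := (f g p.1 * f (g + h)%R p.2)%:E.
have a0 g p : 0 <= a g p by rewrite lee_fin mulr_ge0.
have ma g D : measurable_fun D (a g).
  by apply: measurable_funTS; apply/measurable_EFinP; exact: measurable_tensor.
pose tail p := \esum_(g in [set g | g \notin s]) a g p.
have tail0 p : 0 <= tail p by exact: esum_ge0.
have mtail D : measurable_fun D tail.
  rewrite (_ : tail = fun p => \esum_(g in setT) (if g \in [set g | g \notin s] then a g p else 0)).
    apply: (@measurable_esum _ _ _ _ eK e'K _ _ D (fun g p =>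
      if g \in [set g | g \notin s] then a g p else 0)) => [g p|g].
      by case: (g \in _).
    by case: (g \in _).
  by apply/funext => p; rewrite /tail esum_mkcond.
rewrite (eq_integral (fun p => \sum_(g <- s) a g p + tail p)); last first.
  move=> p _; rewrite agreementE//; exact: (esum_split_seq us (fun g => a0 g p)).
rewrite ge0_integralD//; last 2 first.
- by move=> p _; exact: sume_ge0.
- by apply: emeasurable_sum => g.
rewrite ge0_integral_sum//.
rewrite leeD2l//; apply: le_trans (integral_agreement_tail eK e'K h ff c0 fs).
by apply: ge0_subset_integral => //; exact: mtail.
Qed.

Context (U : set_system nat) (UU : UltraFilter U) (Uoo : \oo `<=` U).

Lemma cvg_near_le (a : nat -> \bar R) (l : \bar R) (t : R) : l \is a fin_num ->
  (0 < t)%R -> a k @[k --> U] --> l -> \forall k \near U, a k <= l + t%:E.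
Proof.
move=> lfin t0; rewrite -(fineK lfin) => /fine_cvgP[afin /cvgrPdist_lt/(_ t t0)].
apply: filterS2 afin => k ak /= H; rewrite -(fineK ak) -EFinD lee_fin.
by move: H; rewrite distrC ltr_norml => /andP[_]; rewrite /=; lra.
Qed.

(** Among the first n picks, a label whose shift by [h] is itself a followed profile contributes a
    product that converges. If no followed profile stays at distance [h], the shifted label leaves
    every finite list of picks and its mass tends to 0. The labels outside the first n picks are
    controlled by the greedy bound. *)
Theorem fuzzy_compactness (f : nat -> L -> T -> R) : (forall k, fuzzy (f k)) ->
  exists F : L -> T -> R, fuzzy F /\ forall h A, measurable A ->
    forall t : R, (0 < t)%R -> \forall k \near U,
      \int[mu \x mu]_(p in A) (agreement (f k) h p)%:E <=
      \int[mu \x mu]_(p in A) (agreement F h p)%:E + t%:E.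
Proof.
move=> ff.
have mf k g : measurable_fun setT (f k g) by case: (ff k).
have f0 k g x : (0 <= f k g x)%R by case: (ff k).
have f01 k g x : (0 <= f k g x <= 1)%R by exact: fuzzy_ge0_le1.
pose M := fine (mu setT).
have ME : mu setT = M%:E by rewrite fineK// fin_num_measure.
have M0 : (0 <= M)%R by exact: fine_ge0.
pose m k g := fine (\int[mu]_x (f k g x)%:E).
have mE k g : \int[mu]_x (f k g x)%:E = (m k g)%:E.
  have /andP[i0 i1] := integral_unit_bounds mu (fun _ : nat => mf k g) (fun=> f01 k g) 0%N measurableT.
  by rewrite fineK// ge0_fin_numE//; exact: le_lt_trans i1 (finite_measure_lty mu).
have m0 k g : (0 <= m k g)%R.
  by rewrite -lee_fin -mE; apply: integral_ge0 => x _; rewrite lee_fin.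
have mM k s : uniq s -> (\sum_(g <- s) m k g <= M)%R.
  move=> us; rewrite -lee_fin -sumEFin -ME -(esum_mass eK e'K mu (ff k)).
  under eq_bigr do rewrite -mE.
  by apply: sum_seq_le_esum => // g; rewrite mE lee_fin.
have mleM k g : (m k g <= M)%R by have := mM k [:: g] isT; rewrite big_seq1.
have [gam gamP] := choice (fun k => greedy_enumeration (can_inj eK) (m0 k) (mM k)).
have gam_inj k : injective (gam k) by case: (gamP k).
have gam_small k n g : (forall i, (i < n)%N -> g != gam k i) -> (n%:R * m k g <= 2 * M)%R.
  by case: (gamP k) => _; exact.
have [lab labP] := consistent_labels UU gam.
have [|||Phi [mPhi Phi0 Phi1 Philim]] :=
  @weak_lim_family _ _ _ mu U UU (fun i k => f k (gam k i)).
- by move=> i k; exact: mf.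
- by move=> i k x; exact: f0.
- move=> n k x; have := @fuzzy_sum_le1 _ _ _ _ (f k) (map (gam k) (iota 0 n)) x (ff k).
  rewrite map_inj_uniq ?iota_uniq// => /(_ isT).
  by rewrite big_map -[X in iota 0 X]subn0 big_mkord.
have Phi01 i x : (0 <= Phi i x <= 1)%R.
  rewrite Phi0/= (le_trans _ (Phi1 i.+1 x))// big_ord_recr/= lerDr.
  exact: sumr_ge0.
have [F [fF PhiF]] := glue_profiles eK e'K lab mPhi Phi0 Phi1.
exists F; split => // h A mA t t0.
(* The profile sitting at distance [h] from the i-th one for [U]-almost all k, if there is one. *)
pose P i (o : option nat) := match o with
  | Some j => \forall k \near U, (gam k j = gam k i + h)%R
  | None => forall j, ~ \forall k \near U, (gam k j = gam k i + h)%R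
  end.
have exP i : exists o, P i o.
  have [[j Hj]|/forallNP H] := pselect (exists j, \forall k \near U, (gam k j = gam k i + h)%R).
    by exists (Some j).
  by exists None.
have [nxt nxtP] := choice exP.
pose l i p : R := (if nxt i is Some j then Phi i p.1 * Phi j p.2 else 0)%R.
have l0 i p : (0 <= l i p)%R by rewrite /l; case: (nxt i) => // j; rewrite mulr_ge0.
have ml i : measurable_fun setT (l i).
  by rewrite /l; case: (nxt i) => [j|]; [exact: measurable_tensor|exact: measurable_cst].
have tensor01 (a b : T -> R) : (forall x, (0 <= a x <= 1)%R) ->
    (forall x, (0 <= b x <= 1)%R) -> forall p : T * T, (0 <= a p.1 * b p.2 <= 1)%R.
  move=> a01 b01 p; have /andP[a0 a1] := a01 p.1; have /andP[b0 b1] := b01 p.2.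
  by rewrite mulr_ge0//= mulr_ile1.
have near_i i (u : R) : (0 < u)%R -> \forall k \near U,
    \int[mu \x mu]_(p in A) (f k (gam k i) p.1 * f k (gam k i + h)%R p.2)%:E <=
    \int[mu \x mu]_(p in A) (l i p)%:E + u%:E.
  move=> u0; have := nxtP i; rewrite /l; case: (nxt i) => [j Hj|Hi]/=.
    have := weak_lim_tensor UU (fun k => mf k (gam k i)) (fun k => mf k (gam k j))
      (mPhi i) (mPhi j) (fun k => f01 k _) (fun k => f01 k _) (Phi01 i) (Phi01 j)
      (Philim i) (Philim j) mA.
    have lfin : \int[mu \x mu]_(p in A) (Phi i p.1 * Phi j p.2)%:E \is a fin_num.
      have /andP[i0 i1] := integral_unit_bounds (mu \x mu)
        (fun _ : nat => measurable_tensor (mPhi i) (mPhi j))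
        (fun _ p => tensor01 _ _ (Phi01 i) (Phi01 j) p) 0%N mA.
      rewrite ge0_fin_numE// (le_lt_trans i1)// (le_lt_trans _ (product_measure_lty mu))//.
      by apply: le_measure; rewrite ?inE.
    move=> /(cvg_near_le lfin u0); apply: filterS2 Hj => k /= Hj.
    by rewrite -Hj.
  (* By the ultrafilter property, for [U]-almost all k the shifted label is none of the first [N]
     picks. Its mass is then at most [2 * M / N], that of its partner at most [M], and [N] makes the
     product at most [u]. *)
  pose N := (Num.bound (2 * M * M / u)).+1.
  have HN : (2 * M * M <= u * N%:R)%R.
    have b0 : (0 <= 2 * M * M / u)%R by rewrite divr_ge0 ?mulr_ge0// ltW.
    rewrite [leRHS]mulrC -ler_pdivrMr// (le_trans (ltW (archi_boundP b0)))//.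
    by rewrite /N ler_nat.
  have : \forall k \near U, forall j : 'I_N, gam k j <> (gam k i + h)%R.
    apply: filter_forall => j.
    by have [/(Hi j)|] := in_ultra_setVsetC [set k | gam k j = (gam k i + h)%R] UU.
  apply: filterS => k Hk; rewrite [X in _ <= X + _]integral0_eq// add0e.
  have small : (N%:R * m k (gam k i + h) <= 2 * M)%R.
    apply: gam_small => j jN; apply/eqP => E; exact: (Hk (Ordinal jN)).
  apply: (@le_trans _ _ (\int[mu \x mu]_p (f k (gam k i) p.1 * f k (gam k i + h)%R p.2)%:E)).
    apply: ge0_subset_integral => //.
      by apply/measurable_EFinP; exact: measurable_tensor.
    by move=> p _; rewrite lee_fin mulr_ge0.
  rewrite integral_tensorT// !mE -EFinM lee_fin.
  rewrite -(@ler_pM2r _ N%:R)// (le_trans _ HN)//.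
  rewrite -mulrA [X in (_ * X)%R]mulrC [leRHS]mulrC; apply: ler_pM => //.
  by rewrite mulr_ge0.
have mlE i : measurable_fun A (fun p => (l i p)%:E).
  by apply/measurable_EFinP; apply: measurable_funTS; exact: ml.
(* Half of [t] pays for the labels outside the first n picks; the other half is shared equally among
   the n comparisons with limits. *)
pose n := (Num.bound (4 * M * M / t)).+1.
have tn : (2 * M / n%:R * M <= t / 2)%R.
  have : (4 * M * M / t <= n%:R)%R.
    have b0 : (0 <= 4 * M * M / t)%R by rewrite divr_ge0 ?mulr_ge0// ltW.
    by rewrite (le_trans (ltW (archi_boundP b0)))// /n ler_nat.
  by rewrite ler_pdivrMr// => H; rewrite mulrAC ler_pdivrMr//; lra.
have tn2 : (0 < t / 2 / n%:R)%R by rewrite !divr_gt0.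
have : \forall k \near U, forall i : 'I_n,
    \int[mu \x mu]_(p in A) (f k (gam k i) p.1 * f k (gam k i + h)%R p.2)%:E <=
    \int[mu \x mu]_(p in A) (l i p)%:E + (t / 2 / n%:R)%:E.
  by apply: filter_forall => i; exact: near_i.
apply: filterS => k Hk.
have c0 : (0 <= 2 * M / n%:R)%R by rewrite divr_ge0 ?mulr_ge0.
have us : uniq (map (gam k) (iota 0 n)) by rewrite map_inj_uniq ?iota_uniq.
apply: le_trans (integral_agreement_split h (ff k) us mA c0 _) _.
  move=> g gs; rewrite mE lee_fin ler_pdivlMr// mulrC; apply: gam_small => i i_n.
  apply: contraNneq gs => ->; apply: map_f; by rewrite mem_iota.
rewrite big_map (_ : iota 0 n = index_iota 0 n); last by rewrite /index_iota subn0.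
rewrite big_mkord ME.
apply: (@le_trans _ _ (\sum_(i < n) (\int[mu \x mu]_(p in A) (l i p)%:E + (t / 2 / n%:R)%:E) + (t / 2)%:E)).
  by apply: leeD; [exact: lee_sum|rewrite -EFinM lee_fin].
rewrite big_split/= -addeA; apply: leeD; last first.
  rewrite sumEFin sumr_const card_ord -(mulr_natr (t / 2 / n%:R) n) divfK ?pnatr_eq0//.
  by rewrite -EFinD lee_fin -splitr.
apply: (@le_trans _ _ (\int[mu \x mu]_(p in A) (\sum_(i < n) (l i p)%:E))).
  by rewrite ge0_integral_sum// => i p _; rewrite lee_fin.
apply: ge0_le_integral => //.
- by move=> p _; apply: sume_ge0 => i _; rewrite lee_fin.
- by apply: emeasurable_sum => i; exact: mlE.
- by apply/measurable_EFinP/measurable_funTS; exact: (measurable_agreement eK e'K).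
move=> p _; rewrite sumEFin lee_fin.
have := agreement_limit_ge eK e'K (h := h) n p (nxt := nxt) fF Phi0 PhiF; apply => i j Eij.
by apply: labP; have := nxtP i; rewrite Eij.
Qed.
End fuzzy_compactness.

(** Agreement and disagreement add up to the measure of the set of pairs; as this is finite, an
    upper estimate of the one becomes a lower estimate of the other. *)
Lemma complement_le (R : realType) (a b c u m : \bar R) (t : R) :
  (0 <= a -> 0 <= b -> 0 <= c -> 0 <= u -> m \is a fin_num ->
   a + c = m -> b + u = m -> u <= c + t%:E -> a <= b + t%:E)%E.
Proof.
move=> a0 b0 c0 u0 mfin E1 E2.
have le_fin x y : (0 <= x -> 0 <= y -> x + y = m -> x \is a fin_num)%E.
  move=> x0 y0 E; rewrite ge0_fin_numE// (@le_lt_trans _ _ m)//.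
    by rewrite -E leeDl.
  by rewrite -ge0_fin_numE// -E adde_ge0.
have af := le_fin _ _ a0 c0 E1; have bf := le_fin _ _ b0 u0 E2.
have cf : c \is a fin_num by apply: (le_fin _ a) => //; rewrite addeC.
have uf : u \is a fin_num by apply: (le_fin _ b) => //; rewrite addeC.
move: E2; rewrite -E1 -(fineK af) -(fineK bf) -(fineK cf) -(fineK uf) -!EFinD !lee_fin.
by move=> [E]; lra.
Qed.

(** * Lower semicontinuity of the relaxed energy *)

Section energy.
Context d (T : measurableType d) (R : realType).
Context (L : zmodType) (e : nat -> L) (e' : L -> nat).
Hypotheses (eK : cancel e e') (e'K : cancel e' e).
Context (mu : {finite_measure set T -> \bar R}).
Context (K : L -> T * T -> R).
Hypotheses (mK : forall h, measurable_fun setT (K h)) (K0 : forall h p, 0 <= K h p).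
Local Open Scope ereal_scope.

Definition energy (f : L -> T -> R) : \bar R :=
  \esum_(h in setT) \int[mu \x mu]_p ((K h p)%:E * (disagreement f h p)%:E).

Lemma energy_ge0 f : fuzzy f -> 0 <= energy f.
Proof.
move=> ff; apply: esum_ge0 => h _; apply: integral_ge0 => p _.
by rewrite mule_ge0 ?lee_fin//; case/andP: (disagreement_ge0_le1 h p ff).
Qed.

Lemma integral_agreementD (f : L -> T -> R) h A : fuzzy f -> measurable A ->
  \int[mu \x mu]_(p in A) (disagreement f h p)%:E +
  \int[mu \x mu]_(p in A) (agreement f h p)%:E = (mu \x mu) A.
Proof.
move=> ff mA; rewrite -ge0_integralD//.
- rewrite -[RHS]mul1e -integral_cst//; apply: eq_integral => p _ /=.
  by rewrite -EFinD /disagreement subrK.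
- by move=> p _; rewrite lee_fin; case/andP: (disagreement_ge0_le1 h p ff).
- by apply/measurable_EFinP/measurable_funTS; exact: (measurable_disagreement eK e'K).
- by move=> p _; rewrite lee_fin; case/andP: (agreement_ge0_le1 h p ff).
- by apply/measurable_EFinP/measurable_funTS; exact: (measurable_agreement eK e'K).
Qed.

Context (U : set_system nat) (UU : UltraFilter U) (Uoo : \oo `<=` U).

(** Strict lower bounds cover the case of an infinite [energy F] as well: finitely many labels, each
    with a simple approximation of its kernel, already push the sum above [r]. *)
Lemma energy_lsc (f : nat -> L -> T -> R) (F : L -> T -> R) (r : R) :
  (forall k, fuzzy (f k)) -> fuzzy F ->
  (forall h A, measurable A -> forall t : R, (0 < t)%R -> \forall k \near U,
      \int[mu \x mu]_(p in A) (agreement (f k) h p)%:E <=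
      \int[mu \x mu]_(p in A) (agreement F h p)%:E + t%:E) ->
  r%:E < energy F -> \forall k \near U, r%:E < energy (f k).
Proof.
move=> ff fF agr rF.
have dis0 g h p : fuzzy g -> (0 <= disagreement g h p)%R.
  by move=> fg; case/andP: (disagreement_ge0_le1 h p fg).
have hle h A : measurable A -> eventually_le U
    (\int[mu \x mu]_(p in A) (disagreement F h p)%:E)
    (fun k => \int[mu \x mu]_(p in A) (disagreement (f k) h p)%:E).
  move=> mA t t0; apply: filterS (agr h A mA t t0) => k H.
  have FE := integral_agreementD h fF mA; have kE := integral_agreementD h (ff k) mA.
  have mAfin : (mu \x mu) A \is a fin_num.
    rewrite ge0_fin_numE// (le_lt_trans _ (product_measure_lty mu))//.
    by apply: le_measure; rewrite ?inE.
  apply: (complement_le _ _ _ _ mAfin FE kE H).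
  - by apply: integral_ge0 => p _; rewrite lee_fin dis0.
  - by apply: integral_ge0 => p _; rewrite lee_fin dis0.
  - apply: integral_ge0 => p _; rewrite lee_fin.
    by case/andP: (agreement_ge0_le1 h p fF).
  - apply: integral_ge0 => p _; rewrite lee_fin.
    by case/andP: (agreement_ge0_le1 h p (ff k)).
have exS h : exists S : nat -> \bar R, [/\ forall n, 0 <= S n,
    S n @[n --> \oo] --> \int[mu \x mu]_p ((K h p)%:E * (disagreement F h p)%:E) &
    forall n, eventually_le U (S n)
      (fun k => \int[mu \x mu]_p ((K h p)%:E * (disagreement (f k) h p)%:E))].
  apply: eventually_le_integralM => //.
  - exact: (measurable_disagreement eK e'K).
  - by move=> k; exact: (measurable_disagreement eK e'K).
  - by move=> p; exact: dis0.
  - by move=> k p; exact: dis0.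
  - by move=> A mA; exact: hle.
have [S SP] := choice exS.
have [_ [X [finX _] <-] rX] := ereal_sup_gt rF.
rewrite fsbig_finite//= in rX.
have [n rn] : exists n, r%:E < \sum_(h <- fset_set X) S h n.
  apply: contrapT => /forallNP H; move: rX; apply/negP; rewrite -leNgt.
  apply: (@cvge_le _ \oo _ _ (fun n => \sum_(h <- fset_set X) S h n)).
    by apply: nearW => n; rewrite leNgt; apply/negP.
  apply: cvg_nnesum => h _; last by case: (SP h).
  by apply: nearW => n; case: (SP h).
have : eventually_le U (\sum_(h <- fset_set X) S h n) (fun k => \sum_(h <- fset_set X)
    \int[mu \x mu]_p ((K h p)%:E * (disagreement (f k) h p)%:E)).
  by apply: eventually_le_sum => h _; case: (SP h).
move=> /eventually_le_lt/(_ rn); apply: filterS => k /lt_le_trans; apply.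
apply: sum_seq_le_esum => // h; apply: integral_ge0 => p _.
by rewrite mule_ge0 ?lee_fin// dis0.
Qed.

(** The tile itself, which serves as minimizer when every energy is infinite. *)
Lemma constant_fuzzy : fuzzy (fun (g : L) (_ : T) => if g == 0%R then 1%R else 0%R : R).
Proof.
split => [g|g x|x]; first exact: measurable_cst.
  by case: eqP.
rewrite -[RHS](@esum_set1 R L 0%R (fun=> 1)) ?lee_fin//.
rewrite [RHS]esum_mkcond; apply: eq_esum => g _.
case: eqP => [->|/eqP g0]; first by rewrite mem_set.
by rewrite memNset//= => /eqP; rewrite (negbTE g0).
Qed.

End energy.

Theorem exists_fuzzy_minimizer d (T : measurableType d) (R : realType)
    (L : zmodType) (e : nat -> L) (e' : L -> nat) (eK : cancel e e') (e'K : cancel e' e)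
    (mu : {finite_measure set T -> \bar R}) (K : L -> T * T -> R) :
  (forall h, measurable_fun setT (K h)) -> (forall h p, 0 <= K h p) ->
  exists F : L -> T -> R, fuzzy F /\ forall f, fuzzy f -> (energy mu K F <= energy mu K f)%E.
Proof.
move=> mK K0.
have [U [UU Uoo]] := ultraFilterLemma (@eventually_filter : ProperFilter \oo).
pose p := ereal_inf [set energy mu K f | f in @fuzzy d T R L].
have p0 : (0 <= p)%E by apply: le_ereal_inf_tmp => _ [f ff <-]; exact: energy_ge0.
have [poo|pfin] := eqVneq p +oo%E.
  exists (fun (g : L) (_ : T) => if g == 0 then 1 else 0); split; first exact: constant_fuzzy.
  move=> f ff; apply: (@le_trans _ _ p); first by rewrite poo leey.
  by apply: ereal_inf_lbound; exists f.
have pE : p \is a fin_num by rewrite ge0_fin_numE// ltey.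
have ex k : exists f, fuzzy f /\ (energy mu K f < p + (k.+1%:R^-1)%:E)%E.
  have k0 : 0 < k.+1%:R^-1 :> R by rewrite invr_gt0.
  by have [_ [f ff <-] fp] := lb_ereal_inf_adherent k0 pE; exists f.
have [f fP] := choice ex.
have ff k : fuzzy (f k) by case: (fP k).
have [F [fF agr]] := fuzzy_compactness eK e'K mu UU ff.
exists F; split => // g fg; apply: (@le_trans _ _ p); last first.
  by apply: ereal_inf_lbound; exists g.
rewrite leNgt; apply/negP => pF.
have [r pr rF] : exists2 r : R, fine p < r & (r%:E < energy mu K F)%E.
  move: pF; rewrite -(fineK pE); case: (energy mu K F) => [a||]//.
    by rewrite lte_fin => pa; exists ((fine p + a) / 2); rewrite ?lte_fin midf_lt.
  by move=> _; exists (fine p + 1); rewrite ?ltry// ltrDl.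
have H1 := energy_lsc eK e'K mK K0 UU ff fF agr rF.
have H2 : \forall k \near U, (energy mu K (f k) < r%:E)%E.
  apply: Uoo; have rp0 : 0 < r - fine p by rewrite subr_gt0.
  have := near_infty_natSinv_lt (PosNum rp0).
  apply: filterS => k /= Hk; apply: lt_trans (proj2 (fP k)) _.
  by rewrite -(fineK pE) -EFinD lte_fin -ltrBrDl.
by have [k [/lt_trans H /H]] := filter_ex (filterI H1 H2); rewrite ltxx.
Qed.

Lemma esum_single (R : realType) (L : choiceType) (a : L) (c : \bar R) : (0 <= c)%E ->
  (\esum_(g in setT) (if g == a then c else 0) = c)%E.
Proof.
move=> c0; rewrite -[RHS](@esum_set1 R L a (fun=> c))// [RHS]esum_mkcond.
apply: eq_esum => g _; case: eqP => [->|/eqP ga]; first by rewrite mem_set.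
by rewrite memNset//= => /eqP; rewrite (negbTE ga).
Qed.

(** * Finite relaxed minimizers are indicators *)

Section swapping.
Context d (T : measurableType d) (R : realType).
Context (L : zmodType) (e : nat -> L) (e' : L -> nat).
Hypotheses (eK : cancel e e') (e'K : cancel e' e).
Context (F : L -> T -> R) (fF : fuzzy F).
Context (a b : L) (ab : a != b) (A : set T) (mA : measurable A) (t : R).
Hypotheses (t0 : 0 < t) (aA : forall x, A x -> t <= F a x) (bA : forall x, A x -> t <= F b x).

Definition swap_sign (g : L) : R := (g == a)%:R - (g == b)%:R.

Definition swap (s : R) (g : L) (x : T) : R := F g x + s * swap_sign g * \1_A x.

Lemma swap_fuzzy s : `|s| <= t -> fuzzy (swap s).
Proof.
move=> st; have [mF F0 F1] := fF.
have /andP[st1 st2] : - t <= s <= t by rewrite -ler_norml.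
have uab : uniq [:: a; b] by rewrite /= inE ab.
have sw0 g x : 0 <= swap s g x.
  rewrite /swap /swap_sign; have := F0 g x; have := aA (x := x); have := bA (x := x).
  rewrite indicE; case: (boolP (x \in A)) => [/set_mem Ax|_]; last by rewrite mulr0 addr0.
  move=> /(_ Ax) Hb /(_ Ax) Ha Hg.
  have [ga|_] := eqVneq g a; have [gb|_] := eqVneq g b.
  - by move: ab; rewrite -ga gb eqxx.
  - by rewrite ga subr0 !mulr1; lra.
  - by rewrite gb sub0r mulrN1 mulr1; lra.
  - by rewrite subrr mulr0 mul0r addr0.
split => //.
  move=> g; apply: measurable_funD => //; apply: measurable_funM.
    exact: measurable_cst.
  exact: measurable_indic.
move=> x; rewrite (esum_split_seq uab); last by move=> g; rewrite lee_fin.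
rewrite -(F1 x) [RHS](esum_split_seq uab); last by move=> g; rewrite lee_fin.
congr (_ + _)%E.
  rewrite !big_cons !big_nil !adde0 -!EFinD; congr EFin.
  rewrite /swap /swap_sign !eqxx (negbTE ab) eq_sym (negbTE ab); ring.
apply: eq_esum => g /=; rewrite !inE negb_or => /andP[ga gb]; congr EFin.
by rewrite /swap /swap_sign (negbTE ga) (negbTE gb) subrr mulr0 mul0r addr0.
Qed.

(** With sigma the [swap_sign], the second-order term is [2 * t ^+ 2] times the sum over g of
    sigma(g) sigma(g + h), which equals 2 [h = 0] - [h = b - a] - [h = a - b]. Its negative part is
    moved to the left so that both sides are sums of nonnegative terms, fit for integration in the
    extended reals. *)
Lemma agreement_swap h (p : T * T) :
  agreement (swap t) h p + agreement (swap (- t)) h p +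
    2 * t ^+ 2 * \1_A p.1 * \1_A p.2 * ((h == b - a)%:R + (h == a - b)%:R) =
  2 * agreement F h p + 2 * t ^+ 2 * \1_A p.1 * \1_A p.2 * (2 * (h == 0)%:R).
Proof.
have fp : fuzzy (swap t) by apply: swap_fuzzy; rewrite gtr0_norm.
have fm : fuzzy (swap (- t)) by apply: swap_fuzzy; rewrite normrN gtr0_norm.
have [_ F0 _] := fF; have [_ fp0 _] := fp; have [_ fm0 _] := fm.
set c := 2 * t ^+ 2 * \1_A p.1 * \1_A p.2.
have c0 : 0 <= c by rewrite !mulr_ge0// ltW.
apply: EFin_inj; rewrite !EFinD !(EFinM 2) !agreementE//.
(* Writing each bracket as a sum over labels with at most one nonzero term reduces the identity to a
   polynomial one at each label. *)
pose sgl (g g' : L) (k : L) : \bar R := if k == g then (if g + h == g' then c else 0)%:E else 0%E.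
have sgl0 g g' k : (0 <= sgl g g' k)%E.
  by rewrite /sgl; case: eqP => // _; case: eqP; rewrite lee_fin.
have sglE g g' : (\esum_(k in setT) sgl g g' k = (c * (h == g' - g)%:R)%:E)%E.
  rewrite esum_single; last by case: eqP; rewrite lee_fin.
  rewrite [h == _]eq_sym subr_eq eq_sym [h + g]addrC.
  by case: eqP => _; rewrite ?mulr1 ?mulr0.
have prod0 (f1 f2 : L -> T -> R) : (forall g x, 0 <= f1 g x) -> (forall g x, 0 <= f2 g x) ->
    forall k, (0 <= (f1 k p.1 * f2 (k + h) p.2)%:E)%E.
  by move=> f10 f20 k; rewrite lee_fin mulr_ge0.
rewrite mulrDr EFinD -!sglE.
rewrite -(@esumZl _ _ _ _ eK e'K)//; last by move=> k; exact: prod0.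
have -> : (c * (2 * (h == 0)%:R))%:E = (\esum_(k in setT) (sgl a a k + sgl b b k))%E.
  rewrite esumD// !sglE !subrr -EFinD; congr EFin; ring.
rewrite -!esumD//; last first.
all: try by move=> *; rewrite ?adde_ge0 ?mule_ge0//; exact: prod0.
apply: eq_esum => k _.
have sglr g g' : sgl g g' k = (c * (k == g)%:R * (k + h == g')%:R)%:E.
  rewrite /sgl; case: eqP => [->|_]; last by rewrite mulr0 mul0r.
  by case: eqP => _; rewrite ?mulr1 ?mulr0.
rewrite !sglr -!EFinM -!EFinD; congr EFin; rewrite /swap /swap_sign /c; ring.
Qed.

Context (mu : {finite_measure set T -> \bar R}) (K : L -> T * T -> R).
Hypotheses (mK : forall h, measurable_fun setT (K h)) (K0 : forall h p, 0 <= K h p).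
Local Open Scope ereal_scope.

Definition self_interaction h : \bar R := \int[mu \x mu]_(p in A `*` A) (K h p)%:E.

(* The agreement is quadratic in the labelling, so adding two opposite
   perturbations cancels the linear terms. *)
Lemma energy_swap : let c := (2 * t ^+ 2)%:E in
  energy mu K (swap t) + energy mu K (swap (- t)) +
    c * (self_interaction 0%R + self_interaction 0%R) =
  energy mu K F + energy mu K F +
    c * (self_interaction (b - a)%R + self_interaction (a - b)%R).
Proof.
have fp : fuzzy (swap t) by apply: swap_fuzzy; rewrite gtr0_norm.
have fm : fuzzy (swap (- t)) by apply: swap_fuzzy; rewrite normrN gtr0_norm.
have mAA : measurable (A `*` A) by exact: measurableX.
have c0 : (0 <= 2 * t ^+ 2 :> R)%R by rewrite mulr_ge0// sqr_ge0.
have I0 h : 0 <= self_interaction h by apply: integral_ge0 => p _; rewrite lee_fin.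
pose D f h p := (K h p)%:E * (disagreement f h p)%:E.
have D0 f h p : fuzzy f -> 0 <= D f h p.
  by move=> ff; rewrite mule_ge0 ?lee_fin//; case/andP: (disagreement_ge0_le1 h p ff).
have mD f h : fuzzy f -> measurable_fun setT (D f h).
  move=> ff; apply: emeasurable_funM; apply/measurable_EFinP => //.
  exact: (measurable_disagreement eK e'K).
have intD0 f h : fuzzy f -> 0 <= \int[mu \x mu]_p D f h p.
  by move=> ff; apply: integral_ge0 => p _; exact: D0.
pose J h (s : R) : \bar R := (2 * t ^+ 2 * s)%:E * self_interaction h.
have JE h (s : R) : (0 <= s)%R ->
    J h s = \int[mu \x mu]_p (K h p * (2 * t ^+ 2 * \1_A p.1 * \1_A p.2 * s))%:E.
  move=> s0; rewrite /J /self_interaction integral_mkcond.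
  rewrite -ge0_integralZl//; last 3 first.
  - apply/(measurable_restrictT _ mAA)/measurable_EFinP; exact: measurable_funTS.
  - by move=> p _; rewrite /patch; case: (_ \in _); rewrite ?lee_fin.
  - by rewrite lee_fin mulr_ge0.
  apply: eq_integral => -[x y] _; rewrite /patch in_setX/= !indicE.
  case: (x \in A); case: (y \in A); rewrite /= ?mule0 -?EFinM; congr EFin; ring.
have J0 h (s : R) : (0 <= s)%R -> 0 <= J h s.
  by move=> s0; rewrite mule_ge0// lee_fin mulr_ge0.
have mJ h (s : R) : measurable_fun setT
    (fun p => (K h p * (2 * t ^+ 2 * \1_A p.1 * \1_A p.2 * s))%:E).
  apply/measurable_EFinP; apply: measurable_funM => //; apply: measurable_funM => //.
  under eq_fun do rewrite -mulrA.
  apply: measurable_funM => //.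
  by apply: measurable_tensor; apply: measurable_indic.
have Jsingle h' : \esum_(h in setT) J h (h == h')%:R = (2 * t ^+ 2)%:E * self_interaction h'.
  rewrite -[RHS](@esum_single R L h'); last by rewrite mule_ge0.
  apply: eq_esum => h _; rewrite /J; case: eqP => [->|_]; first by rewrite mulr1.
  by rewrite mulr0 mul0e.
have esum4 (a1 a2 a3 a4 : L -> \bar R) :
    (forall h, 0 <= a1 h) -> (forall h, 0 <= a2 h) ->
    (forall h, 0 <= a3 h) -> (forall h, 0 <= a4 h) ->
    \esum_(h in setT) a1 h + \esum_(h in setT) a2 h +
      (\esum_(h in setT) a3 h + \esum_(h in setT) a4 h) =
    \esum_(h in setT) (a1 h + a2 h + (a3 h + a4 h)).
  move=> p1 p2 p3 p4; rewrite esumD; last 2 first.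
  - by move=> h _; exact: adde_ge0.
  - by move=> h _; exact: adde_ge0.
  by rewrite !esumD.
have b0 (x : bool) : (0 <= x%:R :> R)%R by [].
have cD' h h' : (2 * t ^+ 2)%:E * (self_interaction h + self_interaction h') =
    (2 * t ^+ 2)%:E * self_interaction h + (2 * t ^+ 2)%:E * self_interaction h'.
  exact: (ge0_muleDr _ (I0 h) (I0 h')).
move=> c; rewrite /c cD' cD'.
rewrite -(Jsingle 0%R) -(Jsingle (b - a)%R) -(Jsingle (a - b)%R).
apply: (etrans (esum4 _ _ _ _ (fun h => intD0 _ h fp) (fun h => intD0 _ h fm)
  (fun h => J0 h _ (b0 (h == 0%R))) (fun h => J0 h _ (b0 (h == 0%R))))).
apply: (etrans _ (esym (esum4 _ _ _ _ (fun h => intD0 _ h fF) (fun h => intD0 _ h fF)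
  (fun h => J0 h _ (b0 (h == b - a)%R)) (fun h => J0 h _ (b0 (h == a - b)%R))))).
apply: eq_esum => h _.
have E p : D (swap t) h p + D (swap (- t)) h p +
    ((K h p * (2 * t ^+ 2 * \1_A p.1 * \1_A p.2 * (h == 0%R)%:R))%:E +
     (K h p * (2 * t ^+ 2 * \1_A p.1 * \1_A p.2 * (h == 0%R)%:R))%:E) =
  D F h p + D F h p +
    ((K h p * (2 * t ^+ 2 * \1_A p.1 * \1_A p.2 * (h == (b - a)%R)%:R))%:E +
     (K h p * (2 * t ^+ 2 * \1_A p.1 * \1_A p.2 * (h == (a - b)%R)%:R))%:E).
  rewrite /D -!EFinM -!EFinD; congr EFin; rewrite /disagreement.
  have := agreement_swap h p; move: (agreement F h p) (agreement (swap t) h p).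
  move: (agreement (swap (- t)) h p) => y z x H; have -> : x = (2 * z + 2 * t ^+ 2 * \1_A p.1 * \1_A p.2 * (2 * (h == 0)%:R)
     - 2 * t ^+ 2 * \1_A p.1 * \1_A p.2 * ((h == b - a)%:R + (h == a - b)%:R) - y)%R.
    by rewrite -H; ring.
  ring.
have int4 (f1 f2 f3 f4 : T * T -> \bar R) :
    (forall p, 0 <= f1 p) -> (forall p, 0 <= f2 p) ->
    (forall p, 0 <= f3 p) -> (forall p, 0 <= f4 p) ->
    measurable_fun setT f1 -> measurable_fun setT f2 ->
    measurable_fun setT f3 -> measurable_fun setT f4 ->
    \int[mu \x mu]_p f1 p + \int[mu \x mu]_p f2 p +
      (\int[mu \x mu]_p f3 p + \int[mu \x mu]_p f4 p) =
    \int[mu \x mu]_p (f1 p + f2 p + (f3 p + f4 p)).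
  move=> p1 p2 p3 p4 m1 m2 m3 m4.
  rewrite ge0_integralD//; last 4 first.
  - by move=> p _; rewrite adde_ge0.
  - exact: emeasurable_funD.
  - by move=> p _; rewrite adde_ge0.
  - exact: emeasurable_funD.
  by rewrite !ge0_integralD.
rewrite !JE//.
have pos s h' p : (0 <= s)%R -> 0 <= (K h' p * (2 * t ^+ 2 * \1_A p.1 * \1_A p.2 * s))%:E.
  move=> s0; rewrite lee_fin; apply: mulr_ge0 => //; apply: mulr_ge0 => //.
  by apply: mulr_ge0 => //; exact: mulr_ge0.
apply: (etrans (int4 _ _ _ _ (fun p => D0 _ h p fp) (fun p => D0 _ h p fm)
  (fun p => pos _ h p (b0 (h == 0%R))) (fun p => pos _ h p (b0 (h == 0%R)))
  (mD _ h fp) (mD _ h fm) (mJ h _) (mJ h _))).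
apply: (etrans _ (esym (int4 _ _ _ _ (fun p => D0 _ h p fF) (fun p => D0 _ h p fF)
  (fun p => pos _ h p (b0 (h == b - a)%R)) (fun p => pos _ h p (b0 (h == a - b)%R))
  (mD _ h fF) (mD _ h fF) (mJ h _) (mJ h _)))).
by apply: eq_integral => p _; exact: E.
Qed.
End swapping.

(** Only the energy [x] is finite, so only it can be cancelled; the self-interaction [i] may be
    infinite, as it is for fractional kernels. *)
Lemma no_gain (R : realType) (x y z i j : \bar R) (c : R) :
  (0 <= x -> x < +oo -> x <= y -> x <= z -> (0 < c)%R -> j < i ->
   y + z + c%:E * i = x + x + c%:E * j -> False)%E.
Proof.
move=> x0 xoo xy xz c0 ji E; have xfin : x \is a fin_num by rewrite ge0_fin_numE.
have : (x + x + c%:E * i <= y + z + c%:E * i)%E by rewrite leeD2r// leeD.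
by rewrite E leNgt => /negP; apply; rewrite lteD2lE ?fin_numD ?xfin// lte_pmul2l.
Qed.

(** As the values sum to 1, a value of [F g] strictly between 0 and 1 leaves room for a second
    positive label. The bad set is thus covered by countably many sets on which two given labels are
    both at least [1 / (n + 1)]; this common lower bound is the amount that can be swapped. *)
Theorem minimizer_zero_one d (T : measurableType d) (R : realType)
    (L : zmodType) (e : nat -> L) (e' : L -> nat) (eK : cancel e e') (e'K : cancel e' e)
    (mu : {finite_measure set T -> \bar R}) (K : L -> T * T -> R) (F : L -> T -> R) :
  (forall h, measurable_fun setT (K h)) -> (forall h p, 0 <= K h p) ->
  (forall A h, measurable A -> (0 < mu A)%E -> h != 0 ->
    exists A', [/\ measurable A', A' `<=` A, (0 < mu A')%E &
      (self_interaction A' mu K h + self_interaction A' mu K (- h) <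
       self_interaction A' mu K 0%R + self_interaction A' mu K 0%R)%E]) ->
  fuzzy F -> (forall f, fuzzy f -> (energy mu K F <= energy mu K f)%E) ->
  (energy mu K F < +oo)%E ->
  forall g, mu [set x | 0 < F g x < 1] = 0%E.
Proof.
move=> mK K0 Kself fF Fmin Foo g; have [mF F0 F1] := fF.
pose B b n := [set x | n.+1%:R^-1 <= F g x /\ n.+1%:R^-1 <= F b x].
have mge u (c : R) : measurable_fun setT u -> measurable [set x : T | c <= u x].
  move=> mu_; rewrite (_ : [set x | _] = u @^-1` `[c, +oo[).
    by rewrite -[X in measurable X]setTI; exact: mu_.
  by apply/seteqP; split => x /=; rewrite in_itv/= andbT.
have mB b n : measurable (B b n).
  rewrite (_ : B b n = [set x | n.+1%:R^-1 <= F g x] `&` [set x | n.+1%:R^-1 <= F b x])//.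
  by apply: measurableI; exact: mge.
have cover : [set x | 0 < F g x < 1] `<=` \bigcup_k (\bigcup_n (if e k == g then set0 else B (e k) n)).
  move=> x /= /andP[Fg0 Fg1].
  have [b bg Fb0] : exists2 b, b != g & 0 < F b x.
    apply: contrapT => H; move: (F1 x).
    rewrite (eq_esum (b := fun b => if b == g then (F g x)%:E else 0%E)); last first.
      move=> b _; case: eqP => [->//|/eqP bg]; congr EFin; apply/eqP.
      by rewrite eq_le F0 andbT leNgt; apply/negP => Fb; apply: H; exists b.
    rewrite esum_single ?lee_fin// => -[E]; by move: Fg1; rewrite E ltxx.
  have m0 : 0 < Num.min (F g x) (F b x) by rewrite lt_min Fg0.
  have [n _ /(_ n (leqnn _)) /= Hn] := near_infty_natSinv_lt (PosNum m0).
  exists (e' b) => //; exists n => //; rewrite e'K (negbTE bg).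
  by split; apply/ltW/(lt_le_trans Hn); rewrite ge_min lexx ?orbT.
have B0 b n : b != g -> mu (B b n) = 0%E.
  move=> bg; apply/eqP; rewrite -measure_le0 leNgt; apply/negP => Bpos.
  have gb : b - g != 0 by rewrite subr_eq0.
  have [A [mA AB Apos]] := Kself _ _ (mB b n) Bpos gb.
  have t0 : 0 < n.+1%:R^-1 :> R by rewrite invr_gt0.
  have gA x : A x -> n.+1%:R^-1 <= F g x by move/AB => [].
  have bA x : A x -> n.+1%:R^-1 <= F b x by move/AB => [].
  have gb' : g != b by rewrite eq_sym.
  have := energy_swap eK e'K fF gb' mA t0 gA bA mu mK K0.
  have := Fmin _ (swap_fuzzy fF gb' mA gA bA (s := n.+1%:R^-1) _).
  rewrite gtr0_norm// => /(_ (lexx _)).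
  have := Fmin _ (swap_fuzzy fF gb' mA gA bA (s := - n.+1%:R^-1) _).
  rewrite normrN gtr0_norm// => /(_ (lexx _)).
  rewrite opprB => Fm Fp /= E I.
  have c0 : 0 < 2 * n.+1%:R^-1 ^+ 2 :> R by rewrite mulr_gt0 ?exprn_gt0.
  exact: (no_gain (energy_ge0 mu K0 fF) Foo Fp Fm c0 I E).
suff : mu.-negligible [set x | 0 < F g x < 1].
  move=> H; apply: measure_negligible H.
  rewrite (_ : [set x | _] = F g @^-1` `]0, 1[).
    by rewrite -[X in measurable X]setTI; exact: mF.
  by apply/seteqP; split => x /=; rewrite in_itv.
apply: negligibleS cover _; apply: negligible_bigcup => k; apply: negligible_bigcup => n.
case: eqP => [_|/eqP kg]; first exact: negligible_set0.
by exists (B (e k) n); split; [exact: mB|exact: B0|].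
Qed.

(** * Lebesgue measure on R^N *)

Section lebesgueN_theory.
Context {R : realType} {n : nat}.
Implicit Types (a b x g : 'rV[R]_n.+1) (A B : set 'rV[R]_n.+1).
Local Notation outer := (@lebesgue_outer R n).

Definition set_coord a (i : 'I_n.+1) (c : R) : 'rV[R]_n.+1 :=
  \row_j (if j == i then c else a ord0 j).

Lemma box_volume_split a b i (c : R) :
  (box_volume a b = box_volume a (set_coord b i (Num.min (b ord0 i) c)) +
                    box_volume (set_coord a i (Num.max (a ord0 i) c)) b)%E.
Proof.
rewrite /box_volume -EFinD; congr EFin.
rewrite (bigD1 i)//= [X in _ = X + _](bigD1 i)//= [X in _ = _ + X](bigD1 i)//= !mxE eqxx.
set P := (\prod_(j | j != i) _).
have -> : \prod_(j < n.+1 | j != i) Num.max 0 (set_coord b i (Num.min (b ord0 i) c) ord0 j - a ord0 j) = P.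
  by apply: eq_bigr => j ji; rewrite mxE (negbTE ji).
have -> : \prod_(j < n.+1 | j != i) Num.max 0 (b ord0 j - set_coord a i (Num.max (a ord0 i) c) ord0 j) = P.
  by apply: eq_bigr => j ji; rewrite mxE (negbTE ji).
rewrite -mulrDl; congr (_ * _).
move: (a ord0 i) (b ord0 i) => u v.
have mx (y z : R) : Num.max y z = y /\ z <= y \/ Num.max y z = z /\ y <= z.
  by case: (leP y z) => yz; [right|left; split => //; exact: ltW].
have mn (y z : R) : Num.min y z = y /\ y <= z \/ Num.min y z = z /\ z <= y.
  by case: (leP y z) => yz; [left|right; split => //; exact: ltW].
have [[-> ?]|[-> ?]] := mn v c; have [[-> ?]|[-> ?]] := mx u c;
  have [[-> ?]|[-> ?]] := mx 0 (v - u);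
  repeat match goal with |- context[Num.max 0 ?z] => have [[-> ?]|[-> ?]] := mx 0 z end; lra.
Qed.

(** The hyperplane cuts every box of a cover into two boxes of the same total volume, the half-open
    shape fitting both the half-space and its complement. *)
Lemma caratheodory_halfspace i (c : R) :
  caratheodory_measurable outer [set x | x ord0 i <= c].
Proof.
apply: le_caratheodory_measurable => X.
apply: le_ereal_inf_tmp => _ [F XF <-].
pose F1 k := ((F k).1, set_coord (F k).2 i (Num.min ((F k).2 ord0 i) c)).
pose F2 k := (set_coord (F k).1 i (Num.max ((F k).1 ord0 i) c), (F k).2).
have -> : (\sum_(k <oo) box_volume (F k).1 (F k).2 =
    \sum_(k <oo) box_volume (F1 k).1 (F1 k).2 + \sum_(k <oo) box_volume (F2 k).1 (F2 k).2)%E.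
  rewrite -nneseriesD; [|by move=> *; exact: box_volume_ge0..].
  by apply: eq_eseriesr => k _; exact: box_volume_split.
apply: leeD; apply: ereal_inf_lbound.
  exists F1 => // x [/XF [k _ Fx] xc]; exists k => //= j; rewrite /F1/= mxE.
  by have := Fx j; case: eqP => // ->; rewrite le_min => /andP[-> ->].
exists F2 => // x [/XF [k _ Fx] xc]; exists k => //= j; rewrite /F2/= mxE.
have := Fx j; case: eqP => // ->; rewrite gt_max => /andP[-> ->].
by rewrite ltNge; move/negP : xc => ->.
Qed.

Lemma measurable_coord i : measurable_fun [set: RN R n] (fun x : RN R n => (x : 'rV[R]_n.+1) ord0 i).
Proof.
apply: (measurability _ (RGenOInfty.measurableE R)) => _ [_ [c ->] <-]; rewrite setTI.
rewrite (_ : _ @^-1` _ = ~` [set x : 'rV[R]_n.+1 | x ord0 i <= c]).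
  by apply: measurableC; exact: caratheodory_halfspace.
apply/seteqP; split => x /=; rewrite in_itv/= andbT ltNge; first by move/negP.
by move=> H; apply/negP.
Qed.

Lemma lebesgue_outer_translate A g : outer (translate A g) = outer A.
Proof.
suff le_tr B h : (outer (translate B h) <= outer B)%E.
  apply/eqP; rewrite eq_le le_tr/=.
  rewrite {1}(_ : A = translate (translate A g) (- g)) ?le_tr//.
  apply/seteqP; split => x; first by exists (x + g); [exists x|rewrite addrK].
  by move=> [_ [y Ay <-] <-]; rewrite addrK.
apply: le_ereal_inf_tmp => _ [F BF <-]; apply: ereal_inf_lbound.
exists (fun k => ((F k).1 + h, (F k).2 + h)).
  move=> _ [x Bx <-]; have [k _ Fx] := BF _ Bx; exists k => //= j.
  by have := Fx j; rewrite !mxE ltrD2r lerD2r.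
apply: eq_eseriesr => k _; rewrite /box_volume; congr EFin.
by apply: eq_bigr => j _; rewrite !mxE opprD addrACA subrr addr0.
Qed.

Lemma translateI A B g : translate (A `&` B) g = translate A g `&` translate B g.
Proof.
apply/seteqP; split; first by move=> _ [x [Ax Bx] <-]; split; exists x.
by move=> _ [[x Ax <-] [y By /addIr yx]]; exists x => //; split => //; rewrite -yx.
Qed.

Lemma translateK A g : translate (translate A g) (- g) = A.
Proof.
apply/seteqP; split => x; last by exists (x + g); [exists x|rewrite addrK].
by move=> [_ [y Ay <-] <-]; rewrite addrK.
Qed.

Lemma translateC A g : translate (~` A) g = ~` translate A g.
Proof.
apply/seteqP; split; first by move=> _ [x Ax <-] [y Ay /addIr yx]; apply: Ax; rewrite -yx.
move=> x Ax; exists (x - g); last by rewrite subrK.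
by move=> Axg; apply: Ax; exists (x - g) => //; rewrite subrK.
Qed.

Lemma measurable_translate A g : measurable (A : set (RN R n)) ->
  measurable (translate A g : set (RN R n)).
Proof.
move=> mA; suff : caratheodory_measurable outer (translate A g) by [].
move=> X; have -> : outer X = outer (translate X (- g)) by rewrite lebesgue_outer_translate.
have -> : outer (translate X (- g)) =
    (outer (translate X (- g) `&` A) + outer (translate X (- g) `&` ~` A))%E by exact: mA.
rewrite -(lebesgue_outer_translate (_ `&` A) g) -(lebesgue_outer_translate (_ `&` ~` A) g).
by rewrite !translateI translateC -[X in translate (translate _ _) X]opprK translateK.
Qed.

Lemma measurable_box a b : measurable (box a b : set (RN R n)).
Proof.
rewrite (_ : box a b = \big[setI/setT]_(i < n.+1)
    ((fun x : RN R n => (x : 'rV[R]_n.+1) ord0 i) @^-1` `]a ord0 i, b ord0 i])).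
  apply: bigsetI_measurable => i _.
  by rewrite -[X in measurable X]setTI; exact: measurable_coord.
rewrite -bigcap_seq; apply/seteqP; split => x.
  by move=> abx i _ /=; rewrite in_itv/=; exact: abx.
by move=> H i; have := H i (mem_index_enum i); rewrite /= in_itv.
Qed.

Lemma lebesgueN_box a b : (lebesgueN (box a b : set (RN R n)) <= box_volume a b)%E.
Proof.
apply: ereal_inf_lbound => /=; exists (fun k => if k is 0%N then (a, b) else (a, a)).
  by move=> x abx; exists 0%N.
rewrite nneseries_recl//; last by move=> k _; case: k => [|k]; exact: box_volume_ge0.
rewrite eseries_cond/= eseries0 ?adde0// => -[|k]// _ _ /=.
by rewrite /box_volume big_ord_recl subrr maxxx mul0r.
Qed.

Lemma lebesgueN_translate A g : lebesgueN (translate A g : set (RN R n)) = lebesgueN (A : set (RN R n)).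
Proof. exact: lebesgue_outer_translate. Qed.

Lemma measurable_translation g : measurable_fun [set: RN R n] (fun x : RN R n => (x : 'rV[R]_n.+1) + g : RN R n).
Proof.
move=> _ A mA; rewrite setTI.
rewrite (_ : _ @^-1` A = translate A (- g)); first exact: measurable_translate.
apply/seteqP; split => x; first by move=> Ax; exists (x + g) => //; rewrite addrK.
by move=> [y Ay <-]; rewrite /= subrK.
Qed.

Definition cube (k : nat) : set 'rV[R]_n.+1 := box (const_mx (- k%:R)) (const_mx k%:R).

Lemma bigcup_cube : \bigcup_k cube k = setT.
Proof.
rewrite -subTset => x _.
pose M := \sum_i `|x ord0 i|.
exists (Num.bound M).+1 => // i; rewrite !mxE.
have xM : `|x ord0 i| <= M by rewrite /M (bigD1 i)//= lerDl sumr_ge0.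
have MB := archi_boundP (le_trans (normr_ge0 _) xM).
have xB : `|x ord0 i| < (Num.bound M).+1%:R.
  by rewrite (le_lt_trans xM)// (lt_le_trans MB)// ler_nat.
by move: xB; rewrite ltr_norml => /andP[-> /ltW ->].
Qed.

Lemma lebesgueN_sigma_finite : sigma_finite [set: RN R n] (@lebesgueN R n).
Proof.
exists cube; first by rewrite bigcup_cube.
move=> k; split; first exact: measurable_box.
by rewrite (le_lt_trans (lebesgueN_box _ _))// ltry.
Qed.

HB.instance Definition _ := @Measure_isSigmaFinite.Build _ (RN R n) R (@lebesgueN R n) lebesgueN_sigma_finite.

End lebesgueN_theory.

(** * Kernels evaluated at a difference *)

Section difference_measurability.
Context {R : realType} {n : nat}.
Local Notation V := 'rV[R]_n.+1.
Local Notation mu := (@lebesgueN R n).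

Definition shifted_difference (g : V) (p : RN R n * RN R n) : V := (p.2 : V) - (p.1 : V) + g.

(* Lebesgue measurability of [B] does not make its preimage under the difference
   measurable for the product of the Lebesgue sigma-algebras. *)
Definition difference_measurable (B : set V) := measurable (B : set (RN R n)) /\
  forall g, measurable (shifted_difference g @^-1` B).

Lemma difference_measurable_box a b : difference_measurable (box a b).
Proof.
split=> [|g]; first exact: measurable_box.
rewrite (_ : _ @^-1` _ = \big[setI/setT]_(i < n.+1)
    ((fun p : RN R n * RN R n => (p.2 : V) ord0 i - (p.1 : V) ord0 i + g ord0 i) @^-1` `]a ord0 i, b ord0 i])).
  apply: bigsetI_measurable => i _.
  rewrite -[X in measurable X]setTI.
  apply: measurable_funD => //; apply: measurable_funB.
    exact: (measurableT_comp (measurable_coord i) measurable_snd).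
  exact: (measurableT_comp (measurable_coord i) measurable_fst).
rewrite -bigcap_seq; apply/seteqP; split => p.
  by move=> H i _ /=; rewrite in_itv/=; have := H i; rewrite !mxE.
by move=> H i; have := H i (mem_index_enum i); rewrite /= in_itv/= !mxE.
Qed.

Lemma difference_measurable_bigcup (B : nat -> set V) :
  (forall k, difference_measurable (B k)) -> difference_measurable (\bigcup_k B k).
Proof.
move=> mB; split=> [|g]; first by apply: bigcupT_measurable => k; case: (mB k).
by rewrite preimage_bigcup; apply: bigcupT_measurable => k; case: (mB k).
Qed.

Lemma difference_measurableC (B : set V) :
  difference_measurable B -> difference_measurable (~` B).
Proof.
move=> [mB mBg]; split=> [|g]; first exact: measurableC.
by rewrite preimage_setC; apply: measurableC; exact: mBg.
Qed.

Lemma difference_measurable_bigcap (B : nat -> set V) :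
  (forall k, difference_measurable (B k)) -> difference_measurable (\bigcap_k B k).
Proof.
move=> mB; rewrite -[\bigcap_k B k]setCK setC_bigcap; apply: difference_measurableC.
by apply: difference_measurable_bigcup => k; exact: difference_measurableC.
Qed.

Lemma difference_measurableD (B C : set V) :
  difference_measurable B -> difference_measurable C -> difference_measurable (B `\` C).
Proof.
move=> [mB mBg] [mC mCg]; split=> [|g]; first exact: measurableD.
have -> : shifted_difference g @^-1` (B `\` C) =
    shifted_difference g @^-1` B `\` shifted_difference g @^-1` C by [].
by apply: measurableD; [exact: mBg|exact: mCg].
Qed.

(** Almost optimal covers by boxes are intersected. The result is built from boxes by countable
    operations, hence difference measurable, and finiteness of the mass turns equal measures into a
    null difference. *)
Lemma finite_envelope (A : set V) : measurable (A : set (RN R n)) -> (mu A < +oo)%E ->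
  exists B, [/\ difference_measurable B, A `<=` B & mu (B `\` A) = 0%E].
Proof.
move=> mA Aoo; have Afin : mu A \is a fin_num by rewrite ge0_fin_numE.
have ex k : exists F : nat -> V * V, A `<=` \bigcup_j box (F j).1 (F j).2 /\
    (\sum_(j <oo) box_volume (F j).1 (F j).2 <= mu A + (k.+1%:R^-1)%:E)%E.
  have k0 : 0 < k.+1%:R^-1 :> R by rewrite invr_gt0.
  have [_ [F AF <-] ltF] := lb_ereal_inf_adherent k0 Afin.
  by exists F; split => //; exact: ltW.
have [F FP] := choice ex.
pose C k := \bigcup_j box (F k j).1 (F k j).2.
have mC k : difference_measurable (C k).
  by apply: difference_measurable_bigcup => j; exact: difference_measurable_box.
have mCk k : measurable (C k : set (RN R n)) by case: (mC k).
have mB := difference_measurable_bigcap mC; exists (\bigcap_k C k).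
have AB : A `<=` \bigcap_k C k by move=> x Ax k _; apply: (FP k).1.
split => //; have [mB' _] := mB.
have BA : (mu (\bigcap_k C k) <= mu A)%E.
  apply/lee_addgt0Pr => eps eps0.
  have [N _ /(_ N (leqnn _)) /= HN] := near_infty_natSinv_lt (PosNum eps0).
  apply: (@le_trans _ _ (mu (C N))).
    by apply: le_measure; rewrite ?inE// => x; apply.
  apply: (@le_trans _ _ (\sum_(j <oo) box_volume (F N j).1 (F N j).2)%E).
    by apply: ereal_inf_lbound; exists (F N).
  by apply: le_trans (FP N).2 _; rewrite leeD2l// lee_fin ltW.
have Bfin : (mu (\bigcap_k C k) < +oo)%E by exact: le_lt_trans Aoo.
rewrite measureD// setIidr//.
apply/eqP; rewrite eq_le; apply/andP; split; first by rewrite leeBlDr// add0e.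
by rewrite leeBrDr// add0e; apply: le_measure; rewrite ?inE.
Qed.

Lemma envelope (A : set V) : measurable (A : set (RN R n)) ->
  exists B, [/\ difference_measurable B, A `<=` B & mu (B `\` A) = 0%E].
Proof.
move=> mA.
have ex k : exists B, [/\ difference_measurable B, A `&` cube k `<=` B & mu (B `\` (A `&` cube k)) = 0%E].
  have mAk : measurable (A `&` cube k : set (RN R n)).
    by apply: measurableI => //; exact: measurable_box.
  apply: finite_envelope => //.
  apply: (@le_lt_trans _ _ (mu (cube k))).
    by apply: le_measure; rewrite ?inE//; exact: measurable_box.
  by rewrite (le_lt_trans (lebesgueN_box _ _))// ltry.
have [B BP] := choice ex.
have mB k : difference_measurable (B k) by case: (BP k).
have mU := difference_measurable_bigcup mB.
exists (\bigcup_k B k); split => //.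
  move=> x Ax; have : (\bigcup_k @cube R n k) x by rewrite bigcup_cube.
  by move=> [k _ xk]; exists k => //; case: (BP k) => _ + _; apply.
have [mU' _] := mU.
apply: measure_negligible; first exact: measurableD.
apply: (@negligibleS _ _ _ mu (\bigcup_k (B k `\` (A `&` cube k)))).
  by move=> x [[k _ Bx] nAx]; exists k => //; split => // -[].
apply: negligible_bigcup => k; exists (B k `\` (A `&` cube k)); split => //.
  apply: measurableD; first by case: (mB k).
  by apply: measurableI => //; exact: measurable_box.
by case: (BP k).
Qed.

(** Each superlevel set of [K] at a rational level is replaced by its envelope. The discrepancies
    form a null set, and [N] is an envelope of that set in turn, so that removing it is a difference
    measurable operation as well. Off [N] the superlevel sets coincide with their envelopes. *)
Lemma difference_measurable_version (K : V -> R) :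
  measurable_fun [set: RN R n] (K : RN R n -> R) -> (forall x, 0 <= K x) ->
  exists N, [/\ measurable (N : set (RN R n)), mu N = 0%E &
    forall g, measurable_fun setT
      (fun p => K (shifted_difference g p) * \1_(~` N) (shifted_difference g p))].
Proof.
move=> mK K0.
pose A m k := [set x : V | (m%:R / k.+1%:R) < K x].
have mA m k : measurable (A m k : set (RN R n)).
  rewrite (_ : A m k = (K : RN R n -> R) @^-1` `]m%:R / k.+1%:R, +oo[).
    by rewrite -[X in measurable X]setTI; exact: mK.
  by apply/seteqP; split => x /=; rewrite in_itv/= andbT.
have [B BP] := choice (fun q : nat * nat => envelope (mA q.1 q.2)).
pose N0 := \bigcup_m \bigcup_k (B (m, k) `\` A m k).
have mN0 : measurable (N0 : set (RN R n)).
  apply: bigcupT_measurable => m; apply: bigcupT_measurable => k; apply: measurableD => //.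
  by case: (BP (m, k)) => -[].
have N00 : mu N0 = 0%E.
  apply: measure_negligible => //; apply: negligible_bigcup => m; apply: negligible_bigcup => k.
  exists (B (m, k) `\` A m k); split => //; last by case: (BP (m, k)).
  by apply: measurableD => //; case: (BP (m, k)) => -[].
have [N [mN N0N NN0]] := envelope mN0.
have [mN' _] := mN.
exists N; split => //.
  apply: measure_negligible => //.
  apply: (@negligibleS _ _ _ mu (N0 `|` (N `\` N0))); first by rewrite setDUK.
  apply: negligibleU; first by exists N0; split.
  by exists (N `\` N0); split => //; exact: measurableD.
move=> g.
apply: (measurability _ (RGenOInfty.measurableE R)) => _ [_ [c ->] <-]; rewrite setTI.
have [c0|c0] := ltP c 0.
  rewrite (_ : _ @^-1` _ = setT)//; apply/seteqP; split => // p _ /=.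
  by rewrite in_itv/= andbT (lt_le_trans c0)// mulr_ge0.
rewrite (_ : _ @^-1` _ = shifted_difference g @^-1`
   ((\bigcup_k \bigcup_m (if c <= m%:R / k.+1%:R then B (m, k) else set0)) `\` N)).
  have [_ //] : difference_measurable
    ((\bigcup_k \bigcup_m (if c <= m%:R / k.+1%:R then B (m, k) else set0)) `\` N).
    apply: difference_measurableD => //.
    apply: difference_measurable_bigcup => k; apply: difference_measurable_bigcup => m.
    case: ifP => _; first by case: (BP (m, k)).
    have -> : set0 = box (0 : V) 0.
      apply/seteqP; split=> [//|x /(_ ord0)]; rewrite mxE => /andP[/lt_le_trans H /H].
      by rewrite ltxx.
    exact: difference_measurable_box.
apply/seteqP; split => p /=; rewrite in_itv/= andbT indicE in_setC.
  case: (boolP (_ \in N)) => [_|/negP pN]; first by rewrite mulr0 ltNge c0.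
  rewrite mulr1 => cK; split; last by move=> Nz; apply: pN; exact: mem_set.
  have Kc : 0 < K (shifted_difference g p) - c by rewrite subr_gt0.
  have [k _ /(_ k (leqnn _)) /= Hk] := near_infty_natSinv_lt (PosNum Kc).
  have ck0 : 0 <= c * k.+1%:R by rewrite mulr_ge0.
  (* The first multiple of [1 / (k + 1)] above [c]; it exceeds [c] by at most [1 / (k + 1)] and so
     stays below the value of [K]. *)
  pose m := (Num.truncn (c * k.+1%:R)).+1.
  have /andP[m1 m2] := truncn_itv ck0.
  exists k => //; exists m => //.
  have cm : c <= m%:R / k.+1%:R by rewrite ler_pdivlMr// ltW.
  rewrite cm; case: (BP (m, k)) => _ + _; apply => /=.
  rewrite /A /= (@le_lt_trans _ _ (c + k.+1%:R^-1))//.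
    rewrite ler_pdivrMr// mulrDl mulVf// /m -natr1 lerD2r//.
  by move: Hk; rewrite ltrBrDl.
move=> [[k _ [m _]]]; case: ifP => // cm Bp pN.
rewrite memNset//= mulr1 (le_lt_trans cm)//.
apply: contrapT => nA; apply: pN; apply: N0N; exists m => //; exists k => //.
Qed.

End difference_measurability.

(** * Lattices and their tiles *)

Section lattice_theory.
Context {R : realType} {n : nat}.
Local Notation V := 'rV[R]_n.+1.
Context (G : set V) (latG : lattice G).

Lemma lattice0 : G 0. Proof. by case: latG => -[]. Qed.

Lemma latticeB x y : G x -> G y -> G (x - y).
Proof. by case: latG => -[_ + _ _]; exact. Qed.

Lemma latticeN x : G x -> G (- x).
Proof. by move=> Gx; rewrite -[- x]add0r; apply: latticeB => //; exact: lattice0. Qed.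

Lemma latticeD x y : G x -> G y -> G (x + y).
Proof. by move=> Gx Gy; rewrite -[y]opprK; apply: latticeB => //; exact: latticeN. Qed.

Lemma lattice_int_comb k (v : 'I_k -> V) (c : 'I_k -> int) :
  (forall i, G (v i)) -> G (\sum_i v i *~ c i).
Proof.
move=> Gv; apply: (big_ind G) => [||i _]; [exact: lattice0|exact: latticeD|].
have Gn m : G (v i *+ m).
  elim: m => [|m IH]; first by rewrite mulr0n; exact: lattice0.
  by rewrite mulrS; exact: latticeD.
by case: (c i) => m; [exact: Gn|rewrite NegzE mulrNz; apply: latticeN; exact: Gn].
Qed.

Lemma lattice_separated : exists2 eps : R, 0 < eps &
  forall g, G g -> (forall i, `|g ord0 i| < eps) -> g = 0.
Proof.
have [_ dG _] := latG; have [_ [W W0 WG]] := dG _ lattice0.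
move/nbhs_ballP: W0 => [eps /= eps0 epsW]; exists eps => // g Gg geps.
have : (W `&` G) g.
  split => //; apply: epsW; split => // i j.
  rewrite ord1 /ball /= mxE sub0r normrN; exact: geps.
by rewrite WG.
Qed.

Definition frac (x : R) : R := x - (Num.floor x)%:~R.

Lemma frac_ge0_lt1 x : 0 <= frac x < 1.
Proof.
have /andP[f1 f2] := floor_itv x; rewrite /frac.
by move: f2; rewrite intrD; move: f1; move: ((Num.floor x)%:~R) => z; lra.
Qed.

(* Simultaneous Dirichlet approximation. *)
Lemma dirichlet_pigeonhole (b : 'I_n.+1 -> R) (M : nat) : (0 < M)%N ->
  exists k l : nat, k <> l /\ forall j, `|frac (k%:R * b j) - frac (l%:R * b j)| < M%:R^-1.
Proof.
move=> M0.
have fM x : (Num.truncn (M%:R * frac x) < M)%N.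
  have /andP[f0 f1] := frac_ge0_lt1 x.
  rewrite -(ltr_nat R) (@le_lt_trans _ _ (M%:R * frac x))//.
    by have /andP[] := truncn_itv (mulr_ge0 (ler0n R M) f0).
  by rewrite -[ltRHS]mulr1 ltr_pM2l// ltr0n.
pose N := #|{ffun 'I_n.+1 -> 'I_M}|.
pose p (k : 'I_N.+1) : {ffun 'I_n.+1 -> 'I_M} := [ffun j => Ordinal (fM (k%:R * b j))].
have : ~~ injectiveb p.
  apply/negP => /injectiveP /leq_card; rewrite card_ord -/N ltnn //.
move=> /injectivePn[k [l kl pkl]]; exists k, l; split.
  by move=> E; move/eqP: kl; apply; exact: val_inj.
move=> j; have := congr1 (fun f : {ffun _ -> _} => val (f j)) pkl; rewrite !ffunE /= => E.
have /andP[fk0 _] := frac_ge0_lt1 (k%:R * b j).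
have /andP[fl0 _] := frac_ge0_lt1 (l%:R * b j).
have /andP[k1 k2] := truncn_itv (mulr_ge0 (ler0n R M) fk0).
have /andP[l1 l2] := truncn_itv (mulr_ge0 (ler0n R M) fl0).
rewrite E in k1 k2.
have MR : 0 < M%:R :> R by rewrite ltr0n.
rewrite -(@ltr_pM2l _ M%:R)// mulfV ?gt_eqF//.
have -> : M%:R * `|frac (k%:R * b j) - frac (l%:R * b j)| =
    `|M%:R * frac (k%:R * b j) - M%:R * frac (l%:R * b j)|.
  by rewrite -mulrBr normrM gtr0_norm.
move: k1 k2 l1 l2; rewrite ltr_norml -natr1.
move: (M%:R * frac (k%:R * b j)) (M%:R * frac (l%:R * b j)) => x y; lra.
Qed.

(** Independence over the integers gives independence over the reals only because the lattice is
    discrete. From a real relation, Dirichlet approximation produces an integer combination that is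
    too short to be a nonzero lattice vector; it vanishes, hence so do its coefficients. *)
Lemma zfree_unitmx (v : 'I_n.+1 -> V) : (forall i, G (v i)) -> zfree v ->
  \matrix_i v i \in unitmx.
Proof.
move=> Gv zv; rewrite -row_free_unit -kermx_eq0.
apply/rowV0P => c; rewrite sub_kermx => /eqP cv.
apply/eqP; apply: contrapT => /negP c0.
have [i0 ci0] : exists i, c ord0 i != 0.
  by move/rV0Pn: c0.
(* Normalized so that the coefficient at [i0] is 1: the integer coefficient there is then exactly
   [k - l], which is not 0. *)
pose b j := c ord0 j / c ord0 i0.
have bv : \sum_j b j *: v j = 0.
  have : (c ord0 i0)^-1 *: (c *m \matrix_i v i) = 0 by rewrite cv scaler0.
  rewrite mulmx_sum_row scaler_sumr => E; rewrite -[RHS]E; apply: eq_bigr => j _.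
  by rewrite rowK scalerA /b mulrC.
have [eps eps0 sep] := lattice_separated.
pose S := \sum_j \sum_i `|v j ord0 i|.
have S0 : 0 <= S by apply: sumr_ge0 => j _; apply: sumr_ge0.
pose M := (Num.bound (S / eps)).+1.
have SM : S * M%:R^-1 < eps.
  rewrite ltr_pdivrMr// mulrC -ltr_pdivrMr//.
  rewrite (lt_trans (archi_boundP _)) ?ltr_nat// divr_ge0//; exact: ltW.
have [k [l [kl fkl]]] := dirichlet_pigeonhole b (ltn0Sn _ : (0 < M)%N).
pose z j : int := Num.floor (k%:R * b j) - Num.floor (l%:R * b j).
have zE : \sum_j v j *~ z j =
    - \sum_j (frac (k%:R * b j) - frac (l%:R * b j)) *: v j.
  apply/eqP; rewrite -subr_eq0 opprK -big_split/=; apply/eqP.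
  transitivity (\sum_j (k%:R - l%:R) *: (b j *: v j)); last by rewrite -scaler_sumr bv scaler0.
  apply: eq_bigr => j _.
  rewrite -scaler_int -scalerDl scalerA /z /frac intrB; congr (_ *: _); ring.
have : \sum_j v j *~ z j = 0.
  apply: sep; first exact: lattice_int_comb.
  move=> i; apply: le_lt_trans SM; rewrite zE mxE normrN summxE.
  apply: le_trans (ler_norm_sum _ _ _) _; rewrite /S mulr_suml; apply: ler_sum => j _.
  rewrite mxE normrM mulrC ler_pM//; last exact: ltW.
  by rewrite (bigD1 i)//= lerDl sumr_ge0.
move/zv => /(_ i0); rewrite /z /b mulfV// !mulr1.
have fl (q : nat) : Num.floor (q%:R : R) = q%:Z.
  by rewrite -[q%:R]/((q%:Z)%:~R) intrKfloor.
by rewrite !fl => /eqP; rewrite subr_eq0 => /eqP[].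
Qed.

Lemma lattice_cobounded : exists M : R, forall x, exists2 g, G g & forall i, `|(x - g) ord0 i| <= M.
Proof.
have [_ _ [[v [Gv zv]] _]] := latG.
have vunit := zfree_unitmx Gv zv.
exists (\sum_j \sum_i `|v j ord0 i|) => x.
pose t := x *m invmx (\matrix_i v i).
have xE : x = \sum_j t ord0 j *: v j.
  rewrite -[LHS](mulmxKV vunit) mulmx_sum_row; apply: eq_bigr => j _; by rewrite rowK.
exists (\sum_j v j *~ Num.floor (t ord0 j)); first exact: lattice_int_comb.
move=> i; rewrite {1}xE -sumrB summxE (le_trans (ler_norm_sum _ _ _))//.
apply: ler_sum => j _; rewrite -scaler_int -scalerBl mxE normrM.
have /andP[f0 f1] := frac_ge0_lt1 (t ord0 j).
rewrite ger0_norm// (@le_trans _ _ (1 * `|v j ord0 i|))//.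
  by rewrite ler_wpM2r// ltW.
by rewrite mul1r (bigD1 i)//= lerDl sumr_ge0.
Qed.
End lattice_theory.

(** Labels are summed over and added, so the subgroup is turned into a type with its own addition,
    together with an enumeration and the embedding [v]. *)
Lemma transport_zmodType (V : zmodType) (G : set V) (f : nat -> V) :
  G 0 -> (forall x y, G x -> G y -> G (x - y)) -> set_bij setT G f ->
  exists (L : zmodType) (e : nat -> L) (e' : L -> nat) (v : L -> V),
    [/\ cancel e e', cancel e' e, {morph v : a b / a + b >-> a + b}, injective v &
        forall x, G x <-> exists a, v a = x].
Proof.
move=> G0 GB [fG finj fsurj].
have GN x : G x -> G (- x) by move=> Gx; rewrite -[- x]add0r; exact: GB.
have GD x y : G x -> G y -> G (x + y) by move=> Gx Gy; rewrite -[y]opprK; apply: GB => //; exact: GN.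
pose L0 := {x : V | x \in G}.
pose mk x (Gx : G x) : L0 := exist _ x (mem_set Gx).
have LG (a : L0) : G (val a) by exact: set_mem (valP a).
pose add0 (a b : L0) := mk _ (GD _ _ (LG a) (LG b)).
pose opp0 (a : L0) := mk _ (GN _ (LG a)).
have addA : associative add0 by move=> a b c; apply: val_inj; rewrite /= addrA.
have addC : commutative add0 by move=> a b; apply: val_inj; rewrite /= addrC.
have add0l : left_id (mk _ G0) add0 by move=> a; apply: val_inj; rewrite /= add0r.
have addN : left_inverse (mk _ G0) opp0 add0 by move=> a; apply: val_inj; rewrite /= addNr.
pose zm := GRing.isZmodule.Build L0 addA addC add0l addN.
pose L : zmodType := HB.pack L0 zm.
have fGk k : G (f k) by exact: fG.
have ex (a : L0) : exists k, f k = val a by have [k _ fk] := fsurj _ (LG a); exists k.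
have [e' e'P] := choice ex.
exists L, (fun k => mk _ (fGk k)), e', (fun a : L0 => val a); split => //.
- by move=> k; apply: finj; rewrite ?inE// e'P.
- by move=> a; apply: val_inj; rewrite /= e'P.
- move=> x; split=> [Gx|[a <-]]; last exact: LG.
  by exists (mk _ Gx).
Qed.

(** * A bounded measurable tile *)

Section tile.
Context {R : realType} {n : nat}.
Local Notation V := 'rV[R]_n.+1.

(** A numerical code of the grid cell of side [t] containing [x]. Equal codes mean close points, and
    the order on codes allows a measurable choice among points of a coset. *)
Definition grid (t : R) (x : V) : nat :=
  choice.pickle [ffun i : 'I_n.+1 => Num.floor (x ord0 i / t)].

Lemma grid_close t x y : 0 < t -> grid t x = grid t y ->
  forall i, `|x ord0 i - y ord0 i| < t.
Proof.
move=> t0 /(pcan_inj choice.pickleK)/ffunP xy i; have := xy i; rewrite !ffunE => E.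
have /andP[x1 x2] := floor_itv (x ord0 i / t).
have /andP[y1 y2] := floor_itv (y ord0 i / t).
move: x1 x2 y1 y2; rewrite E intrD !(ler_pdivlMr _ _ t0) !(ltr_pdivrMr _ _ t0).
rewrite ltr_norml; move: (_%:~R) => z; rewrite !mulrDl mul1r.
move: (x ord0 i) (y ord0 i) (z * t) => u v w; lra.
Qed.

Lemma measurable_grid t k : 0 < t -> measurable (grid t @^-1` [set k] : set (RN R n)).
Proof.
move=> t0; have [[x0 x0k]|] := pselect (exists x0, grid t x0 = k); last first.
  move/forallNP => H; rewrite (_ : _ @^-1` _ = set0)//.
  by apply/seteqP; split => // x /= /H.
rewrite (_ : _ @^-1` _ = \big[setI/setT]_(i < n.+1)
    ((fun x : RN R n => (x : V) ord0 i / t) @^-1`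
      `[(Num.floor (x0 ord0 i / t))%:~R, (Num.floor (x0 ord0 i / t) + 1)%:~R[)).
  apply: bigsetI_measurable => i _; rewrite -[X in measurable X]setTI.
  by apply: measurable_funM; [exact: measurable_coord|exact: measurable_cst|exact: measurableT|exact: measurable_itv].
rewrite -bigcap_seq; apply/seteqP; split => x.
  rewrite /= -x0k => /(pcan_inj choice.pickleK)/ffunP xx0 i _ /=.
  by have := xx0 i; rewrite !ffunE => /eqP; rewrite floor_eq in_itv.
move=> H; rewrite /= -x0k; congr choice.pickle; apply/ffunP => i; rewrite !ffunE; apply/eqP.
by have := H i (mem_index_enum i); rewrite floor_eq /= in_itv.
Qed.

Context (G : set V) (latG : lattice G).

Lemma lattice_enum : exists f : nat -> V, set_bij setT G f.
Proof.
have [eps eps0 sep] := lattice_separated latG.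
have cG : (G #<= [set: nat])%card.
  apply/pcard_injP; exists (grid eps) => x y /set_mem Gx /set_mem Gy E.
  apply/eqP; rewrite -subr_eq0; apply/eqP; apply: sep; first exact: latticeB.
  by move=> i; rewrite !mxE; exact: grid_close.
have nG : ([set: nat] #<= G)%card.
  have [_ _ [[v [Gv zv]] _]] := latG.
  pose c (i : 'I_n.+1) (z : int) : 'I_n.+1 -> int := fun j => if j == i then z else 0.
  have vc z : \sum_j v j *~ c ord0 z j = v ord0 *~ z.
    rewrite (bigD1 ord0)//= /c eqxx big1 ?addr0// => j j0.
    by rewrite (negbTE j0) mulr0z.
  pose w (k : nat) : V := v ord0 *~ k%:Z.
  have winj : injective w.
    move=> k l E; have : \sum_j v j *~ c ord0 (k%:Z - l%:Z) j = 0.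
      by rewrite vc mulrzBr -/(w k) -/(w l) E subrr.
    by move/zv => /(_ ord0); rewrite /c eqxx => /eqP; rewrite subr_eq0 => /eqP[].
  have := @inj_card_eq _ _ [set: nat] w (in2W winj).
  rewrite card_eq_le => /andP[_ H]; apply: (card_le_trans H).
  apply: subset_card_le => _ [k _ <-].
  by rewrite /w -vc; exact: lattice_int_comb.
apply/card_set_bijP; rewrite card_eq_le; exact/andP.
Qed.

(** The rank provides independent vectors, not a basis of [G], so a parallelepiped is not at hand.
    Instead each coset keeps its point of least grid code inside a cube that meets all cosets. Such
    a point is unique, for two points of a coset in one cell of side [eps] differ by a lattice
    vector too short to be nonzero. *)
Lemma lattice_tile : exists X : set V, [/\ measurable (X : set (RN R n)),
  exists k, X `<=` cube k,
  forall x, exists2 g, G g & X (x - g) &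
  forall x g, X x -> G g -> X (x + g) -> g = 0].
Proof.
have [eps eps0 sep] := lattice_separated latG.
have [M GM] := lattice_cobounded latG.
have [f [fG finj fsurj]] := lattice_enum.
pose k := (Num.bound `|M|).+1.
pose X := [set x | cube k x /\ forall g, G g -> cube k (x + g) -> (grid eps x <= grid eps (x + g))%N].
have cubeM (x : V) : (forall i, `|x ord0 i| <= M) -> cube k x.
  move=> xM i; rewrite !mxE.
  have MB := archi_boundP (normr_ge0 M).
  have xk : `|x ord0 i| < k%:R.
    by rewrite (le_lt_trans (xM i))// (le_lt_trans (ler_norm _))// (lt_le_trans MB)// ler_nat.
  by move: xk; rewrite ltr_norml => /andP[-> /ltW ->].
have mcube : measurable (cube k : set (RN R n)) by exact: measurable_box.
exists X; split.
- rewrite (_ : X = cube k `&` \bigcap_j ((fun x => x + f j) @^-1` (~` cube k) `|`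
    \bigcup_a \bigcup_b (if (a <= b)%N then grid eps @^-1` [set a] `&`
      (fun x => x + f j) @^-1` (grid eps @^-1` [set b]) else set0))).
    apply: measurableI => //; apply: bigcapT_measurable => j; apply: measurableU.
      rewrite -[X in measurable X]setTI; apply: (measurable_translation (f j)) => //.
      exact: measurableC.
    apply: bigcupT_measurable => a; apply: bigcupT_measurable => b; case: ifP => // _.
    apply: measurableI; first exact: measurable_grid.
    rewrite -[X in measurable X]setTI; apply: (measurable_translation (f j)) => //.
    exact: measurable_grid.
  apply/seteqP; split => x [kx H]; split => //.
    move=> j _; have [kxj|] := pselect (cube k (x + f j)); last by left.
    right; exists (grid eps x) => //; exists (grid eps (x + f j)) => //.
    by rewrite H//; exact: fG.
  move=> g /fsurj[j _ <-] kxj; have [//|[a _ [b _]]] := H j I.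
  by case: ifP => // ab [/= -> ->].
- by exists k => x [].
- move=> x; pose P m := `[< exists2 g, G g & cube k (x - g) /\ grid eps (x - g) = m >].
  have [g0 Gg0 kg0] : exists2 g, G g & cube k (x - g).
    by have [g Gg gM] := GM x; exists g => //; exact: cubeM.
  have exP : exists m, P m by exists (grid eps (x - g0)); apply/asboolP; exists g0.
  case: (ex_minnP exP) => m /asboolP[g Gg [kg gm]] mmin; exists g => //; split => // h Gh kh.
  rewrite gm; apply: mmin; apply/asboolP; exists (g - h); first exact: latticeB.
  by rewrite opprB addrA addrAC.
- move=> x g [kx xmin] Gg [kxg gmin].
  have E : grid eps x = grid eps (x + g).
    apply/eqP; rewrite eqn_leq xmin//=.
    have := gmin (- g) (latticeN latG Gg); rewrite addrK; exact.
  apply: sep => // i; have := grid_close eps0 E i.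
  by rewrite mxE opprD addrA subrr add0r normrN.
Qed.
End tile.

(** * The perimeter as a relaxed energy *)

Lemma integral_invariant d (T : measurableType d) (R : realType)
    (mu : {measure set T -> \bar R}) (phi : T -> T) (D : set T) (f : T -> \bar R) :
  measurable_fun setT phi -> measurable D -> measurable_fun setT f ->
  (forall x, 0 <= f x)%E -> (forall A, measurable A -> mu (phi @^-1` A) = mu A) ->
  (\int[mu]_(y in D) f y = \int[mu]_(x in phi @^-1` D) f (phi x))%E.
Proof.
move=> mphi mD mf f0 inv.
transitivity (\int[pushforward mu phi]_(y in D) f y)%E.
  by apply: eq_measure_integral => A mA _; exact: esym (inv A mA).
by rewrite ge0_integral_pushforward//; exact: measurable_funTS.
Qed.

Lemma integral_mfrestr d (T : measurableType d) (R : realType) (mu : {measure set T -> \bar R})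
    (X : set T) (mX : measurable X) (Xoo : (mu X < +oo)%E) (f : T -> \bar R) :
  measurable_fun setT f -> (forall x, 0 <= f x)%E ->
  (\int[mfrestr mX Xoo]_x f x = \int[mu]_(x in X) f x)%E.
Proof.
move=> mf f0; have mXC : measurable (~` X) by exact: measurableC.
rewrite -(setUv X) ge0_integral_setU//; last 2 first.
- by rewrite setUv.
- by apply/disj_setPCl.
rewrite [X in (_ + X)%E](_ : _ = 0%E) ?adde0.
  by apply: eq_measure_integral => A mA AX; exact: (congr1 mu (setIidl AX)).
rewrite (eq_measure_integral mzero) ?integral_measure_zero// => A mA AX.
have AX0 : A `&` X = set0 by apply/seteqP; split => // x [/AX].
exact: (etrans (congr1 mu AX0) (measure0 mu)).
Qed.

Section tiling_formula.
Context {R : realType} {n : nat}.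
Local Notation V := 'rV[R]_n.+1.
Local Notation leb := (@lebesgueN R n).
Local Open Scope ereal_scope.

Lemma integral_translate (D : set V) (t : V) (f : RN R n -> \bar R) :
  measurable (D : set (RN R n)) -> measurable_fun setT f -> (forall x, 0 <= f x) ->
  \int[leb]_(x in (translate D t : set (RN R n))) f x =
  \int[leb]_(x in (D : set (RN R n))) f ((x : V) + t)%R.
Proof.
move=> mD mf f0.
have mDt : measurable (translate D t : set (RN R n)) by exact: measurable_translate.
rewrite (integral_invariant (measurable_translation t))//; last first.
  move=> A mA; rewrite (_ : _ @^-1` A = translate A (- t)%R); first exact: lebesgueN_translate.
  apply/seteqP; split => x; first by move=> Ax; exists (x + t)%R => //; rewrite addrK.
  by move=> [y Ay <-]; rewrite /= subrK.
congr integral; apply/seteqP; split => x /=; last by move=> Dx; exists x.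
by move=> [y Dy /addIr <-].
Qed.

Context (G : set V) (latG : lattice G) (X : set V).
Context (mX : measurable (X : set (RN R n))).
Hypothesis Xcover : forall x, exists2 g, G g & X (x - g)%R.
Hypothesis Xdisj : forall x g, X x -> G g -> X (x + g)%R -> g = 0%R.
Context (L : zmodType) (e : nat -> L) (e' : L -> nat) (v : L -> V).
Hypotheses (eK : cancel e e') (e'K : cancel e' e).
Hypotheses (vD : {morph v : a b / (a + b)%R >-> (a + b)%R}) (vinj : injective v).
Hypothesis vG : forall x, G x <-> exists a, v a = x.

Lemma label0 : v 0%R = 0%R.
Proof. by apply: (@addrI _ (v 0%R)); rewrite -vD !addr0. Qed.

Lemma labelB a b : v (a - b)%R = (v a - v b)%R.
Proof. by apply: (@addIr _ (v b)); rewrite -vD !subrK. Qed.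

Lemma integral_tiling (f : RN R n -> \bar R) :
  measurable_fun setT f -> (forall x, 0 <= f x) ->
  \int[leb]_x f x =
  \esum_(g in setT) \int[leb]_(x in (X : set (RN R n))) f ((x : V) + v g)%R.
Proof.
move=> mf f0.
rewrite (esum_enum eK e'K); last by move=> g; apply: integral_ge0.
have -> : [set: RN R n] = \bigcup_k (translate X (v (e k)) : set (RN R n)).
  apply/esym; rewrite -subTset => x _; have [g Gg Xg] := Xcover x.
  have [a va] := (vG g).1 Gg; exists (e' a) => //.
  by rewrite e'K va; exists (x - g)%R => //; rewrite subrK.
rewrite ge0_integral_bigcup//; last 3 first.
- by move=> k; exact: measurable_translate.
- exact: measurable_funTS.
- move=> i j _ _ [x [[y Xy yx] [z Xz zx]]].
  apply/eqP; rewrite -(inj_eq (can_inj eK)) -(inj_eq vinj) -subr_eq0 -labelB; apply/eqP.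
  apply: (Xdisj Xy); first by apply/vG; exists (e i - e j)%R.
  by rewrite labelB addrA yx -zx addrK.
by apply: eq_eseriesr => k _; rewrite integral_translate.
Qed.

End tiling_formula.

Lemma esum_swap (R : realType) (L : choiceType) (e : nat -> L) (e' : L -> nat)
    (eK : cancel e e') (e'K : cancel e' e) (a : L -> L -> \bar R) :
  (forall g h, 0 <= a g h)%E ->
  (\esum_(g in setT) \esum_(h in setT) a g h = \esum_(h in setT) \esum_(g in setT) a g h)%E.
Proof.
move=> a0.
have E (b : L -> L -> \bar R) : (forall g h, 0 <= b g h)%E ->
    (\esum_(g in setT) \esum_(h in setT) b g h =
     \sum_(i <oo) \sum_(j <oo) b (e i) (e j))%E.
  move=> b0; rewrite (esum_enum eK e'K); last by move=> g; exact: esum_ge0.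
  by apply: eq_eseriesr => i _; rewrite (esum_enum eK e'K).
by rewrite !E// nneseries_interchange.
Qed.

(** The form in which the perimeter unfolds: a point of the domain against a point outside it. It
    uses that the labels at [p.1] sum to 1. *)
Lemma disagreementE d (T : measurableType d) (R : realType) (L : zmodType)
    (e : nat -> L) (e' : L -> nat) (eK : cancel e e') (e'K : cancel e' e)
    (f : L -> T -> R) h p : fuzzy f ->
  ((disagreement f h p)%:E = \esum_(g in setT) (f g p.1 * (1 - f (g + h)%R p.2))%:E)%E.
Proof.
move=> ff; have [_ f0 f1] := ff.
have f01 g x : 0 <= f g x <= 1 by exact: fuzzy_ge0_le1.
have d0 g : (0 <= (f g p.1 * (1 - f (g + h)%R p.2))%:E)%E.
  by rewrite lee_fin mulr_ge0// subr_ge0; case/andP: (f01 (g + h) p.2).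
rewrite /disagreement EFinB agreementE// -(f1 p.1).
rewrite (eq_esum (b := fun g => ((f g p.1 * (1 - f (g + h)%R p.2))%:E + (f g p.1 * f (g + h)%R p.2)%:E)%E)); last first.
  by move=> g _; rewrite -EFinD -mulrDr subrK mulr1.
rewrite esumD//; last by move=> g _; rewrite lee_fin mulr_ge0.
by rewrite -agreementE// addeK.
Qed.

Section perimeter_energy.
Context {R : realType} {n : nat}.
Local Notation V := 'rV[R]_n.+1.
Local Notation leb := (@lebesgueN R n).
Context (G : set V) (X : set V) (mX : measurable (X : set (RN R n))).
Hypothesis Xoo : (leb X < +oo)%E.
Hypothesis Xcover : forall x, exists2 g, G g & X (x - g).
Hypothesis Xdisj : forall x g, X x -> G g -> X (x + g) -> g = 0.
Context (L : zmodType) (e : nat -> L) (e' : L -> nat) (v : L -> V).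
Hypotheses (eK : cancel e e') (e'K : cancel e' e).
Hypotheses (vD : {morph v : a b / a + b >-> a + b}) (vinj : injective v).
Hypothesis vG : forall x, G x <-> exists a, v a = x.
Context (K : V -> R) (mK : measurable_fun [set: RN R n] (K : RN R n -> R)).
Hypothesis K0 : forall x, 0 <= K x.
Context (N : set V) (mN : measurable (N : set (RN R n))) (N0 : leb N = 0%E).

(** For fixed [y] this changes [K (x - y)] only for [x] in a translate of the null set [N], so inner
    integrals are unaffected, while the function of the pair becomes product measurable. *)
Definition off_null (x : V) : R := K x * \1_(~` N) x.

Hypothesis mK' : forall g, measurable_fun setT (fun p => off_null (shifted_difference g p)).

Definition cell_kernel (h : L) (p : RN R n * RN R n) : R :=
  off_null (shifted_difference (v h) p).

Local Notation nu := (mfrestr mX Xoo).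

Lemma off_null_ge0 x : 0 <= off_null x.
Proof. by rewrite mulr_ge0. Qed.

Lemma cell_kernel_ge0 h p : 0 <= cell_kernel h p.
Proof. exact: off_null_ge0. Qed.

Lemma measurable_cell_kernel h : measurable_fun setT (cell_kernel h).
Proof. exact: mK'. Qed.

Context (E : set V) (mE : measurable (E : set (RN R n))).
Local Open Scope ereal_scope.

Let Phi (p : RN R n * RN R n) : \bar R :=
  ((1 - \1_E p.2) * off_null (shifted_difference 0%R p))%:E.

Let Q (y : RN R n) : \bar R := \int[leb]_x Phi (y, x).

Let mindicC : measurable_fun [set: RN R n] (fun x : RN R n => 1 - \1_E (x : V) : R)%R.
Proof. by apply: measurable_funB => //; exact: measurable_indic. Qed.

Let Phi0 p : 0 <= Phi p.
Proof. by rewrite lee_fin mulr_ge0// off_null_ge0. Qed.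

Let mPhi : measurable_fun setT Phi.
Proof.
apply/measurable_EFinP; apply: measurable_funM; last exact: mK'.
exact: (measurableT_comp mindicC measurable_snd).
Qed.

Let mQ : measurable_fun setT Q.
Proof. exact: measurable_fun_fubini_tonelli_F. Qed.

Let Q0 y : 0 <= Q y.
Proof. by apply: integral_ge0 => x _; exact: Phi0. Qed.

Let inner_integral (y : V) :
  \int[leb]_(x in (~` E : set (RN R n))) (K (x - y)%R)%:E = Q y.
Proof.
have mEC : measurable (~` E : set (RN R n)) by exact: measurableC.
have mPy : measurable_fun setT (fun x : RN R n => Phi (y, x)).
  exact: (measurableT_comp mPhi (pair1_measurable (y : RN R n))).
transitivity (\int[leb]_(x in (~` E : set (RN R n))) Phi (y, x)).
  have mKy : measurable_fun (~` E : set (RN R n)) (fun x : RN R n => (K ((x : V) - y)%R)%:E).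
    apply/measurable_funTS/measurable_EFinP.
    exact: (measurableT_comp mK (measurable_translation (- y))).
  have mPyE : measurable_fun (~` E : set (RN R n)) (fun x : RN R n => Phi (y : RN R n, x)).
    exact: measurable_funTS.
  have Ky0 (x : RN R n) : (~` E) x -> 0 <= (K ((x : V) - y)%R)%:E by rewrite lee_fin.
  have Py0 (x : RN R n) : (~` E) x -> 0 <= Phi (y : RN R n, x) by move=> _; exact: Phi0.
  apply: (ge0_ae_eq_integral mEC mKy mPyE Ky0 Py0).
  exists (translate N y); split; first exact: measurable_translate.
    exact: (etrans (lebesgueN_translate N y) N0).
  move=> x /= H; apply: contrapT => xN; apply: H => Ex.
  have xyN : ~ N (x - y)%R by move=> H; apply: xN; exists (x - y)%R => //; rewrite subrK.
  rewrite /Phi /off_null /shifted_difference/= addr0 !indicE (memNset Ex).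
  by rewrite mem_set// subr0 mul1r mulr1.
rewrite integral_mkcond; apply: eq_integral => x _.
rewrite /patch in_setC /Phi/= indicE; case: (x \in E) => //=.
by rewrite subrr mul0r.
Qed.

(** The interaction of [p.1 + v g] in [E] with [p.2 + v (g + h)] outside [E]. Indexing the second
    tile relative to the first makes the kernel depend on [h] alone. *)
Let piece g h (p : RN R n * RN R n) : \bar R :=
  (\1_E ((p.1 : V) + v g)%R * (1 - \1_E ((p.2 : V) + v (g + h)%R)%R) * cell_kernel h p)%:E.

Let piece0 g h p : 0 <= piece g h p.
Proof.
by rewrite lee_fin; apply: mulr_ge0; [apply: mulr_ge0|exact: cell_kernel_ge0].
Qed.

Let mpiece g h : measurable_fun setT (piece g h).
Proof.
apply/measurable_EFinP; apply: measurable_funM; last exact: measurable_cell_kernel.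
apply: measurable_funM.
  apply: (measurableT_comp (f := fun x : RN R n => \1_E ((x : V) + v g)%R : R) _ measurable_fst).
  exact: (measurableT_comp (measurable_indic mE) (measurable_translation (v g))).
apply: (measurableT_comp (f := fun x : RN R n => (1 - \1_E ((x : V) + v (g + h)%R)%R)%R : R) _ measurable_snd).
exact: (measurableT_comp mindicC (measurable_translation (v (g + h)%R))).
Qed.

Let Q_tiling (y : V) g :
  (\1_E (y + v g)%R)%:E * Q (y + v g)%R = \esum_(h in setT) \int[nu]_x piece g h (y, x).
Proof.
have mP z : measurable_fun setT (fun x : RN R n => Phi (z : RN R n, x)).
  exact: (measurableT_comp mPhi (pair1_measurable (z : RN R n))).
rewrite /Q (integral_tiling mX Xcover Xdisj eK e'K vD vinj vG (mP _)); last by move=> x; exact: Phi0.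
rewrite -(esum_shift _ g) -(esumZl eK e'K)//; last first.
  by move=> h; apply: integral_ge0 => x _; exact: Phi0.
apply: eq_esum => h _.
have mPt : measurable_fun setT (fun x : RN R n => Phi ((y + v g)%R : RN R n, ((x : V) + v (h + g))%R : RN R n)).
  exact: (measurableT_comp (mP (y + v g)%R) (measurable_translation (v (h + g)%R))).
rewrite -(integral_mfrestr mX Xoo mPt); last by move=> x; exact: Phi0.
rewrite -ge0_integralZl//.
apply: eq_integral => x _; rewrite /piece /Phi -EFinM /cell_kernel /shifted_difference/=.
rewrite (addrC h g) mulrA; congr ((_ * off_null _)%:E).
rewrite addr0 vD opprD addrACA; congr (_ + _)%R.
by rewrite addrAC subrr add0r.
Qed.

Lemma Per_tiling : Per K E = \esum_(g in setT) \esum_(h in setT)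
  \int[nu]_y \int[nu]_x piece g h (y, x).
Proof.
rewrite /Per; under eq_integral do rewrite inner_integral.
rewrite integral_mkcond.
have mEQ : measurable_fun setT (fun y : RN R n => (\1_E (y : V))%:E * Q y).
  apply: emeasurable_funM; last exact: mQ.
  by apply/measurable_EFinP; exact: (measurable_indic mE).
have EQ0 y : 0 <= (\1_E y)%:E * Q y by rewrite mule_ge0 ?Q0// lee_fin.
transitivity (\int[leb]_y ((\1_E (y : V))%:E * Q y)).
  apply: eq_integral => y _; rewrite /patch indicE.
  by case: (y \in E); rewrite ?mul1e ?mul0e.
rewrite (integral_tiling mX Xcover Xdisj eK e'K vD vinj vG mEQ EQ0).
apply: eq_esum => g _.
have mEQg : measurable_fun setT (fun y : RN R n => (\1_E ((y : V) + v g)%R)%:E * Q ((y : V) + v g)%R).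
  exact: (measurableT_comp mEQ (measurable_translation (v g))).
rewrite -(integral_mfrestr mX Xoo mEQg); last by move=> y; exact: EQ0.
under eq_integral do rewrite Q_tiling.
have p1 h (y : RN R n) : 0 <= \int[nu]_x piece g h (y, x).
  by apply: integral_ge0 => x _; exact: piece0.
have p2 h : measurable_fun setT (fun y : RN R n => \int[nu]_x piece g h (y, x)).
  exact: (measurable_fun_fubini_tonelli_F (m2 := nu) _ (mpiece g h) (piece0 g h)).
exact: (integral_esum eK e'K nu measurableT p1 p2).
Qed.

(** Agreement of the labels almost everywhere is all that can be asked: the translates of a
    fundamental domain tile space only up to null sets. *)
Lemma Per_energy (f : L -> RN R n -> R) : fuzzy f ->
  (forall g, ae_eq nu setT (fun x : RN R n => \1_E ((x : V) + v g)%R) (f g)) ->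
  Per K E = energy nu cell_kernel f.
Proof.
move=> ff fE; have [mf f0 f1] := ff.
have f01 g x : (0 <= f g x <= 1)%R by exact: fuzzy_ge0_le1.
rewrite Per_tiling (esum_swap eK e'K); last first.
  by move=> g h; apply: integral_ge0 => y _; apply: integral_ge0 => x _; exact: piece0.
apply: eq_esum => h _.
pose piecef g (p : RN R n * RN R n) : \bar R :=
  (f g p.1 * (1 - f (g + h)%R p.2) * cell_kernel h p)%:E.
have piecef0 g p : 0 <= piecef g p.
  rewrite lee_fin; apply: mulr_ge0; last exact: cell_kernel_ge0.
  by rewrite mulr_ge0// subr_ge0; case/andP: (f01 (g + h)%R p.2).
have mpiecef g : measurable_fun setT (piecef g).
  apply/measurable_EFinP; apply: measurable_funM; last exact: measurable_cell_kernel.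
  exact: (@measurable_tensor _ _ _ (f g) (fun x => 1 - f (g + h)%R x)%R (mf g)
    (measurable_funB (measurable_cst _) (mf _))).
transitivity (\esum_(g in setT) \int[nu \x nu]_p piecef g p).
  apply: eq_esum => g _.
  apply: (etrans _ (esym (fubini_tonelli1 (m1 := nu) (m2 := nu) _ (mpiecef g) (piecef0 g)))).
  have mFp : measurable_fun setT (fubini_F nu (piece g h)).
    exact: (measurable_fun_fubini_tonelli_F (m2 := nu) _ (mpiece g h) (piece0 g h)).
  have mFf : measurable_fun setT (fubini_F nu (piecef g)).
    exact: (measurable_fun_fubini_tonelli_F (m2 := nu) _ (mpiecef g) (piecef0 g)).
  have Fp0 y : setT y -> 0 <= fubini_F nu (piece g h) y.
    by move=> _; apply: integral_ge0 => x _; exact: piece0.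
  have Ff0 y : setT y -> 0 <= fubini_F nu (piecef g) y.
    by move=> _; apply: integral_ge0 => x _; exact: piecef0.
  apply: (ge0_ae_eq_integral measurableT mFp mFf Fp0 Ff0).
  move: (fE g); apply: filterS => y Ey _.
  rewrite /fubini_F.
  have mp1 : measurable_fun setT (fun x : RN R n => piece g h (y, x)).
    exact: (measurableT_comp (mpiece g h) (pair1_measurable (y : RN R n))).
  have mp2 : measurable_fun setT (fun x : RN R n => piecef g (y, x)).
    exact: (measurableT_comp (mpiecef g) (pair1_measurable (y : RN R n))).
  apply: (ge0_ae_eq_integral measurableT mp1 mp2 (fun x _ => piece0 g h _) (fun x _ => piecef0 g _)).
  move: (fE (g + h)%R); apply: filterS => x Ex _.
  by rewrite /piece /piecef/= (Ey I) (Ex I).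
apply: (etrans (esym (integral_esum eK e'K (nu \x nu) measurableT piecef0 mpiecef))).
apply: eq_integral => p _.
rewrite (disagreementE eK e'K)// -(esumZl eK e'K)//; last 2 first.
- exact: cell_kernel_ge0.
- move=> g; rewrite lee_fin mulr_ge0// subr_ge0.
  by case/andP: (f01 (g + h)%R p.2).
by apply: eq_esum => g _; rewrite /piecef mulrC EFinM.
Qed.
End perimeter_energy.

(** * Self-interaction of small sets *)

Lemma integral_lt d (T : measurableType d) (R : realType) (mu : {measure set T -> \bar R})
    (A : set T) (f g : T -> \bar R) : measurable A -> (0 < mu A)%E ->
  measurable_fun A f -> measurable_fun A g ->
  (forall x, A x -> 0 <= f x)%E -> (forall x, A x -> f x < g x)%E ->
  (\int[mu]_(x in A) f x < +oo)%E -> (\int[mu]_(x in A) f x < \int[mu]_(x in A) g x)%E.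
Proof.
move=> mA A0 mf mg f0 fg foo.
pose h x := (g x - f x)%E.
have ffin x : A x -> f x \is a fin_num.
  by move=> Ax; rewrite ge0_fin_numE ?f0// (lt_le_trans (fg x Ax))// leey.
have h0 x : A x -> (0 < h x)%E by move=> Ax; rewrite /h sube_gt0; exact: fg.
have mh : measurable_fun A h by exact: emeasurable_funB.
have E : (\int[mu]_(x in A) g x = \int[mu]_(x in A) f x + \int[mu]_(x in A) h x)%E.
  rewrite -ge0_integralD//; last by move=> x /h0/ltW.
  by apply: eq_integral => x /[!inE] Ax; rewrite /h addeC subeK// ffin.
have int0 : (0 <= \int[mu]_(x in A) f x)%E by exact: integral_ge0.
have inth0 : (0 <= \int[mu]_(x in A) h x)%E by apply: integral_ge0 => x /h0/ltW.
rewrite E -[ltLHS]adde0 lteD2lE ?ge0_fin_numE// lt_def inth0 andbT.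
apply/eqP => I0.
have : (\int[mu]_(x in A) `|h x| = 0)%E.
  by rewrite -I0; apply: eq_integral => x /[!inE] /h0/ltW/gee0_abs.
move/(ae_eq_integral_abs _ mA mh) => [N [mN N0 hN]].
move: A0; rewrite lt0e => /andP[/eqP + _]; apply.
apply/eqP; rewrite -measure_le0 -N0; apply: le_measure; rewrite ?inE//.
move=> x Ax; apply: hN => /= /(_ Ax) hx.
by have := h0 x Ax; rewrite hx ltxx.
Qed.

Section self_interactions.
Context {R : realType} {n : nat}.
Local Notation V := 'rV[R]_n.+1.
Local Notation leb := (@lebesgueN R n).

Lemma lebesgueN_set1 (x : V) : leb ([set x] : set (RN R n)) = 0%E.
Proof.
apply/eqP; rewrite eq_le measure_ge0 andbT.
apply/lee_addgt0Pr => t t0; rewrite add0e.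
pose r := Num.min t 1.
have r0 : 0 < r by rewrite lt_min t0 ltr01.
have r1 : r <= 1 by rewrite ge_min lexx orbT.
have rt : r <= t by rewrite ge_min lexx.
have sub : [set x] `<=` box (x - const_mx r) x.
  by move=> _ -> i; rewrite !mxE lexx andbT ltrBlDr ltrDl.
apply: (@le_trans _ _ (lebesgueN (box (x - const_mx r) x : set (RN R n)))).
  exact: le_lebesgue_outer.
apply: le_trans (lebesgueN_box _ _) _.
rewrite lee_fin (eq_bigr (fun=> r)); last first.
  by move=> i _; rewrite !mxE opprB addrCA subrr addr0 max_r// ltW.
rewrite prodr_const card_ord exprS; apply: le_trans rt; apply: ler_piMr; first exact: ltW.
by apply: exprn_ile1 => //; exact: ltW.
Qed.

Context (X : set V) (mX : measurable (X : set (RN R n))) (Xoo : (leb X < +oo)%E).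
Context (L : zmodType) (v : L -> V).
Context (K : V -> R) (mK : measurable_fun [set: RN R n] (K : RN R n -> R)).
Hypothesis K0 : forall x, 0 <= K x.
Context (N : set V) (mN : measurable (N : set (RN R n))) (N0 : leb N = 0%E).
Hypothesis mK' : forall g, measurable_fun setT (fun p => off_null K N (shifted_difference g p)).
Local Notation nu := (mfrestr mX Xoo).
Local Open Scope ereal_scope.

(** Kept as an iterated integral, since [K] at a difference is measurable in each variable but
    perhaps not in the pair. *)
Definition pair_energy (A : set V) (w : V) : \bar R :=
  \int[leb]_(y in (A : set (RN R n))) \int[leb]_(x in (A : set (RN R n))) (K ((x : V) - (y : V) + w)%R)%:E.

Lemma small_positive_part (A : set V) (t : R) : measurable (A : set (RN R n)) ->
  0 < nu A -> (0 < t)%R ->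
  exists A' : set V, [/\ measurable (A' : set (RN R n)), A' `<=` A `&` X, 0 < leb A' &
    forall x y, A' x -> A' y -> forall i, (`|x ord0 i - y ord0 i| < t)%R].
Proof.
move=> mA A0 t0.
pose C k : set (RN R n) := A `&` X `&` grid t @^-1` [set k].
have mC k : measurable (C k).
  by apply: measurableI; [exact: measurableI|exact: measurable_grid].
have [k Ck] : exists k, 0 < leb (C k).
  apply: contrapT => /forallNP H.
  have : leb.-negligible (A `&` X).
    apply: (@negligibleS _ _ _ _ (\bigcup_k C k)).
      by move=> x AX; exists (grid t x).
    apply: negligible_bigcup => k; exists (C k); split => //.
    by apply/eqP; rewrite -measure_le0 leNgt; apply/negP; exact: H.
  move=> /(measure_negligible (measurableI _ _ mA mX)) E.
  by move: A0; rewrite /mfrestr /mrestr E ltxx.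
exists (C k); split => //; first by move=> x [].
by move=> x y [_ xk] [_ yk] i; apply: grid_close => //; rewrite xk yk.
Qed.

Let mKw w (y : V) D : measurable_fun (D : set (RN R n)) (fun x : RN R n => (K ((x : V) - y + w)%R)%:E).
Proof.
apply/measurable_funTS/measurable_EFinP.
rewrite (_ : (fun x => _) = (K : RN R n -> R) \o (fun x : RN R n => (x : V) + (w - y) : RN R n)%R).
  exact: (measurableT_comp mK (measurable_translation (w - y)%R)).
by apply/funext => x /=; rewrite addrA addrAC.
Qed.

Lemma integral_off_null (A : set V) (w y : V) : measurable (A : set (RN R n)) ->
  \int[leb]_(x in (A : set (RN R n))) (off_null K N ((x : V) - y + w)%R)%:E =
  \int[leb]_(x in (A : set (RN R n))) (K ((x : V) - y + w)%R)%:E.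
Proof.
move=> mA.
have m1 : measurable_fun (A : set (RN R n)) (fun x : RN R n => (off_null K N ((x : V) - y + w)%R)%:E).
  apply/measurable_funTS/measurable_EFinP.
  exact: (measurableT_comp (mK' w) (pair1_measurable (y : RN R n))).
have p1 (x : RN R n) : A x -> 0 <= (off_null K N ((x : V) - y + w)%R)%:E.
  by move=> _; rewrite lee_fin off_null_ge0.
have p2 (x : RN R n) : A x -> 0 <= (K ((x : V) - y + w)%R)%:E by rewrite lee_fin.
have m2 : measurable_fun (A : set (RN R n)) (fun x : RN R n => (K ((x : V) - y + w)%R)%:E).
  exact: mKw.
have H := @ge0_ae_eq_integral _ _ _ leb _ _ _ mA m1 m2 p1 p2.
apply: H.
exists (translate N (y - w)%R); split; first exact: measurable_translate.
  exact: (etrans (lebesgueN_translate N (y - w)%R) N0).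
move=> x /= H; apply: contrapT => xN; apply: H => _.
rewrite /off_null indicE mem_set ?mulr1// => Nx; apply: xN.
by exists (x - y + w)%R => //; rewrite -addrA [(w + _)%R]addrC subrK subrK.
Qed.

Let Phi w (p : RN R n * RN R n) : \bar R := (off_null K N (shifted_difference w p))%:E.

Lemma measurable_inner_energy (A : set V) (w : V) : measurable (A : set (RN R n)) ->
  measurable_fun setT (fun y : RN R n =>
    \int[leb]_(x in (A : set (RN R n))) (K ((x : V) - (y : V) + w)%R)%:E).
Proof.
move=> mA.
have mP : measurable_fun setT (fun p : RN R n * RN R n => (\1_A p.2)%:E * Phi w p).
  apply: emeasurable_funM; apply/measurable_EFinP; last exact: mK'.
  exact: (measurableT_comp (measurable_indic mA) measurable_snd).
have P0 p : 0 <= (\1_A p.2)%:E * Phi w p.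
  by apply: mule_ge0; rewrite lee_fin// off_null_ge0.
have := measurable_fun_fubini_tonelli_F (m2 := leb) _ mP P0.
rewrite (_ : fubini_F _ _ = fun y : RN R n =>
    \int[leb]_(x in (A : set (RN R n))) (K ((x : V) - (y : V) + w)%R)%:E)//.
apply/funext => y; rewrite /fubini_F -integral_off_null// [RHS]integral_mkcond.
apply: eq_integral => x _; rewrite /patch /= indicE.
by case: (x \in A); rewrite ?mul1e ?mul0e.
Qed.

Lemma self_interactionE (A : set V) h : measurable (A : set (RN R n)) -> A `<=` X ->
  self_interaction (A : set (RN R n)) nu (cell_kernel v K N) h = pair_energy A (v h).
Proof.
move=> mA AX; rewrite /self_interaction /pair_energy integral_mkcond.
pose P (p : RN R n * RN R n) : \bar R := (\1_A p.1)%:E * ((\1_A p.2)%:E * Phi (v h) p).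
have mP2 : measurable_fun setT (fun p : RN R n * RN R n => (\1_A p.2)%:E * Phi (v h) p).
  apply: emeasurable_funM; apply/measurable_EFinP; last exact: mK'.
  exact: (measurableT_comp (measurable_indic mA) measurable_snd).
have mP : measurable_fun setT P.
  apply: emeasurable_funM; last exact: mP2.
  apply/measurable_EFinP.
  exact: (measurableT_comp (measurable_indic mA) measurable_fst).
have P20 p : 0 <= (\1_A p.2)%:E * Phi (v h) p.
  by apply: mule_ge0; rewrite lee_fin// off_null_ge0.
have P0 p : 0 <= P p by apply: mule_ge0; [rewrite lee_fin|exact: P20].
transitivity (\int[nu \x nu]_p P p).
  apply: eq_integral => -[y x] _; rewrite /patch in_setX/= /P/= !indicE.
  by case: (y \in A); case: (x \in A); rewrite ?mul1e ?mul0e.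
apply: (etrans (fubini_tonelli1 (m1 := nu) (m2 := nu) _ mP P0)).
have mF := measurable_fun_fubini_tonelli_F (m2 := nu) _ mP P0.
have F0 y : 0 <= fubini_F nu P y by apply: integral_ge0 => x _; exact: P0.
apply: (etrans (integral_mfrestr mX Xoo mF F0)).
have sub (phi : RN R n -> \bar R) :
    \int[leb]_(x in (X : set (RN R n))) ((\1_A (x : V))%:E * phi x) =
    \int[leb]_(x in (A : set (RN R n))) phi x.
  rewrite integral_mkcond [RHS]integral_mkcond; apply: eq_integral => x _.
  rewrite /patch indicE; case: (boolP (x \in A)) => [/set_mem/AX xX|_].
    by rewrite mem_set// mul1e.
  by rewrite mul0e; case: (x \in X).
rewrite -sub; apply: eq_integral => y _; rewrite /fubini_F.
have mPy : measurable_fun setT (fun x : RN R n => P (y, x)).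
  exact: (measurableT_comp mP (pair1_measurable y)).
rewrite (integral_mfrestr mX Xoo mPy (fun x => P0 _)) /P/=.
rewrite -integral_off_null// indicE; case: (y \in A).
  rewrite mul1e -sub; apply: eq_integral => x _; by rewrite mul1e.
by rewrite mul0e; apply: integral0_eq => x _; rewrite mul0e.
Qed.
End self_interactions.

Lemma measurable_point (R : realType) (n : nat) (y : 'rV[R]_n.+1) :
  measurable ([set y] : set (RN R n)).
Proof.
rewrite (_ : [set y] = \big[setI/setT]_(i < n.+1)
    ((fun x : RN R n => (x : 'rV[R]_n.+1) ord0 i) @^-1` [set y ord0 i])).
  apply: bigsetI_measurable => i _; rewrite -[X in measurable X]setTI.
  by apply: measurable_coord; [exact: measurableT|exact: measurable_set1].
rewrite -bigcap_seq; apply/seteqP; split => x; first by move=> ->.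
by move=> H; apply/rowP => i; exact: (H i (mem_index_enum i)).
Qed.

Section kernel_types.
Context {R : realType} {n : nat}.
Local Notation V := 'rV[R]_n.+1.
Local Notation leb := (@lebesgueN R n).
Context (K : V -> R) (mK : measurable_fun [set: RN R n] (K : RN R n -> R)).
Hypothesis K0 : forall x, 0 <= K x.
Context (A : set V) (mA : measurable (A : set (RN R n))) (Aoo : (leb A < +oo)%E).
Local Open Scope ereal_scope.

Let J w (y : RN R n) : \bar R :=
  \int[leb]_(x in (A : set (RN R n))) (K ((x : V) - (y : V) + w)%R)%:E.

Let J0 w y : 0 <= J w y.
Proof. by apply: integral_ge0 => x _; rewrite lee_fin. Qed.

Hypothesis mJ : forall w, measurable_fun setT (J w).

Let mKs w (y : V) D : measurable_fun (D : set (RN R n)) (fun x : RN R n => (K ((x : V) - y + w)%R)%:E).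
Proof.
apply/measurable_funTS/measurable_EFinP.
rewrite (_ : (fun x => _) = (K : RN R n -> R) \o (fun x : RN R n => (x : V) + (w - y) : RN R n)%R).
  exact: (measurableT_comp mK (measurable_translation (w - y)%R)).
by apply/funext => x /=; rewrite addrA addrAC.
Qed.

(** The majorant [psi] serves both kernel types: it is [K] itself when [K] is integrable, and a
    multiple of [Num.min 1 (enorm z) * K z] for a fractional kernel away from the origin.
    Translation invariance makes the bound uniform in [y]. *)
Lemma inner_energy_le (psi : V -> R) w (y : V) :
  measurable_fun [set: RN R n] (psi : RN R n -> R) -> (forall x, (0 <= psi x)%R) ->
  (forall x, A x -> (K (x - y + w) <= psi (x - y + w))%R) ->
  J w y <= \int[leb]_x (psi (x : V))%:E.
Proof.
move=> mpsi psi0 Kpsi.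
have mpsiE : measurable_fun setT (fun x : RN R n => (psi (x : V))%:E) by exact/measurable_EFinP.
have psi0E (x : RN R n) : 0 <= (psi (x : V))%:E by rewrite lee_fin.
have inv (B : set (RN R n)) : measurable B ->
    leb ((fun x : RN R n => (x : V) + (w - y) : RN R n)%R @^-1` B) = leb B.
  move=> mB; rewrite (_ : _ @^-1` B = translate B (- (w - y))%R); first exact: lebesgueN_translate.
  apply/seteqP; split => x; first by move=> Bx; exists (x + (w - y))%R => //; rewrite addrK.
  by move=> [z Bz <-]; rewrite /= subrK.
have mt := measurable_translation (w - y)%R.
rewrite (integral_invariant mt measurableT mpsiE psi0E inv) preimage_setT.
have mpt : measurable_fun setT (fun x : RN R n => (psi ((x : V) + (w - y))%R)%:E).
  exact: (measurableT_comp mpsiE mt).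
apply: (@le_trans _ _ (\int[leb]_(x in (A : set (RN R n))) (psi ((x : V) + (w - y))%R)%:E)).
  have p1 (x : RN R n) : A x -> 0 <= (K ((x : V) - y + w)%R)%:E by rewrite lee_fin.
  have m2 : measurable_fun (A : set (RN R n)) (fun x : RN R n => (psi ((x : V) + (w - y))%R)%:E).
    exact: (measurable_funTS mpt).
  have H := @ge0_le_integral _ _ _ leb _ mA _ _ p1 (@mKs w y A) m2.
  apply: H => x Ax; rewrite lee_fin; have -> : ((x : V) + (w - y) = (x : V) - y + w)%R by rewrite addrA addrAC.
  exact: Kpsi.
have p2 (x : RN R n) : setT x -> 0 <= (psi ((x : V) + (w - y))%R)%:E by rewrite lee_fin.
exact: (ge0_subset_integral leb mA measurableT mpt p2 (@subsetT _ A)).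
Qed.

Lemma pair_energy_lty (psi : V -> R) w :
  measurable_fun [set: RN R n] (psi : RN R n -> R) -> (forall x, (0 <= psi x)%R) ->
  \int[leb]_x (psi (x : V))%:E < +oo ->
  (forall x y, A x -> A y -> (K (x - y + w) <= psi (x - y + w))%R) ->
  pair_energy K A w < +oo.
Proof.
move=> mpsi psi0 psioo Kpsi; rewrite /pair_energy -/(J w).
set B := \int[leb]_x _ in psioo.
have B0 : 0 <= B by apply: integral_ge0 => x _; rewrite lee_fin.
apply: (@le_lt_trans _ _ (\int[leb]_(y in (A : set (RN R n))) cst B y)).
  have mJA : measurable_fun (A : set (RN R n)) (J w) by exact: (measurable_funTS (mJ w)).
  apply: (@ge0_le_integral _ _ _ leb _ mA _ _ (fun y _ => J0 w y) mJA (measurable_cst _)) => y Ay.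
  by apply: inner_energy_le => // x Ax; exact: Kpsi.
rewrite integral_cst//.
by rewrite -ge0_fin_numE ?mule_ge0// fin_numM// ge0_fin_numE.
Qed.

Lemma pair_energy_lt (psi : V -> R) w : 0 < leb A ->
  measurable_fun [set: RN R n] (psi : RN R n -> R) -> (forall x, (0 <= psi x)%R) ->
  \int[leb]_x (psi (x : V))%:E < +oo ->
  (forall x y, A x -> A y -> (K (x - y + w) <= psi (x - y + w))%R) ->
  (forall x y, A x -> A y -> x != y -> (K (x - y + w) < K (x - y + 0))%R) ->
  pair_energy K A w < pair_energy K A 0.
Proof.
move=> Apos mpsi psi0 psioo Kpsi Klt.
have mJA u : measurable_fun (A : set (RN R n)) (J u) by exact: (measurable_funTS (mJ u)).
apply: (@integral_lt _ _ _ leb _ _ _ mA Apos (mJA w) (mJA 0%R) (fun y _ => J0 w y)).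
- move=> y Ay.
  have my : measurable ([set y] : set (RN R n)).
    exact: measurable_point.
  (* The diagonal point is discarded because the strict inequality between the kernels is assumed
     only for [x != y]. *)
  have drop u : J u y = \int[leb]_(x in (A `\` [set y] : set (RN R n))) (K ((x : V) - (y : V) + u)%R)%:E.
    have p1 (x : RN R n) : A x -> 0 <= (K ((x : V) - (y : V) + u)%R)%:E by rewrite lee_fin.
    exact: (@ge0_negligible_integral _ _ _ leb _ _ _ my mA (@mKs u y A) p1 (lebesgueN_set1 y)).
  have mAy : measurable (A `\` [set y] : set (RN R n)) by exact: measurableD.
  have Aypos : 0 < leb (A `\` [set y] : set (RN R n)).
    rewrite lt0e measure_ge0 andbT; apply/eqP => E0; move: Apos; rewrite lt0e => /andP[/eqP + _]; apply.
    apply: (measure_negligible mA).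
    apply: (@negligibleS _ _ _ leb ((A `\` [set y]) `|` [set y])).
      by move=> x Ax; have [->|xy] := pselect (x = y); [right|left].
    apply: negligibleU; first by exists (A `\` [set y]); split.
    by exists [set y]; split => //; exact: lebesgueN_set1.
  have p1 (x : RN R n) : (A `\` [set y]) x -> 0 <= (K ((x : V) - (y : V) + w)%R)%:E by rewrite lee_fin.
  rewrite !drop; apply: (@integral_lt _ _ _ leb _ _ _ mAy Aypos (@mKs w y _) (@mKs 0%R y _) p1).
  + move=> x [Ax /eqP xy]; rewrite lte_fin; exact: Klt.
  + rewrite -drop; apply: le_lt_trans psioo.
    by apply: inner_energy_le => // x Ax; exact: Kpsi.
- exact: (pair_energy_lty mpsi psi0 psioo Kpsi).
Qed.
End kernel_types.

Lemma limf_einf_dnbhs0_gt0 (R : realType) (n : nat) (f : 'rV[R]_n.+1 -> R) :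
  (0 < limf_einf (fun z => (f z)%:E) (0%R : 'rV[R]_n.+1)^')%E ->
  exists2 r : R, 0 < r & forall z : 'rV[R]_n.+1, z != 0 -> (forall i, `|z ord0 i| < r) -> 0 < f z.
Proof.
rewrite /limf_einf oppe_gt0 => /ereal_inf_lt[_ [W W0 <-] supW].
have := W0; rewrite /dnbhs /within/= => /nbhs_ballP[r /= r0 rW].
exists r => // z z0 zr.
have Wz : W z.
  apply: rW => //; split => // i j; rewrite ord1 /ball /= mxE sub0r normrN; exact: zr.
rewrite -oppr_lt0 -lte_fin EFinN; apply: le_lt_trans supW; apply: ereal_sup_ubound.
by exists z.
Qed.

(** The cells of mass at most [eta] hold together at most [#|F| * eta], that is, half of [m]. *)
Lemma popular_cells d (T : measurableType d) (R : realType) (mu : {measure set T -> \bar R})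
    (F : finType) (S : F -> set T) (A : set T) (m eta : R) :
  measurable A -> (forall c, measurable (S c)) -> A `<=` \bigcup_c S c ->
  mu A = m%:E -> 0 <= eta -> #|F|%:R * eta <= m / 2 ->
  let good := \bigcup_(c in [set c | (eta%:E < mu (A `&` S c))%E]) (A `&` S c) in
  measurable good /\ ((m / 2)%:E <= mu good)%E.
Proof.
move=> mA mS AS mAm eta0 Feta good.
pose bad := \bigcup_(c in [set c | (mu (A `&` S c) <= eta%:E)%E]) (A `&` S c).
have mAS c : measurable (A `&` S c) by exact: measurableI.
have mgood : measurable good by apply: fin_bigcup_measurable => //; exact: finite_finset.
have mbad : measurable bad by apply: fin_bigcup_measurable => //; exact: finite_finset.
split=> //.
have AU : A `<=` good `|` bad.
  move=> x Ax; have [c _ Sx] := AS x Ax.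
  by have [gc|bc] := ltP eta%:E (mu (A `&` S c)); [left|right]; exists c.
have bad_le : (mu bad <= (m / 2)%:E)%E.
  apply: (@le_trans _ _ (\sum_(c \in [set c | (mu (A `&` S c) <= eta%:E)%E]) mu (A `&` S c))%E).
    by apply: content_sub_fsum => //; exact: finite_finset.
  apply: (@le_trans _ _ (\sum_(c \in [set c | (mu (A `&` S c) <= eta%:E)%E]) eta%:E)%E).
    apply: lee_fsum; [exact: finite_finset|by move=> c].
  rewrite fsbig_finite/=; last exact: finite_finset.
  rewrite sumEFin lee_fin big_const_seq count_predT iter_addr_0.
  apply: le_trans Feta; rewrite -[leLHS]mulr_natl ler_wpM2r// ler_nat cardE.
  by apply: uniq_leq_size => [|c _]; [exact: fset_uniq|rewrite mem_enum].
have : (m%:E <= mu good + mu bad)%E.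
  rewrite -mAm; apply: le_trans (measureU2 mu mgood mbad).
  by apply: le_measure => //; rewrite inE//; exact: measurableU.
case: (mu good) (measure_ge0 mu good) => [a|//|//]; last by rewrite leey.
move=> _ H; have {H} : (m%:E <= a%:E + (m / 2)%:E)%E by apply: le_trans H _; rewrite leeD2l.
by rewrite -EFinD !lee_fin; lra.
Qed.

(** * Self-interaction under a fractional kernel *)

Section fractional_kernel.
Context {R : realType} {n : nat}.
Local Notation V := 'rV[R]_n.+1.
Local Notation leb := (@lebesgueN R n).

(** Half-open cells of side [1 / M]. The extra index per direction is for the face [x ord0 i = k],
    which falls into the cell number [2 * k * M]. *)
Definition cell (k M : nat) (c : {ffun 'I_n.+1 -> 'I_(2 * k * M).+1}) : set V :=
  [set x | forall i, (c i)%:R - (k * M)%:R <= M%:R * x ord0 i < (c i)%:R - (k * M)%:R + 1].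

Lemma measurable_cell k M c : measurable (@cell k M c : set (RN R n)).
Proof.
rewrite (_ : cell c = \big[setI/setT]_(i < n.+1)
    ((fun x : RN R n => M%:R * (x : V) ord0 i) @^-1`
      `[(c i)%:R - (k * M)%:R, (c i)%:R - (k * M)%:R + 1[)).
  apply: bigsetI_measurable => i _; rewrite -[X in measurable X]setTI.
  by apply: measurable_funM; [exact: measurable_cst|exact: measurable_coord|exact: measurableT|exact: measurable_itv].
rewrite -bigcap_seq; apply/seteqP; split => x.
  by move=> H i _ /=; rewrite in_itv; exact: H.
by move=> H i; have := H i (mem_index_enum i); rewrite /= in_itv.
Qed.

Lemma cube_sub_cells k M : @cube R n k `<=` \bigcup_c @cell k M c.
Proof.
move=> x kx.
have b i : 0 <= M%:R * x ord0 i + (k * M)%:R <= (2 * k * M)%:R.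
  have := kx i; rewrite !mxE => /andP[x1 x2].
  have M0 := ler0n R M; rewrite !natrM.
  have : M%:R * (- k%:R) <= M%:R * x ord0 i by rewrite ler_wpM2l// ltW.
  have : M%:R * x ord0 i <= M%:R * k%:R by rewrite ler_wpM2l.
  move: (M%:R * x ord0 i) => u; rewrite mulrN (mulrC _ k%:R) -mulrA.
  move: (k%:R * M%:R) => z; lra.
have cP i : (Num.truncn (M%:R * x ord0 i + (k * M)%:R) < (2 * k * M).+1)%N.
  have /andP[b0 b1] := b i; rewrite ltnS -(ler_nat R).
  by apply: le_trans b1; have /andP[] := truncn_itv b0.
exists [ffun i => Ordinal (cP i)] => // i; rewrite ffunE /=.
have /andP[b0 _] := b i; have /andP[] := truncn_itv b0.
rewrite -natr1; move: (Num.truncn _) => a.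
move: (M%:R * x ord0 i) (k * M)%:R (a%:R : R) => u w z; lra.
Qed.

Lemma cell_enorm k M c x y : (0 < M)%N -> @cell k M c x -> @cell k M c y ->
  enorm (x - y) <= n.+1%:R / M%:R.
Proof.
move=> M0 cx cy; have MR : 0 < M%:R :> R by rewrite ltr0n.
have xy i : `|(x - y) ord0 i| <= M%:R^-1.
  rewrite -(@ler_pM2l _ M%:R)// mulfV ?gt_eqF// -[X in X * `|_|](gtr0_norm MR) -normrM.
  rewrite !mxE mulrBr ler_norml; have := cx i; have := cy i.
  move: (M%:R * x ord0 i) (M%:R * y ord0 i) ((c i)%:R - (k * M)%:R) => u w z.
  by move=> /andP[? ?] /andP[? ?]; lra.
have q0 : 0 <= n.+1%:R / M%:R :> R by rewrite divr_ge0.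
rewrite /enorm -(ger0_norm q0) -sqrtr_sqr ler_wsqrtr//.
apply: (@le_trans _ _ (\sum_(i < n.+1) (M%:R^-1) ^+ 2)).
  apply: ler_sum => i _; rewrite -[leLHS]real_normK ?num_real//.
  by rewrite lerXn2r ?nnegrE ?invr_ge0// ltW.
rewrite sumr_const card_ord -[leLHS]mulr_natl exprMn ler_wpM2r ?sqr_ge0//.
by rewrite expr2 -[leLHS]mulr1 ler_wpM2l// ler1n.
Qed.

Context (K : V -> R) (mK : measurable_fun [set: RN R n] (K : RN R n -> R)).
Hypothesis K0 : forall x, 0 <= K x.
Context (C s : R) (C0 : 0 < C) (s01 : 0 < s < 1).
Hypothesis KC : forall h, h != 0 -> C * enorm h `^ (- n.+1%:R - s) <= K h.
Context (A : set V) (mA : measurable (A : set (RN R n))) (Aoo : (leb A < +oo)%E).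
Hypothesis mJ : measurable_fun setT (fun y : RN R n =>
  \int[leb]_(x in (A : set (RN R n))) (K ((x : V) - (y : V) + 0)%R)%:E)%E.

Lemma enorm_gt0 (z : V) : z != 0 -> 0 < enorm z.
Proof.
move=> z0; rewrite /enorm sqrtr_gt0 lt0r sumr_ge0 ?andbT; last by move=> i _; exact: sqr_ge0.
rewrite psumr_neq0; last by move=> i _; exact: sqr_ge0.
have /rV0Pn[i zi] := z0.
by apply/hasP; exists i; rewrite ?mem_index_enum//= lt0r sqr_ge0 andbT expf_neq0.
Qed.

(* The cells of side 1/M carrying at least half of the average mass cover half of
   [A], and [K] is at least [C (M/N)^(N+s)] on differences within a cell. *)
Lemma pair_energy_cells (k M : nat) (m : R) : A `<=` cube k -> (0 < M)%N -> leb A = m%:E -> 0 < m ->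
  ((C * (M%:R / n.+1%:R) `^ (n.+1%:R + s) / ((2 * k * M).+1 ^ n.+1)%:R * (m ^+ 2 / 4))%:E
    <= pair_energy K A 0)%E.
Proof.
move=> Ak M0 Am m0; have MR : 0 < M%:R :> R by rewrite ltr0n.
pose kappa := C * (M%:R / n.+1%:R) `^ (n.+1%:R + s).
have kappa0 : 0 <= kappa by rewrite mulr_ge0 ?powR_ge0// ltW.
pose nF := ((2 * k * M).+1 ^ n.+1)%N.
have nF0 : 0 < nF%:R :> R by rewrite ltr0n expn_gt0.
pose eta := m / 2 / nF%:R.
have eta0 : 0 <= eta by rewrite !divr_ge0// ltW.
have Feta : #|{ffun 'I_n.+1 -> 'I_(2 * k * M).+1}|%:R * eta <= m / 2.
  by rewrite card_ffun !card_ord -/nF /eta mulrC divfK// gt_eqF.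
have [mgood] := popular_cells mA (@measurable_cell k M) (subset_trans Ak (@cube_sub_cells k M))
  Am eta0 Feta.
set good := \bigcup_(c in _) _ => good_ge.
have Kcell (c : {ffun 'I_n.+1 -> 'I_(2 * k * M).+1}) x y : cell c x -> cell c y -> x != y -> kappa <= K (x - y + 0).
  move=> cx cy xy; rewrite addr0; have z0 : x - y != 0 by rewrite subr_eq0.
  apply: le_trans (KC z0); rewrite /kappa; apply: ler_wpM2l; first exact: ltW.
  have e0 := enorm_gt0 z0.
  have -> : - n.+1%:R - s = - (n.+1%:R + s) by rewrite opprD.
  have p0 : 0 <= n.+1%:R + s by case/andP: s01 => /ltW s0 _; rewrite addr_ge0.
  rewrite powRN -[leRHS]div1r ler_pdivlMr ?powR_gt0//.
  rewrite -powRM ?divr_ge0//; last exact: ltW.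
  apply: (@le_trans _ _ (1 `^ (n.+1%:R + s))); last by rewrite powR1.
  apply: ge0_ler_powR => //.
  - by rewrite nnegrE mulr_ge0 ?divr_ge0// ltW.
  - by rewrite nnegrE.
  have := cell_enorm M0 cx cy; rewrite mulrAC ler_pdivrMr// ler_pdivlMr// mul1r.
  by rewrite mulrC.
pose J (y : RN R n) := (\int[leb]_(x in (A : set (RN R n))) (K ((x : V) - (y : V) + 0)%R)%:E)%E.
have Jge y : good y -> ((kappa * eta)%:E <= J y)%E.
  move=> [c /= ceta [Ay cy]].
  have my : measurable ([set y] : set (RN R n)) by exact: measurable_point.
  have mAc : measurable (A `&` cell c : set (RN R n)).
    by apply: measurableI => //; exact: measurable_cell.
  (* The point [y] is left out because the lower bound on [K] says nothing at the origin. *)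
  pose B : set (RN R n) := (A `&` cell c) `\` [set y].
  have mB : measurable B by exact: measurableD.
  have Beta : (eta%:E <= leb B)%E.
    apply: le_trans (ltW ceta) _.
    apply: (@le_trans _ _ (leb (B `|` [set y]))).
      apply: le_measure => //; rewrite ?inE//; first exact: measurableU.
      by move=> x Ax; have [->|xy] := pselect (x = y); [right|left].
    apply: le_trans (measureU2 leb mB my) _.
    by rewrite [X in (_ + X)%E](lebesgueN_set1 y) adde0.
  have Ky0 (x : RN R n) : (0 <= (K ((x : V) - (y : V) + 0)%R)%:E)%E by rewrite lee_fin.
  have mKy D : measurable_fun (D : set (RN R n)) (fun x : RN R n => (K ((x : V) - (y : V) + 0)%R)%:E).
    apply/measurable_funTS/measurable_EFinP.
    rewrite (_ : (fun x => _) = (K : RN R n -> R) \o (fun x : RN R n => (x : V) + - (y : V) : RN R n)%R).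
      exact: (measurableT_comp mK (measurable_translation (- (y : V)))).
    by apply/funext => x /=; rewrite addr0.
  have BA : B `<=` A by move=> x [[]].
  apply: (@le_trans _ _ (\int[leb]_(x in B) (K ((x : V) - (y : V) + 0)%R)%:E)%E); last first.
    exact: (ge0_subset_integral leb mB mA (@mKy A) (fun x _ => Ky0 x) BA).
  apply: (@le_trans _ _ (\int[leb]_(x in B) cst kappa%:E x)%E); last first.
    have k0 (x : RN R n) : B x -> (0 <= cst kappa%:E x)%E by rewrite lee_fin.
    apply: (@ge0_le_integral _ _ _ leb _ mB _ _ k0 (measurable_cst _) (@mKy B)) => x [[_ cx] xy].
    by rewrite lee_fin; apply: (Kcell c) => //; exact/eqP.
  by rewrite integral_cst// EFinM lee_wpmul2l// lee_fin.
have J0 y : (0 <= J y)%E by apply: integral_ge0 => x _; rewrite lee_fin.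
have goodA : good `<=` A by move=> x [c _ []].
have mJA : measurable_fun (A : set (RN R n)) J by exact: measurable_funTS.
have mJg : measurable_fun (good : set (RN R n)) J by exact: measurable_funTS.
apply: (@le_trans _ _ (\int[leb]_(y in (good : set (RN R n))) J y)%E); last first.
  exact: (ge0_subset_integral leb mgood mA mJA (fun y _ => J0 y) goodA).
apply: (@le_trans _ _ (\int[leb]_(y in (good : set (RN R n))) cst (kappa * eta)%:E y)%E); last first.
  have ke0 (y : RN R n) : good y -> (0 <= cst (kappa * eta)%:E y)%E by rewrite lee_fin mulr_ge0.
  exact: (@ge0_le_integral _ _ _ leb _ mgood _ _ ke0 (measurable_cst _) mJg Jge).
rewrite integral_cst//; apply: (@le_trans _ _ ((kappa * eta)%:E * (m / 2)%:E)%E); last first.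
  by rewrite lee_wpmul2l// lee_fin mulr_ge0.
rewrite -EFinM lee_fin /eta /kappa -/nF expr2.
have nF1 : nF%:R != 0 :> R by rewrite gt_eqF.
rewrite le_eqVlt; apply/orP; left; apply/eqP; field.
exact: nF1.
Qed.
End fractional_kernel.

Section singular_kernel.
Context {R : realType} {n : nat}.
Local Notation V := 'rV[R]_n.+1.
Local Notation leb := (@lebesgueN R n).
Context (K : V -> R) (mK : measurable_fun [set: RN R n] (K : RN R n -> R)).
Hypothesis K0 : forall x, 0 <= K x.
Context (A : set V) (mA : measurable (A : set (RN R n))) (Apos : (0 < leb A)%E) (Aoo : (leb A < +oo)%E).
Hypothesis mJ : forall w, measurable_fun setT (fun y : RN R n =>
  \int[leb]_(x in (A : set (RN R n))) (K ((x : V) - (y : V) + w)%R)%:E)%E.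

(** On cells of side [1 / M] the kernel gains a factor of order M^(N+s), while spreading the mass
    over about M^N cells loses only M^N. The lower bound grows like M^s and passes every [B]. *)
Lemma singular_pair_energy (C s : R) (k : nat) : 0 < C -> 0 < s < 1 ->
  (forall h, h != 0 -> C * enorm h `^ (- n.+1%:R - s) <= K h) ->
  A `<=` cube k.+1 -> pair_energy K A 0 = +oo%E.
Proof.
move=> C0 s01 KC Ak; have /andP[s0 _] := s01.
have mfin : leb A \is a fin_num by rewrite ge0_fin_numE.
have Am : leb A = (fine (leb A))%:E by rewrite fineK.
have m0 : 0 < fine (leb A) by rewrite -lte_fin fineK.
set m := fine _ in Am m0.
(* A lower bound, uniform in [M >= 1], for [M / N] divided by the number of cells in one direction,
   obtained from [2 * k.+1 * M + 1 <= 3 * k.+1 * M]. *)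
pose d : R := ((3 * k.+1 * n.+1)%:R)^-1.
have d0 : 0 < d by rewrite invr_gt0 ltr0n.
pose D := C * d ^+ n.+1 * (m ^+ 2 / 4).
have D0 : 0 < D by rewrite !mulr_gt0// ?exprn_gt0// invr_gt0.
apply/eqyP => B B0.
(* The solution of [D * q ^ s = B]; [M] is then chosen with [M / N >= q]. *)
pose q := (B / D) `^ s^-1.
have q0 : 0 <= q by exact: powR_ge0.
pose M := (Num.bound (q * n.+1%:R)).+1.
have Mq : q <= M%:R / n.+1%:R.
  rewrite ler_pdivlMr ?ltr0n//; apply: ltW.
  apply: lt_trans (archi_boundP _) _; first by rewrite mulr_ge0.
  by rewrite ltr_nat.
have MN0 : 0 < M%:R / n.+1%:R :> R by rewrite divr_gt0 ?ltr0n.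
have H := pair_energy_cells mK K0 C0 s01 KC mA (mJ 0) Ak (ltn0Sn (Num.bound (q * n.+1%:R))) Am m0.
apply: (le_trans _ H).
rewrite lee_fin -/M.
have Bs : B / D <= (M%:R / n.+1%:R) `^ s.
  have -> : B / D = q `^ s.
    by rewrite /q -powRrM mulVf ?gt_eqF// powRr1// divr_ge0// ltW.
  by apply: ge0_ler_powR; rewrite ?nnegrE// ltW.
rewrite powRD; last by apply/implyP => _; exact: lt0r_neq0 MN0.
rewrite (powR_mulrn _ (ltW MN0)) natrX.
have base0 : d <= M%:R / n.+1%:R / (2 * k.+1 * M).+1%:R :> R.
  rewrite ler_pdivlMr ?ltr0n// ler_pdivlMr ?ltr0n// -mulrA /d mulrC ler_pdivrMr ?ltr0n//.
  rewrite -!natrM ler_nat mulnA leq_mul2r/=.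
  rewrite (mulnC M) -[3%N]/(2 + 1)%N !mulnDl mul1n -addn1 leq_add2l muln_gt0.
  by [].
have base : d ^+ n.+1 <= (M%:R / n.+1%:R) ^+ n.+1 / (2 * k.+1 * M).+1%:R ^+ n.+1 :> R.
  by rewrite -expr_div_n; apply: lerXn2r; rewrite ?nnegrE ?divr_ge0 ?(ltW d0).
rewrite ler_pdivrMr // in Bs.
apply: (le_trans Bs).
rewrite /D; move: base Bs.
have E2 : 0 <= (2 * k.+1 * M).+1%:R ^+ n.+1 :> R by rewrite exprn_ge0.
move: ((M%:R / n.+1%:R) `^ s) (powR_ge0 (M%:R / n.+1%:R) s) => P P0 base _.
set T := (M%:R / _) ^+ _ in base *; set U := (2 * k.+1 * M).+1%:R ^+ _ in E2 base *.
have -> : C * (T * P) / U * (m ^+ 2 / 4) = C * P * (m ^+ 2 / 4) * (T / U) by ring.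
have -> : P * (C * d ^+ n.+1 * (m ^+ 2 / 4)) = C * P * (m ^+ 2 / 4) * d ^+ n.+1 by ring.
by apply: (ler_wpM2l _ base); rewrite !mulr_ge0 ?sqr_ge0 ?invr_ge0 ?(ltW C0)// ?exprn_ge0// ltW.
Qed.

(* Away from the origin a fractional kernel is integrable. *)
Lemma translated_pair_energy_lty (w : V) (i : 'I_n.+1) :
  leb.-integrable [set: RN R n] (fun h : V => (Num.min 1 (enorm h) * K h)%:E) ->
  w ord0 i != 0 ->
  (forall x y, A x -> A y -> `|x ord0 i - y ord0 i| < `|w ord0 i| / 2) ->
  (pair_energy K A w < +oo)%E.
Proof.
move=> iK wi0 Aw.
have a0 : 0 < `|w ord0 i| / 2 by rewrite divr_gt0 ?normr_gt0.
set a := `|w ord0 i| / 2 in Aw a0.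
(* On the differences [x - y + w] the i-th coordinate has absolute value at least [a], so the weight
   [Num.min 1 (enorm z)] is at least [b] there and [psi] dominates [K]. *)
pose b := Num.min 1 a.
have b0 : 0 < b by rewrite lt_min ltr01.
have en0 (z : V) : 0 <= Num.min 1 (enorm z) by rewrite le_min ler01 sqrtr_ge0.
have ei (z : V) : `|z ord0 i| <= enorm z.
  rewrite /enorm -sqrtr_sqr ler_wsqrtr//.
  by rewrite (bigD1 i)//= lerDl sumr_ge0// => j _; exact: sqr_ge0.
pose psi (z : V) := b^-1 * (Num.min 1 (enorm z) * K z).
have m1 : measurable_fun [set: RN R n] (fun z : RN R n => Num.min 1 (enorm (z : V)) * K (z : V)).
  by apply/measurable_EFinP; exact: (measurable_int _ iK).
have mpsi : measurable_fun [set: RN R n] (psi : RN R n -> R).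
  exact: (measurable_funM (measurable_cst b^-1) m1).
have psi0 z : 0 <= psi z by rewrite mulr_ge0 ?invr_ge0 ?mulr_ge0// ltW.
have psioo : (\int[leb]_x (psi (x : V))%:E < +oo)%E.
  have i2 : leb.-integrable [set: RN R n] (fun z => (b^-1)%:E * (Num.min 1 (enorm (z : V)) * K (z : V))%:E)%E.
    exact: (@integrableZl _ _ _ leb _ measurableT b^-1 _ iK).
  have /integrableP[_] := i2.
  apply: le_lt_trans; rewrite le_eqVlt; apply/orP; left; apply/eqP; apply: eq_integral => z _.
  by rewrite -EFinM gee0_abs// lee_fin; exact: psi0.
apply: (pair_energy_lty mK K0 mA Aoo mJ mpsi psi0 psioo) => x y Ax Ay.
rewrite /psi mulrA ler_peMl// ler_pdivlMl// mulr1 /b.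
rewrite le_min ge_min lexx/= ge_min; apply/orP; right.
apply: le_trans (ei _); rewrite !mxE.
have := Aw x y Ax Ay; rewrite /a; move: (x ord0 i - y ord0 i) (w ord0 i) => u c.
have := ler_normD (u + c) (- u); rewrite normrN [u + c]addrC addrK.
lra.
Qed.
End singular_kernel.

Section concentration.
Context {R : realType} {n : nat}.
Local Notation V := 'rV[R]_n.+1.
Local Notation leb := (@lebesgueN R n).
Context (K : V -> R) (mK : measurable_fun [set: RN R n] (K : RN R n -> R)).
Hypothesis K0 : forall x, 0 <= K x.

(* A fractional kernel has infinite self-interaction; an integrable one satisfies
   [K (z + w) < K z] for [z] near the origin. *)
Lemma small_diameter_energy_lt (w : V) : fractional_type K \/ integrable_type K -> w != 0 ->
  exists2 r : R, 0 < r & forall (A : set V) k, measurable (A : set (RN R n)) ->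
    (0 < leb A)%E -> (leb A < +oo)%E -> A `<=` cube k.+1 ->
    (forall u, measurable_fun setT (fun y : RN R n =>
      \int[leb]_(x in (A : set (RN R n))) (K ((x : V) - (y : V) + u)%R)%:E)%E) ->
    (forall x y, A x -> A y -> forall i, `|x ord0 i - y ord0 i| < r) ->
    (pair_energy K A w < pair_energy K A 0)%E.
Proof.
move=> [[iK [C [s [C0 s01 KC]]]] w0|[iK _ Klim] w0].
  have /rV0Pn[i wi] := w0.
  exists (`|w ord0 i| / 2); first by rewrite divr_gt0 ?normr_gt0.
  move=> A k mA Apos Aoo Ak mJ Ar.
  rewrite (singular_pair_energy mK K0 mA Apos Aoo mJ C0 s01 KC Ak).
  exact: (translated_pair_energy_lty mK K0 mA Aoo mJ iK wi (fun x y Ax Ay => Ar x y Ax Ay i)).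
have [r r0 rK] := limf_einf_dnbhs0_gt0 (Klim w w0).
exists r => // A k mA Apos Aoo Ak mJ Ar.
have Koo : (\int[leb]_x (K (x : V))%:E < +oo)%E.
  have /integrableP[_] := iK; apply: le_lt_trans; rewrite le_eqVlt; apply/orP; left; apply/eqP.
  by apply: eq_integral => z _; rewrite /= ger0_norm.
apply: (pair_energy_lt mK K0 mA Aoo mJ Apos mK K0 Koo) => // x y Ax Ay xy.
rewrite addr0 -subr_gt0; apply: rK; first by rewrite subr_eq0.
by move=> i; rewrite !mxE; exact: Ar.
Qed.

Context (X : set V) (mX : measurable (X : set (RN R n))) (Xoo : (leb X < +oo)%E).
Context (k : nat) (Xk : X `<=` cube k.+1).
Context (L : zmodType) (v : L -> V).
Hypotheses (vD : {morph v : a b / a + b >-> a + b}) (vinj : injective v).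
Context (N : set V) (mN : measurable (N : set (RN R n))) (N0 : leb N = 0%E).
Hypothesis mK' : forall g, measurable_fun setT (fun p => off_null K N (shifted_difference g p)).
Local Notation nu := (mfrestr mX Xoo).

Lemma concentrated_self_interaction (A : set (RN R n)) (h : L) :
  fractional_type K \/ integrable_type K ->
  measurable A -> (0 < nu A)%E -> h != 0 ->
  exists A' : set (RN R n), [/\ measurable A', A' `<=` A, (0 < nu A')%E &
    (self_interaction A' nu (cell_kernel v K N) h +
     self_interaction A' nu (cell_kernel v K N) (- h) <
     self_interaction A' nu (cell_kernel v K N) 0 +
     self_interaction A' nu (cell_kernel v K N) 0)%E].
Proof.
move=> Ktype mA Apos h0.
have v0 := label0 vD.
have vN : v (- h) = - v h by rewrite -sub0r labelB// v0 sub0r.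
have vh0 : v h != 0 by rewrite -v0 (inj_eq vinj).
have [r1 r10 H1] := small_diameter_energy_lt Ktype vh0.
have vNh0 : - v h != 0 by rewrite oppr_eq0.
have [r2 r20 H2] := small_diameter_energy_lt Ktype vNh0.
have t0 : 0 < Num.min r1 r2 by rewrite lt_min r10.
have [A' [mA' A'AX A'pos A't]] := small_positive_part mA Apos t0.
have A'X : A' `<=` X by move=> x /A'AX[].
have A'oo : (leb A' < +oo)%E.
  by apply: le_lt_trans Xoo; apply: le_measure; rewrite ?inE.
have mJ u := measurable_inner_energy mK K0 mN N0 mK' u mA'.
exists A'; split => //.
- by move=> x /A'AX[].
- by rewrite /mfrestr /mrestr setIidl.
rewrite !(self_interactionE mX Xoo v mK K0 mN N0 mK' _ mA' A'X) vN v0.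
have A'k := subset_trans A'X Xk.
apply: lteD.
  apply: (H1 A' k mA' A'pos A'oo A'k mJ) => x y Ax Ay i.
  by have := A't x y Ax Ay i; rewrite lt_min => /andP[].
apply: (H2 A' k mA' A'pos A'oo A'k mJ) => x y Ax Ay i.
by have := A't x y Ax Ay i; rewrite lt_min => /andP[].
Qed.
End concentration.

(** * Fundamental domains and their labellings *)

Section domains_and_labels.
Context {R : realType} {n : nat}.
Local Notation V := 'rV[R]_n.+1.
Local Notation leb := (@lebesgueN R n).
Context (G : set V) (X : set V) (mX : measurable (X : set (RN R n))).
Hypothesis Xoo : (leb X < +oo)%E.
Hypothesis Xcover : forall x, exists2 g, G g & X (x - g).
Hypothesis Xdisj : forall x g, X x -> G g -> X (x + g) -> g = 0.
Context (L : zmodType) (e : nat -> L) (e' : L -> nat) (v : L -> V).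
Hypotheses (eK : cancel e e') (e'K : cancel e' e).
Hypotheses (vD : {morph v : a b / a + b >-> a + b}) (vinj : injective v).
Hypothesis vG : forall x, G x <-> exists a, v a = x.
Local Notation nu := (mfrestr mX Xoo).

Let vN a : v (- a) = - v a.
Proof. by rewrite -sub0r (labelB vD) (label0 vD) sub0r. Qed.

Let null_bigcup (B : nat -> set V) : (forall k, measurable (B k : set (RN R n))) ->
  (forall k, leb (B k) = 0%E) -> leb (\bigcup_k B k) = 0%E.
Proof.
move=> mB B0.
have mU : measurable (\bigcup_k B k : set (RN R n)) by exact: bigcupT_measurable.
apply: (measure_negligible mU); apply: negligible_bigcup => k.
by exists (B k); split; [exact: mB|exact: B0|].
Qed.

Lemma fuzzy_of_domain (E : set V) : fundamental_domain G E ->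
  exists f : L -> RN R n -> R, fuzzy f /\
    forall g, ae_eq nu setT (fun x : RN R n => \1_E ((x : V) + v g)) (f g).
Proof.
move=> [mE Ecover Edisj].
have mEt a : measurable ([set x | E (x + v a)] : set (RN R n)).
  rewrite (_ : mkset _ = translate E (- v a)); first exact: measurable_translate.
  apply/seteqP; split => x; first by move=> Ex; exists (x + v a) => //; rewrite addrK.
  by move=> [z Ez <-]; rewrite /= subrK.
pose B1 : set V := ~` \bigcup_k [set x | E (x + v (e k))].
pose C i j : set V := [set x | E (x + v (e i))] `&` [set x | E (x + v (e j))].
pose B2 i j : set V := if i == j then set0 else C i j.
pose B : set V := B1 `|` \bigcup_i \bigcup_j B2 i j.
have mB1 : measurable (B1 : set (RN R n)).
  by apply: measurableC; apply: bigcupT_measurable => k; exact: mEt.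
have mB2 i j : measurable (B2 i j : set (RN R n)).
  by rewrite /B2; case: ifP => _; [exact: measurable0|apply: measurableI; exact: mEt].
have mB2i i : measurable (\bigcup_j B2 i j : set (RN R n)) by exact: bigcupT_measurable.
have mB22 : measurable (\bigcup_i \bigcup_j B2 i j : set (RN R n)) by exact: bigcupT_measurable.
have mB : measurable (B : set (RN R n)) by exact: measurableU.
have B10 : leb B1 = 0%E.
  rewrite -Ecover; congr (leb _); congr (~` _).
  apply/seteqP; split => x.
    move=> [k _ Ex]; exists (- v (e k)); first by apply/vG; exists (- e k).
    by exists (x + v (e k)) => //; rewrite addrK.
  move=> [g /vG[a <-] [y Ey <-]]; exists (e' (- a)) => //=.
  by rewrite e'K vN addrK.
have B20 i j : leb (B2 i j) = 0%E.
  rewrite /B2; case: eqP => [_|/eqP ij]; first exact: measure0.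
  have d0 : v (e i - e j) != 0.
    by rewrite -(label0 vD) (inj_eq vinj) subr_eq0 (inj_eq (can_inj eK)).
  have Gd : G (v (e i - e j)) by apply/vG; exists (e i - e j).
  apply: (etrans _ (etrans (lebesgueN_translate _ (- v (e i))) (Edisj _ Gd d0))).
  congr (leb _); apply/seteqP; split => x.
    move=> [Ei Ej]; exists (x + v (e i)); last by rewrite addrK.
    split=> //; exists (x + v (e j)) => //.
    by rewrite (labelB vD) [v (e i) - _]addrC addrA addrK.
  move=> [y [Ey [z Ez zy]] <-]; split; rewrite /= ?subrK//.
  by rewrite -zy (labelB vD) addrA [z + _ - _]addrAC addrK subrK.
have B0 : leb B = 0%E.
  apply: (measure_negligible mB); apply: negligibleU.
    by exists B1; split.
  exists (\bigcup_i \bigcup_j B2 i j); split => //.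
  apply: null_bigcup => // i; exact: null_bigcup.
(* On the null set [B] of points lying in no piece or in several, label 0 is imposed, because a
   labelling has to sum to 1 at every point. *)
pose f (g : L) (x : RN R n) : R :=
  \1_B x * (if g == 0 then 1 else 0) + \1_(~` B) x * \1_E ((x : V) + v g).
have fB g x : ~ B x -> \1_E (x + v g) = f g x.
  by move=> nB; rewrite /f [\1_B x]indicE [\1_(~` B) x]indicE memNset// mem_set// mul0r add0r mul1r.
exists f; split.
  split=> [g|g x|x].
  - apply: measurable_funD; apply: measurable_funM.
    + exact: measurable_indic.
    + exact: measurable_cst.
    + by apply: measurable_indic; exact: measurableC.
    + exact: (measurableT_comp (measurable_indic mE) (measurable_translation (v g))).
  - by rewrite addr_ge0// mulr_ge0//; case: ifP.
  have [Bx|nBx] := pselect (B x).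
    rewrite -[RHS](@esum_single R L 0 1%E)//; apply: eq_esum => g _.
    rewrite /f [\1_B x]indicE [\1_(~` B) x]indicE mem_set// memNset/=; last by move=> /(_ Bx).
    by rewrite mul0r addr0 mul1r; case: ifP.
  have [i Ei] : exists i, E ((x : V) + v (e i)).
    apply: contrapT => H; apply: nBx; left=> -[k _ Ek]; apply: H; by exists k.
  rewrite -[RHS](@esum_single R L (e i) 1%E)//; apply: eq_esum => g _.
  rewrite -fB//; case: eqP => [->|gi]; first by rewrite indicE mem_set.
  rewrite indicE memNset// => Eg; apply: nBx; right; exists i => //; exists (e' g) => //.
  rewrite /B2; case: eqP => [ig|_]; first by case: gi; rewrite ig e'K.
  by split => //=; rewrite e'K.
move=> g; exists B; split => //.
  apply/eqP; rewrite -measure_le0 -B0; apply: le_measure; rewrite ?inE//.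
  exact: measurableI.
by move=> x /= H; apply: contrapT => nB; apply: H => _; exact: fB.
Qed.

(** Keeping only the points where a label has value exactly 1 makes distinct translates of [D]
    disjoint outright. Only the covering holds up to a null set: off the points with an intermediate
    value, a total of 1 forces some label to be 1. *)
Lemma domain_of_fuzzy (F : L -> RN R n -> R) : fuzzy F ->
  (forall g, nu [set x | 0 < F g x < 1] = 0%E) ->
  exists D : set V, fundamental_domain G D /\
    forall g, ae_eq nu setT (fun x : RN R n => \1_D ((x : V) + v g)) (F g).
Proof.
move=> fF F01; have [mF F0 F1] := fF.
have mFs g S : measurable S -> measurable (F g @^-1` S).
  by move=> mS; rewrite -[X in measurable X]setTI; exact: mF.
pose Y g : set V := X `&` F g @^-1` [set 1].
have mY g : measurable (Y g : set (RN R n)).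
  by apply: measurableI => //; apply: mFs; exact: measurable_set1.
pose D : set V := \bigcup_k translate (Y (e k)) (v (e k)).
have mD : measurable (D : set (RN R n)).
  by apply: bigcupT_measurable => k; exact: measurable_translate.
have uniqF x g h : F g x = 1 -> F h x = 1 -> g = h.
  move=> Fg Fh; apply/eqP; apply: contrapT => /negP gh.
  have := @fuzzy_sum_le1 _ _ _ _ F [:: g; h] x fF.
  rewrite /= inE gh => /(_ isT); rewrite !big_cons big_nil addr0 Fg Fh; lra.
have DE x g : X x -> D (x + v g) <-> F g x = 1.
  move=> Xx; split; last first.
    by move=> Fg; exists (e' g) => //; rewrite e'K; exists x.
  move=> [k _ [y [Xy Fy] yx]].
  have yE : y = x + v (g - e k) by rewrite (labelB vD) addrA -yx addrK.
  have d0 : v (g - e k) = 0.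
    by apply: (Xdisj Xx); [apply/vG; exists (g - e k)|rewrite -yE].
  have /eqP : g - e k = 0 by apply: vinj; rewrite d0 (label0 vD).
  by rewrite subr_eq0 => /eqP ->; move: yE Fy; rewrite d0 addr0 => ->.
pose M g : set V := F g @^-1` [set t | 0 < t < 1].
have mM g : measurable (M g : set (RN R n)).
  apply: mFs; rewrite (_ : mkset _ = `]0, 1[%classic); first exact: measurable_itv.
  by apply/seteqP; split => t; rewrite /= in_itv.
pose B : set V := \bigcup_k (M (e k) `&` X).
have mMX k : measurable (M (e k) `&` X : set (RN R n)) by exact: measurableI.
have mB : measurable (B : set (RN R n)) by exact: bigcupT_measurable.
have B0 : leb B = 0%E by apply: null_bigcup => // k; exact: F01.
have F01' x g : X x -> ~ B x -> F g x != 1 -> F g x = 0.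
  move=> Xx nB F1x; apply/eqP; apply: contrapT => /negP F0x; apply: nB.
  exists (e' g) => //; rewrite e'K; split => //; rewrite /M/=.
  by have /andP[a b] := fuzzy_ge0_le1 g (x : RN R n) fF; rewrite !lt_neqAle a b F1x eq_sym F0x.
have exF x : X x -> ~ B x -> exists g, F g x = 1.
  move=> Xx nB; apply: contrapT => /forallNP H.
  have := F1 x; rewrite esum1; last first.
    by move=> g _; rewrite F01'//; exact/eqP/H.
  by move=> /eqP; rewrite eq_sym onee_eq0.
exists D; split; last first.
  move=> g; exists (~` X `|` B); split.
  - by apply: measurableU => //; exact: measurableC.
  - rewrite /mfrestr /mrestr; apply/eqP; rewrite -measure_le0 -B0.
    apply: le_measure; rewrite ?inE//.
      by apply: measurableI => //; apply: measurableU => //; exact: measurableC.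
    by move=> x [[nX /nX|]].
  move=> x /= H; apply: contrapT => /not_orP[/contrapT Xx nB]; apply: H => _.
  rewrite indicE; have [F1x|/eqP F1x] := pselect (F g x = 1).
    by rewrite mem_set ?F1x//; exact/(DE x g Xx).
  rewrite (F01' x g Xx nB F1x) memNset// => /(DE x g Xx) E1.
  by rewrite E1 eqxx in F1x.
split=> //.
  pose S : set V := \bigcup_k translate B (v (e k)).
  have S0 : leb S = 0%E.
    apply: null_bigcup => k; first exact: measurable_translate.
    exact: (etrans (lebesgueN_translate _ _) B0).
  apply/eqP; rewrite eq_le measure_ge0 andbT -S0; apply: le_lebesgue_outer => z nz.
  have [g0 Gg0 Xz] := Xcover z.
  have [a av] := (vG g0).1 Gg0.
  have [Bz|nB] := pselect (B (z - g0)).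
    by exists (e' a) => //; rewrite e'K av; exists (z - g0) => //; rewrite subrK.
  have [g Fg] := exF _ Xz nB; exfalso; apply: nz.
  exists (v (a - g)); first by apply/vG; exists (a - g).
  exists (z - g0 + v g); first exact/(DE _ _ Xz).
  by rewrite (labelB vD) av [g0 - _]addrC addrA addrK subrK.
move=> g /vG[c <-] c0.
rewrite (_ : _ `&` _ = set0); first exact: measure0.
apply/seteqP; split => // p [[i _ [x [Xx Fx] xp]] [q [j _ [y [Xy Fy] yq]] qp]].
have yE : y = x + v (e i - c - e j).
  by rewrite !(labelB vD) !addrA xp -qp addrK -yq addrK.
have d0 : v (e i - c - e j) = 0.
  by apply: (Xdisj Xx); [apply/vG; exists (e i - c - e j)|rewrite -yE].
rewrite d0 addr0 in yE.
move: Fy; rewrite yE => Fy; have ij := uniqF x _ _ Fx Fy.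
have : e i - c - e j = 0 by apply: vinj; rewrite d0 (label0 vD).
rewrite ij addrAC subrr sub0r => /eqP; rewrite oppr_eq0 => /eqP c00.
by rewrite c00 (label0 vD) eqxx in c0.
Qed.
End domains_and_labels.

Theorem theorem1p1 (R : realType) (n : nat) (K : 'rV[R]_n.+1 -> R)
    (Kmeas : measurable_fun [set: RN R n] (K : RN R n -> R))
    (Ksym : forall x, K x = K (- x)) (Kge0 : forall x, 0 <= K x)
    (Ktype : fractional_type K \/ integrable_type K)
    (G : set 'rV[R]_n.+1) (latG : lattice G) :
  exists D : set 'rV[R]_n.+1, fundamental_domain G D /\
    forall E : set 'rV[R]_n.+1, fundamental_domain G E ->
      (Per K D <= Per K E)%E.

Proof.
have [X [mX [k Xk] Xcover Xdisj]] := lattice_tile latG.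
(* A cube of positive side, since the constants of the singular estimate divide by it. *)
have Xk1 : X `<=` cube k.+1.
  move=> x /Xk kx i; have := kx i; rewrite !mxE => /andP[x1 x2]; apply/andP; split.
    by apply: le_lt_trans x1; rewrite lerN2 ler_nat.
  by apply: le_trans x2 _; rewrite ler_nat.
have Xoo : (lebesgueN X < +oo)%E.
  apply: (le_lt_trans (le_lebesgue_outer Xk)).
  by apply: le_lt_trans (lebesgueN_box _ _) _; rewrite ltry.
have [u uG] := lattice_enum latG.
have [L [e [e' [v [eK e'K vD vinj vG]]]]] :=
  @transport_zmodType _ G u (lattice0 latG) (latticeB latG) uG.
have [N [mN N0 mK']] := difference_measurable_version Kmeas Kge0.
pose nu : {finite_measure set (RN R n) -> \bar R} := mfrestr mX Xoo.
have mk h : measurable_fun setT (cell_kernel v K N h) := mK' (v h).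
have k0 h p : 0 <= cell_kernel v K N h p by exact: cell_kernel_ge0.
have [F [fF F01 Fmin]] : exists F : L -> RN R n -> R, [/\ fuzzy F,
    forall g, nu [set x | 0 < F g x < 1] = 0%E &
    forall f, fuzzy f -> (energy nu (cell_kernel v K N) F <= energy nu (cell_kernel v K N) f)%E].
  have [F [fF Fmin]] := exists_fuzzy_minimizer eK e'K nu mk k0.
  (* The swap argument cancels the energy and so needs it finite. If the minimum is infinite, all
     labellings have infinite energy and the tile itself is a minimizer. *)
  have [Foo|Foo] := eqVneq (energy nu (cell_kernel v K N) F) +oo%E.
    exists (fun g _ => if g == 0 then 1 else 0); split; first exact: constant_fuzzy.
      move=> g; rewrite (_ : mkset _ = set0); first exact: measure0.
      by apply/seteqP; split => // x /=; case: ifP; rewrite ?ltxx ?andbF.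
    move=> f ff; have := Fmin f ff; rewrite Foo leye_eq => /eqP ->; exact: leey.
  exists F; split => //.
  have Flt : (energy nu (cell_kernel v K N) F < +oo)%E by rewrite ltey.
  apply: (minimizer_zero_one eK e'K mk k0 _ fF Fmin Flt) => A h mA Apos h0.
  exact: (concentrated_self_interaction Kmeas Kge0 Xk1 vD vinj mN N0 mK' Ktype mA Apos h0).
have [D [GD DF]] := domain_of_fuzzy Xcover Xdisj e'K vD vinj vG fF F01.
have PerE := Per_energy Xcover Xdisj eK e'K vD vinj vG Kmeas Kge0 mN N0 mK'.
exists D; split; [exact: GD|move=> E GE].
have [mD _ _] := GD; have [mE _ _] := GE.
have [f [ff fE]] := fuzzy_of_domain mX Xoo eK e'K vD vinj vG GE.
rewrite (PerE mX Xoo D mD F fF DF) (PerE mX Xoo E mE f ff fE); exact: Fmin.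
Qed.
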